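(* For every $F\in\mathbb{D}$, the process $\theta\mapsto F^\theta$ is differentiable in $L^2(\mathbb{P})$ and $$\forall\theta\in\mathbb{R},\qquad \mathbb{E}\Big[\Big(\frac{d}{d\theta}F^\theta\Big)^2\Big]=\sum_{n\in\mathbb{Z}}n^2c_n^2=\mathbb{E}\,\Gamma[F]=2\mathcal{E}[F],$$ where $\mathcal{E}$ is the Ornstein-Uhlenbeck form, $\Gamma$ the associated carré du champ operator, and $(c_n)_{n\in\mathbb{Z}}$ are the coefficients of the spectral representation of the second order stationary process $(F^\theta)_\theta$.
   Context: $B$ is a standard one-dimensional Brownian motion on the Wiener space $(\Omega_1,\mathbb{P}_1)$. $M$ is a normal martingale (a square integrable martingale with $M_0=0$ and $\langle M,M\rangle_t=t$) defined under a probability $\mathbb{P}_2$; $\mathbb{P}=\mathbb{P}_1\times\mathbb{P}_2$, so $M$ is independent of $B$. For $\theta\in\mathbb{R}$, $Y^\theta_t=B_t\cos\theta+M_t\sin\theta$, a normal martingale with $Y^0=B$. For symmetric $f_n\in L^2(\mathbb{R}_+^n)$, $I_n(f_n)$ denotes the multiple stochastic integral with respect to $B$ and $I_n^\theta(f_n)=n!\int_{0<s_1<\cdots<s_n}f_n\,dY^\theta_{s_1}\cdots dY^\theta_{s_n}$ the one with respect to $Y^\theta$. If $F=\sum_{n\ge0} I_n(f_n)\in L^2(\mathbb{P}_1)$, its chaotic extension is $F^\theta=\sum_{n\ge0}I_n^\theta(f_n)\in L^2(\mathbb{P})$. $\mathbb{D}$ is the domain of the Ornstein-Uhlenbeck form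 on Wiener space: $F=\sum_n I_n(f_n)\in\mathbb{D}$ iff $\sum_n n\,n!\,\|f_n\|^2_{L^2}<\infty$. With $D$ the Malliavin derivative, $\Gamma[F]=\int_0^\infty (D_sF)^2ds$ and $\mathcal{E}[F]=\frac12\mathbb{E}\,\Gamma[F]$. The process $\theta\mapsto F^\theta$ is $2\pi$-periodic, second order stationary and continuous in $L^2(\mathbb{P})$, so it has a spectral representation $F^\theta=\sum_{n\in\mathbb{Z}}c_ne^{in\theta}\xi_n$ with real $c_n\geq0$ and $\xi_n$ orthonormal in $L^2_{\mathbb{C}}(\mathbb{P})$; equivalently $\mathbb{E}[F^{\theta+\varphi}F^\theta]=\sum_{n\in\mathbb{Z}}c_n^2e^{in\varphi}$. *)

(* Defs.v *)
From HB Require Import structures.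
From mathcomp Require Import all_boot all_order all_fingroup all_algebra.
From mathcomp Require Import all_classical all_reals all_analysis.
From mathcomp Require Import complex.

Set Implicit Arguments.
Unset Strict Implicit.
Unset Printing Implicit Defensive.

Import Order.TTheory GRing.Theory Num.Theory.
Import numFieldNormedType.Exports.

Local Open Scope classical_set_scope.
Local Open Scope ring_scope.

(* The time set R_+ is rendered by processes indexed by R, of which only the
   values at nonnegative times are ever constrained or used. Random variables
   are functions, so an equality in L^2 is stated for all versions. *)

Section L2.
Context {R : realType} {d : measure_display} {T : measurableType d}.
Variable P : probability T R.

Definition L2_norm (X : T -> R) : \bar R := Lnorm P 2%:E (EFin \o X).

Definition L2_cvg (X : nat -> T -> R) (Y : T -> R) : Prop :=
  L2_norm (X n \- Y) @[n --> \oo] --> 0%E.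

Definition L2_derivative (X : R -> T -> R) (t : R) (Z : T -> R) : Prop :=
  Z \in Lfun P 2%:E /\
  L2_norm (fun w => h^-1 * (X (t + h) w - X t w) - Z w) @[h --> 0^'] --> 0%E.

Definition L2_differentiable (X : R -> T -> R) : Prop :=
  forall t, exists Z, L2_derivative X t Z.

End L2.

Section processes.
Context {R : realType} {d : measure_display} {T : measurableType d}.
Variable P : probability T R.

Definition mutually_independent (n : nat) (X : nat -> T -> R) : Prop :=
  forall A : nat -> set R, (forall i, measurable (A i)) ->
    P (\bigcap_(i < n) (X i @^-1` A i)) =
    (\prod_(i < n) P (X i @^-1` A i))%E.

Definition brownian_motion (B : R -> T -> R) : Prop :=
  [/\ forall t, 0 <= t -> measurable_fun [set: T] (B t),
      {ae P, forall w, B 0 w = 0},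
      (forall s t, 0 <= s -> s < t -> forall A : set R, measurable A ->
         P ((B t \- B s) @^-1` A) = normal_prob 0 (Num.sqrt (t - s)) A),
      (forall (n : nat) (t : nat -> R), 0 <= t 0 ->
         (forall i, t i <= t i.+1) ->
         mutually_independent n (fun i => B (t i.+1) \- B (t i))) &
      {ae P, forall w, {within `[0, +oo[, continuous (B ^~ w)}}].

Definition filtration (G : R -> set (set T)) : Prop :=
  (forall t, 0 <= t ->
     sigma_algebra [set: T] (G t) /\ G t `<=` @measurable d T) /\
  (forall s t, 0 <= s -> s <= t -> G s `<=` G t).

Definition martingale (G : R -> set (set T)) (X : R -> T -> R) : Prop :=
  [/\ forall t, 0 <= t -> forall A : set R, measurable A -> G t (X t @^-1` A),
      forall t, 0 <= t -> P.-integrable [set: T] (EFin \o X t) &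
      forall s t, 0 <= s -> s <= t -> forall A, G s A ->
        (\int[P]_(w in A) (X t w)%:E = \int[P]_(w in A) (X s w)%:E)%E].

(* The last clause says <M, M>_t = t: the deterministic process t is
   predictable and increasing, hence it is the angle bracket of M as soon as
   it compensates M^2. *)
Definition normal_martingale (G : R -> set (set T)) (M : R -> T -> R) : Prop :=
  [/\ filtration G, martingale G M,
      forall t, 0 <= t -> M t \in Lfun P 2%:E,
      {ae P, forall w, M 0 w = 0} &
      martingale G (fun t w => M t w ^+ 2 - t)].

End processes.

Section kernels.
Context {R : realType}.

(* Lebesgue integral over R_+^n of a nonnegative measurable function, as an
   iterated integral (Tonelli); for n = 0 it is the value at the only point
   of R^0. *)
Fixpoint integral_Rn (n : nat) : (n.-tuple R -> \bar R) -> \bar R :=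
  match n return (n.-tuple R -> \bar R) -> \bar R with
  | 0 => fun f => f [tuple]
  | n'.+1 => fun f =>
      (\int[lebesgue_measure]_(s in `[0%R, +oo[)
         integral_Rn (fun x : n'.-tuple R => f [tuple of s :: x]))%E
  end.

Definition sqnorm (n : nat) (f : n.-tuple R -> R) : \bar R :=
  integral_Rn (fun x => (f x ^+ 2)%:E).

Definition symmetric_L2 (n : nat) (f : n.-tuple R -> R) : Prop :=
  [/\ measurable_fun [set: n.-tuple R] f, (sqnorm f < +oo)%E &
      forall (s : {perm 'I_n}) (x : n.-tuple R),
        f [tuple tnth x (s i) | i < n] = f x].

(* A term (a, ((s_1, t_1), ..., (s_n, t_n))) stands for
   a 1_{]s_1, t_1] x ... x ]s_n, t_n]}. *)
Definition step (n : nat) : Type := seq (R * n.-tuple (R * R)).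

(* 0 <= s_1 <= t_1 <= s_2 <= ... <= t_n, so that the box lies in the simplex
   0 < x_1 < ... < x_n. *)
Definition ordered_step (n : nat) (e : step n) : bool :=
  all (fun b : R * n.-tuple (R * R) =>
         path <=%R 0 (flatten [seq [:: p.1; p.2] | p <- b.2])) e.

Definition step_fun (n : nat) (e : step n) (x : n.-tuple R) : R :=
  \sum_(b <- e) b.1 *
    \prod_(i < n) \1_(`](tnth b.2 i).1, (tnth b.2 i).2]) (tnth x i).

Definition on_simplex (n : nat) (f : n.-tuple R -> R) (x : n.-tuple R) : R :=
  if path <%R 0 x then f x else 0.

End kernels.

Section chaos.
Context {R : realType} {d : measure_display} {T : measurableType d}.
Variables (P : probability T R) (Y : R -> T -> R).

(* Iterated integral over 0 < s_1 < ... < s_n of an ordered step function. *)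
Definition step_integral (n : nat) (e : step n) (w : T) : R :=
  \sum_(b <- e) b.1 *
    \prod_(i < n) (Y (tnth b.2 i).2 w - Y (tnth b.2 i).1 w).

(* J is a version of n! \int_{0 < s_1 < ... < s_n} f dY_{s_1} ... dY_{s_n}:
   for Y a normal martingale, step_integral is an isometry from the step
   functions in L^2 of the simplex to L^2(P), and the iterated integral is its
   extension by density. *)
Definition multiple_integral (n : nat) (f : n.-tuple R -> R) (J : T -> R) :
    Prop :=
  J \in Lfun P 2%:E /\
  exists e : nat -> step n,
    [/\ forall k, ordered_step (e k),
        sqnorm (step_fun (e k) \- on_simplex f) @[k --> \oo] --> 0%E &
        L2_cvg P (fun k w => n`!%:R * step_integral (e k) w) J].

(* F = \sum_(n >= 0) I_n(f_n) in L^2(P), integrals being taken against Y. *)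
Definition chaos_expansion (f : forall n, n.-tuple R -> R) (F : T -> R) :
    Prop :=
  [/\ forall n, symmetric_L2 (f n), F \in Lfun P 2%:E &
      exists J : nat -> T -> R,
        (forall n, multiple_integral (f n) (J n)) /\
        L2_cvg P (fun N w => \sum_(n < N) J n w) F].

End chaos.

Section ornstein_uhlenbeck.
Context {R : realType} {d : measure_display} {T : measurableType d}.
Variables (P : probability T R) (B : R -> T -> R).

Definition OU_domain (F : T -> R) : Prop :=
  exists f : forall n, n.-tuple R -> R, chaos_expansion P B f F /\
    (\sum_(0 <= n <oo) (n%:R * n`!%:R)%:E * sqnorm (f n) < +oo)%E.

(* D_s F = \sum_(n >= 1) n I_(n-1)(f_n(s, .)) for almost every s >= 0. *)
Definition malliavin_derivative (F : T -> R) (DF : R -> T -> R) : Prop :=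
  measurable_fun [set: R * T] (fun z => DF z.1 z.2) /\
  exists f : forall n, n.-tuple R -> R, chaos_expansion P B f F /\
    {ae lebesgue_measure, forall s : R, 0 <= s ->
       chaos_expansion P B
         (fun n x => n.+1%:R * f n.+1 [tuple of s :: x]) (DF s)}.

(* Gamma[F] and the form E[F], as functions of the derivative DF of F. *)
Definition carre_du_champ (DF : R -> T -> R) (w : T) : \bar R :=
  (\int[lebesgue_measure]_(s in `[0%R, +oo[) (DF s w ^+ 2)%:E)%E.

Definition OU_form (DF : R -> T -> R) : \bar R :=
  (2^-1%:E * \int[P]_w carre_du_champ DF w)%E.

End ornstein_uhlenbeck.

Section chaotic_extension.
Context {R : realType} {d1 d2 : measure_display}
  {T1 : measurableType d1} {T2 : measurableType d2}.
Variables (P1 : probability T1 R) (P2 : probability T2 R).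
Variables (B : R -> T1 -> R) (M : R -> T2 -> R).

Definition rotation (theta t : R) (w : T1 * T2) : R :=
  B t w.1 * cos theta + M t w.2 * sin theta.

Definition chaotic_extension (F : T1 -> R) (theta : R) (X : T1 * T2 -> R) :
    Prop :=
  exists f : forall n, n.-tuple R -> R,
    chaos_expansion P1 B f F /\
    chaos_expansion (P1 \x P2)%E (rotation theta) f X.

End chaotic_extension.

Section spectral.
Context {R : realType} {d : measure_display} {T : measurableType d}.
Variable P : probability T R.

Definition expectationC (Z : T -> R[i]) : R[i] :=
  (fine 'E_P[fun w => complex.Re (Z w)] +i*
   fine 'E_P[fun w => complex.Im (Z w)])%C.

Definition L2C (Z : T -> R[i]) : Prop :=
  (fun w => complex.Re (Z w)) \in Lfun P 2%:E /\
  (fun w => complex.Im (Z w)) \in Lfun P 2%:E.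

Definition orthonormal_L2C (xi : int -> T -> R[i]) : Prop :=
  (forall n, L2C (xi n)) /\
  (forall n m, expectationC (fun w => xi n w * conjc (xi m w)) = (n == m)%:R).

(* e^{i x} *)
Definition expi (x : R) : R[i] := (cos x +i* sin x)%C.

Definition spectral_sum (c : int -> R) (xi : int -> T -> R[i]) (N : nat)
    (theta : R) (w : T) : R[i] :=
  \sum_(k < N.*2.+1) let n := k%:Z - N%:Z in
    (c n)%:C%C * expi (n%:~R * theta) * xi n w.

(* X_theta = \sum_(n in Z) c_n e^{i n theta} xi_n in complex L^2(P), by
   symmetric partial sums; the terms being orthogonal, convergence does not
   depend on the order of summation. *)
Definition spectral_representation (X : R -> T -> R) (c : int -> R)
    (xi : int -> T -> R[i]) : Prop :=
  [/\ forall n, 0 <= c n, orthonormal_L2C xi &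
      forall theta,
        L2_norm P (fun w => Normc.normc ((X theta w)%:C%C -
          spectral_sum c xi N theta w)) @[N --> \oo] --> 0%E].

End spectral.

(* Main.v *)
(* Write Y^a for the rotation of (B, M) by the angle a. Since
   d<Y^a, Y^b>_t = cos (a - b) dt, iterated integrals of order n satisfy
   E[I^a_n(f) I^b_n(g)] = cos (a - b) ^ n E[I_n(f) I_n(g)], and those of distinct
   orders are orthogonal; hence E[F^a F^b] = sum_n b_n cos (a - b) ^ n with
   b_n = n! |f_n|^2. Now 2 (1 - cos ^ n h) / h^2 <= n tends to n as h -> 0, so
   that if L = sum_n n b_n is finite then the rates (F^(t+h) - F^t) / h are
   Cauchy in L^2 and the squared norms of their limits equal L. Expanding the
   same rates along the orthonormal xi_n gives sum_n c_n^2 |e^(inh) - 1|^2 / h^2,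
   which tends to sum_n n^2 c_n^2. Finally E Gamma[F] = L by Tonelli's theorem
   and the isometry applied to the chaos expansion of D_s F for almost every s. *)

Require Import Defs.
From HB Require Import structures.
From mathcomp Require Import all_boot all_order all_fingroup all_algebra.
From mathcomp Require Import all_classical all_reals all_analysis.
From mathcomp Require Import complex.
From mathcomp Require Import measurable_realfun.
From mathcomp Require Import zify ring lra.

Set Implicit Arguments.
Unset Strict Implicit.
Unset Printing Implicit Defensive.

Import Order.TTheory GRing.Theory Num.Theory.
Import numFieldNormedType.Exports.

Local Open Scope classical_set_scope.
Local Open Scope ring_scope.

(** * Square integrable random variables *)

(** Random variables are plain functions, a multiple integral is given by some approximating
    sequence, and the kernels of [F] may be chosen anew at each angle, so integrals cannot be
    compared directly. Two facts repair this. On ordered step functions the isometry is a finite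
    formula, [step_gram], that mentions neither the integrator nor the probability space: it shows
    that every step sequence approximating the kernel computes the integral, so that one sequence
    serves [B] and all the rotations. And two expansions of one variable have almost surely equal
    terms, hence equal n! |f_n|^2. Conditional expectations are replaced by integrals over the
    events of a sigma-algebra. [B] comes without a filtration, so one is generated from its
    increments, and the brackets of the rotations are computed on rectangles of the product space.
    The derivative is not known in advance and is obtained from completeness. The Cauchy property
    involves inner products of rates at two different steps h and k, whose terms have no sign; this
    is why a lower bound uniform in h and k is needed for the tail of the series. *)

Definition ip {R : realType} {d} {T : measurableType d} (P : probability T R)
  (X Y : T -> R) : R := \int[P]_w (X w * Y w).

Lemma cvg0_norm_le {R : realType} (I : Type) (F : set_system I)
    (FF : Filter F) (u v : I -> R) :
  (\forall i \near F, `|u i| <= v i) -> v i @[i --> F] --> (0 : R) ->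
  u i @[i --> F] --> (0 : R).
Proof.
move=> uv v0; apply/cvgr0Pnorm_lt => e e0; near=> i.
have uvi : `|u i| <= v i by near: i.
apply: (le_lt_trans uvi); apply: (le_lt_trans (ler_norm _)).
by near: i; exact: cvgr0_norm_lt.
Unshelve. all: by end_near. Qed.

Section L2_space.
Context {R : realType} {d : measure_display} {T : measurableType d}.
Variable P : probability T R.
Implicit Types X Y Z : T -> R.

Lemma L2_measurable X : X \in Lfun P 2%:E -> measurable_fun [set: T] X.
Proof. by move=> /sub_Lfun_mfun; rewrite inE. Qed.

Lemma L2_integrableM X Y : X \in Lfun P 2%:E -> Y \in Lfun P 2%:E ->
  P.-integrable [set: T] (fun w => (X w * Y w)%:E).
Proof. by move=> hX hY; exact/Lfun1_integrable/Lfun2_mul_Lfun1. Qed.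

Lemma L2_integrable X : X \in Lfun P 2%:E ->
  P.-integrable [set: T] (EFin \o X).
Proof.
by move=> hX; apply/Lfun1_integrable/Lfun_subset12 => //; exact: fin_num_measure.
Qed.

Lemma L2_memP X : X \in Lfun P 2%:E <->
  measurable_fun [set: T] X /\ (\int[P]_w (X w ^+ 2)%:E < +oo)%E.
Proof.
split=> [hX|[mX hX]].
  split; first exact: L2_measurable.
  have /integrableP[_] := L2_integrableM hX hX.
  by under eq_integral do rewrite gee0_abs ?lee_fin -?expr2 ?sqr_ge0//.
rewrite inE; apply/andP; split; rewrite inE//=.
rewrite /finite_norm unlock /Lnorm poweR_lty//.
by under eq_integral do rewrite /= powR_mulrn// real_normK ?num_real//.
Qed.

Lemma L2D X Y : X \in Lfun P 2%:E -> Y \in Lfun P 2%:E ->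
  (X \+ Y) \in Lfun P 2%:E.
Proof. by apply: (proj2 (Lfun_addr_closed P (lee1n 2))). Qed.

Lemma L2N X : X \in Lfun P 2%:E -> (fun w => - X w) \in Lfun P 2%:E.
Proof. exact: (@Lfun_oppr_closed _ _ _ P 2%:E X). Qed.

Lemma L2B X Y : X \in Lfun P 2%:E -> Y \in Lfun P 2%:E ->
  (X \- Y) \in Lfun P 2%:E.
Proof. by move=> hX hY; apply: L2D => //; exact: L2N. Qed.

Lemma L2Z a X : X \in Lfun P 2%:E -> (fun w => a * X w) \in Lfun P 2%:E.
Proof.
move=> hX; rewrite (_ : (fun w => a * X w) = (a \o* X)).
  by apply: Lfun_scale => //; rewrite ler1n.
by apply/funext => w /=; rewrite mulrC.
Qed.

Lemma L2_cst c : (cst c : T -> R) \in Lfun P 2%:E.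
Proof. exact: Lfun_cst. Qed.

Lemma L2_sum (I : Type) (r : seq I) (Q : pred I) (X : I -> T -> R) :
  (forall i, Q i -> X i \in Lfun P 2%:E) ->
  (fun w => \sum_(i <- r | Q i) X i w) \in Lfun P 2%:E.
Proof.
move=> hX; elim: r => [|i r ih].
  rewrite (_ : (fun w => _) = cst 0); first exact: L2_cst.
  by apply/funext => w; rewrite big_nil.
rewrite (_ : (fun w => _) = if Q i then X i \+ (fun w => \sum_(i <- r | Q i) X i w)
    else fun w => \sum_(i <- r | Q i) X i w).
  by case: ifPn => // Qi; exact: (L2D (hX _ Qi) ih).
by apply/funext => w; rewrite big_cons; case: ifP.
Qed.

Lemma eq_ip X X' Y Y' : X =1 X' -> Y =1 Y' -> ip P X Y = ip P X' Y'.
Proof. by move=> /funext-> /funext->. Qed.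

Lemma ipC X Y : ip P X Y = ip P Y X.
Proof. by congr (fine _); apply: eq_integral => w _; rewrite mulrC. Qed.

Lemma ipDl X Y Z : X \in Lfun P 2%:E -> Y \in Lfun P 2%:E ->
  Z \in Lfun P 2%:E -> ip P (X \+ Y) Z = ip P X Z + ip P Y Z.
Proof.
move=> hX hY hZ; rewrite /ip -RintegralD//; last 2 first.
  exact: L2_integrableM.
  exact: L2_integrableM.
by apply: eq_Rintegral => w _; rewrite /= mulrDl.
Qed.

Lemma ipZl a X Y : X \in Lfun P 2%:E -> Y \in Lfun P 2%:E ->
  ip P (fun w => a * X w) Y = a * ip P X Y.
Proof.
move=> hX hY; rewrite /ip -RintegralZl//; last exact: L2_integrableM.
by apply: eq_Rintegral => w _; rewrite /= mulrA.
Qed.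

Lemma ipNl X Y : X \in Lfun P 2%:E -> Y \in Lfun P 2%:E ->
  ip P (fun w => - X w) Y = - ip P X Y.
Proof.
move=> hX hY; rewrite -mulN1r -ipZl//.
by apply: eq_ip => // w; rewrite mulN1r.
Qed.

Lemma ipBl X Y Z : X \in Lfun P 2%:E -> Y \in Lfun P 2%:E ->
  Z \in Lfun P 2%:E -> ip P (X \- Y) Z = ip P X Z - ip P Y Z.
Proof.
by move=> hX hY hZ; rewrite -ipNl// -ipDl//; exact: L2N.
Qed.

Lemma ipDr X Y Z : X \in Lfun P 2%:E -> Y \in Lfun P 2%:E ->
  Z \in Lfun P 2%:E -> ip P Z (X \+ Y) = ip P Z X + ip P Z Y.
Proof. by move=> hX hY hZ; rewrite ipC ipDl// ipC (ipC Y). Qed.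

Lemma ipBr X Y Z : X \in Lfun P 2%:E -> Y \in Lfun P 2%:E ->
  Z \in Lfun P 2%:E -> ip P Z (X \- Y) = ip P Z X - ip P Z Y.
Proof. by move=> hX hY hZ; rewrite ipC ipBl// ipC (ipC Y). Qed.

Lemma ipZr a X Y : X \in Lfun P 2%:E -> Y \in Lfun P 2%:E ->
  ip P Y (fun w => a * X w) = a * ip P Y X.
Proof. by move=> hX hY; rewrite ipC ipZl// ipC. Qed.

Lemma ip_suml (I : Type) (r : seq I) (Q : pred I) (X : I -> T -> R) Y :
  (forall i, Q i -> X i \in Lfun P 2%:E) -> Y \in Lfun P 2%:E ->
  ip P (fun w => \sum_(i <- r | Q i) X i w) Y =
  \sum_(i <- r | Q i) ip P (X i) Y.
Proof.
move=> hX hY; elim: r => [|i r ih].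
  rewrite big_nil -[RHS](mul0r (ip P Y Y)) -ipZl//.
  by apply: eq_ip => // w; rewrite big_nil mul0r.
rewrite (_ : (fun w => _) = if Q i then X i \+ (fun w => \sum_(i <- r | Q i) X i w)
    else fun w => \sum_(i <- r | Q i) X i w).
  rewrite big_cons; case: ifPn => // Qi.
  by rewrite -ih; apply: ipDl => //; [exact: hX|exact: L2_sum].
by apply/funext => w; rewrite big_cons; case: ifP.
Qed.

Lemma ip_sumr (I : Type) (r : seq I) (Q : pred I) (X : I -> T -> R) Y :
  (forall i, Q i -> X i \in Lfun P 2%:E) -> Y \in Lfun P 2%:E ->
  ip P Y (fun w => \sum_(i <- r | Q i) X i w) =
  \sum_(i <- r | Q i) ip P Y (X i).
Proof.
move=> hX hY; rewrite ipC ip_suml//.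
by apply: eq_bigr => i _; rewrite ipC.
Qed.

Lemma ip_ge0 X : 0 <= ip P X X.
Proof. by apply: Rintegral_ge0 => w _; rewrite -expr2 sqr_ge0. Qed.

Lemma EFin_ip X Y : X \in Lfun P 2%:E -> Y \in Lfun P 2%:E ->
  (ip P X Y)%:E = (\int[P]_w (X w * Y w)%:E)%E.
Proof.
by move=> hX hY; rewrite fineK// integrable_fin_num//; exact: L2_integrableM.
Qed.

Lemma ip_sqr X Y : X \in Lfun P 2%:E -> Y \in Lfun P 2%:E ->
  ip P (X \- Y) (X \- Y) = ip P X X - 2 * ip P X Y + ip P Y Y.
Proof.
move=> hX hY; have hXY := L2B hX hY.
by rewrite ipBl// !ipBr// (ipC Y X); ring.
Qed.

Lemma ip_sqrD X Y : X \in Lfun P 2%:E -> Y \in Lfun P 2%:E ->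
  ip P (X \+ Y) (X \+ Y) = ip P X X + 2 * ip P X Y + ip P Y Y.
Proof.
move=> hX hY; have hXY := L2D hX hY.
by rewrite ipDl// !ipDr// (ipC Y X); ring.
Qed.

Lemma ip_cauchy_schwarz X Y : X \in Lfun P 2%:E -> Y \in Lfun P 2%:E ->
  ip P X Y ^+ 2 <= ip P X X * ip P Y Y.
Proof.
move=> hX hY.
(* The squared norm of aX - bY. The choice a = |Y|^2, b = <X, Y> gives the inequality when |Y| is
   nonzero. *)
have H a b : 0 <= a ^+ 2 * ip P X X - 2 * a * b * ip P X Y + b ^+ 2 * ip P Y Y.
  have h1 := L2Z a hX; have h2 := L2Z b hY.
  have := ip_ge0 ((fun w => a * X w) \- (fun w => b * Y w)).
  rewrite ip_sqr// !ipZl// !ipZr//; lra.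
have [Y0|Y0] := eqVneq (ip P Y Y) 0; last first.
  have Yp : 0 < ip P Y Y by rewrite lt_neqAle eq_sym Y0 ip_ge0.
  have := H (ip P Y Y) (ip P X Y).
  have -> : ip P Y Y ^+ 2 * ip P X X - 2 * ip P Y Y * ip P X Y * ip P X Y +
    ip P X Y ^+ 2 * ip P Y Y =
    ip P Y Y * (ip P X X * ip P Y Y - ip P X Y ^+ 2) by ring.
  by rewrite pmulr_rge0// subr_ge0.
have {}H c : 0 <= ip P X X - 2 * c * ip P X Y.
  by have := H 1 c; rewrite Y0 expr1n mul1r mulr0 addr0 mulr1.
(* For |Y| = 0 the bound is affine in c, and this value of c would make it equal to -1 unless <X, Y>
   = 0. *)
rewrite Y0 mulr0; have := H ((ip P X X + 1) / (2 * ip P X Y)).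
have [->|XY0] := eqVneq (ip P X Y) 0; first by rewrite expr0n.
have -> : 2 * ((ip P X X + 1) / (2 * ip P X Y)) * ip P X Y = ip P X X + 1.
  by field.
lra.
Qed.

Lemma L2_normE X : X \in Lfun P 2%:E ->
  L2_norm P X = (Num.sqrt (ip P X X))%:E.
Proof.
move=> hX; rewrite /L2_norm unlock /Lnorm.
under eq_integral do
  rewrite /= powR_mulrn// real_normK ?num_real// expr2.
by rewrite -EFin_ip// poweR_EFin powR12_sqrt// ip_ge0.
Qed.

(** Passage from the extended-real norm of the definitions to the real squared norm, on which all
    later estimates are made. *)
Lemma L2_norm_cvg0 (I : Type) (F : set_system I) (FF : Filter F)
    (X : I -> T -> R) : (forall i, X i \in Lfun P 2%:E) ->
  (L2_norm P (X i) @[i --> F] --> 0%E) <->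
  (ip P (X i) (X i) @[i --> F] --> (0 : R)).
Proof.
move=> hX; under eq_fun do rewrite L2_normE//.
split=> [/fine_cvgP[_]/= h|h]; last first.
  apply/fine_cvgP; split; first exact: nearW.
  have := continuous_cvg _ (@sqrt_continuous R 0) h; rewrite sqrtr0; exact.
have e i : ip P (X i) (X i) =
    Num.sqrt (ip P (X i) (X i)) * Num.sqrt (ip P (X i) (X i)).
  by rewrite -expr2 sqr_sqrtr// ip_ge0.
under eq_fun do rewrite e.
have := cvgM h h; rewrite mulr0; exact.
Qed.

Lemma L2_cvgP (X : nat -> T -> R) Y : (forall n, X n \in Lfun P 2%:E) ->
  Y \in Lfun P 2%:E ->
  L2_cvg P X Y <-> (ip P (X n \- Y) (X n \- Y) @[n --> \oo] --> (0 : R)).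
Proof. by move=> hX hY; apply: L2_norm_cvg0 => n; exact: L2B. Qed.

(** Bilinear expansion around (X0, Y0): each of the three error terms has a factor tending to 0 in
    norm and is controlled by Cauchy-Schwarz. *)
Lemma cvg_ip (I : Type) (F : set_system I) (FF : Filter F)
    (X Y : I -> T -> R) (X0 Y0 : T -> R) :
  (forall i, X i \in Lfun P 2%:E) -> (forall i, Y i \in Lfun P 2%:E) ->
  X0 \in Lfun P 2%:E -> Y0 \in Lfun P 2%:E ->
  ip P (X i \- X0) (X i \- X0) @[i --> F] --> (0 : R) ->
  ip P (Y i \- Y0) (Y i \- Y0) @[i --> F] --> (0 : R) ->
  ip P (X i) (Y i) @[i --> F] --> ip P X0 Y0.
Proof.
move=> hX hY hX0 hY0 cX cY.
have small (U V : I -> T -> R) : (forall i, U i \in Lfun P 2%:E) ->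
    (forall i, V i \in Lfun P 2%:E) ->
    ip P (U i) (U i) * ip P (V i) (V i) @[i --> F] --> (0 : R) ->
    ip P (U i) (V i) @[i --> F] --> (0 : R).
  move=> hU hV UV.
  have : Num.sqrt (ip P (U i) (U i) * ip P (V i) (V i)) @[i --> F] --> (0 : R).
    have := continuous_cvg _ (@sqrt_continuous R 0) UV; rewrite sqrtr0; exact.
  apply: cvg0_norm_le; apply: nearW => i.
  by rewrite -sqrtr_sqr ler_wsqrtr// ip_cauchy_schwarz.
have e i : ip P (X i) (Y i) = ip P (X i \- X0) (Y i \- Y0) +
    ip P (X i \- X0) Y0 + ip P X0 (Y i \- Y0) + ip P X0 Y0.
  have ? := L2B (hX i) hX0; have ? := L2B (hY i) hY0.
  rewrite ipBr// !ipBl// ipBr//; ring.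
have hXX i := L2B (hX i) hX0; have hYY i := L2B (hY i) hY0.
have c1 : ip P (X i \- X0) (Y i \- Y0) @[i --> F] --> (0 : R).
  by apply: small => //; have := cvgM cX cY; rewrite mulr0; exact.
have c2 : ip P (X i \- X0) Y0 @[i --> F] --> (0 : R).
  apply: (small _ (fun=> Y0)) => //.
  by have := cvgM cX (cvg_cst (ip P Y0 Y0)); rewrite mul0r; exact.
have c3 : ip P X0 (Y i \- Y0) @[i --> F] --> (0 : R).
  apply: (small (fun=> X0)) => //.
  by have := cvgM (cvg_cst (ip P X0 X0)) cY; rewrite mulr0; exact.
under eq_fun do rewrite e.
have := cvgD (cvgD (cvgD c1 c2) c3) (cvg_cst (ip P X0 Y0)).
by rewrite !add0r; exact.
Qed.

End L2_space.

(** * Completeness of L^2 (Riesz-Fischer) *)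

Section L2_completeness.
Context {R : realType} {d : measure_display} {T : measurableType d}.
Variable P : probability T R.

Lemma limn_einf_near_le (u : (\bar R)^nat) (l : \bar R) :
  (\forall n \near \oo, (u n <= l)%E) -> (limn_einf u <= l)%E.
Proof.
move=> ul; rewrite limn_einf_lim; apply: lime_le; first exact: is_cvg_einfs.
near=> n; apply: (@le_trans _ _ (u n)); last by near: n.
by apply: ereal_inf_lbound; exists n => /=.
Unshelve. all: by end_near. Qed.

(** If G is the sum, each increment is at most sqrt(G) / 2^k, so the telescoping series is dominated
    by a geometric one. Weighted squares are used because their expectation is a squared L^2
    norm. *)
Lemma rapidly_cauchy_cvg (x : nat -> R) :
  (\sum_(0 <= k <oo) (4 ^+ k * (x k.+1 - x k) ^+ 2)%:E < +oo)%E -> cvgn x.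
Proof.
set G := (\sum_(0 <= k <oo) _)%E => Goo.
have G0 : (0 <= G)%E.
  by apply: nneseries_ge0 => k _ _; rewrite lee_fin mulr_ge0 ?sqr_ge0 ?exprn_ge0.
have Gfin : G \is a fin_num by rewrite ge0_fin_numE.
have bound k : `|x k.+1 - x k| <= geometric (Num.sqrt (fine G)) 2^-1 k.
  rewrite /geometric /= -sqrtr_sqr.
  have -> : Num.sqrt (fine G) * 2^-1 ^+ k = Num.sqrt (fine G / 4 ^+ k).
    have -> : (4 ^+ k)^-1 = (2^-1 ^+ k) ^+ 2 :> R.
      by rewrite -exprM mulnC exprM -exprVn; congr (_ ^+ k); field.
    by rewrite sqrtrM ?fine_ge0// sqrtr_sqr ger0_norm// exprn_ge0.
  rewrite ler_wsqrtr// ler_pdivlMr ?exprn_gt0// -lee_fin fineK//.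
  rewrite mulrC; have := @nneseries_lim_ge R
    (fun k => (4 ^+ k * (x k.+1 - x k) ^+ 2)%:E) xpredT 0 k.+1.
  move=> /(_ (fun k _ _ => _)) H.
  apply: le_trans (H _); last first.
    by move=> *; rewrite lee_fin mulr_ge0 ?sqr_ge0 ?exprn_ge0.
  rewrite big_nat_recr//= leeDr// sume_ge0// => i _.
  by rewrite lee_fin mulr_ge0 ?sqr_ge0 ?exprn_ge0.
have : cvgn (series (telescope x)).
  apply: normed_cvg; apply: series_le_cvg bound _ => //.
    by move=> k; rewrite /geometric/= mulr_ge0 ?sqrtr_ge0 ?exprn_ge0.
  by apply: is_cvg_geometric_series; rewrite ger0_norm ?invf_lt1 ?ltr1n.
move=> c; have -> : x = (fun n => x 0%N + series (telescope x) n).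
  by apply/funext => n; rewrite -eq_sum_telescope.
by apply: is_cvgD => //; exact: is_cvg_cst.
Qed.

(** Along a subsequence with squared gaps at most 8^-k, the sum of 4^k times the squared gaps has
    expectation at most the sum of 2^-k. It is thus almost surely finite, which gives pointwise
    convergence; Fatou's lemma then brings the Cauchy bound to the limit. *)
Lemma L2_complete (X : nat -> T -> R) : (forall n, X n \in Lfun P 2%:E) ->
  (forall e, 0 < e -> exists N, forall m n, (N <= m)%N -> (N <= n)%N ->
     ip P (X m \- X n) (X m \- X n) <= e) ->
  exists2 Z, Z \in Lfun P 2%:E &
    ip P (X n \- Z) (X n \- Z) @[n --> \oo] --> (0 : R).
Proof.
move=> hX cX.
have [N hN] : {N : nat -> nat & forall k m n, (N k <= m)%N -> (N k <= n)%N ->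
    ip P (X m \- X n) (X m \- X n) <= 8^-1 ^+ k}.
  by apply: (@choice _ _ (fun k N => forall m n, (N <= m)%N -> (N <= n)%N ->
    ip P (X m \- X n) (X m \- X n) <= 8^-1 ^+ k)) => k; apply: cX; rewrite exprn_gt0.
(* The maximum puts [psi k] beyond every [N j] with j <= k, in particular [psi k.+1] beyond [N k];
   the summand k makes [psi] tend to infinity. *)
pose psi k := (\max_(j < k.+1) N j + k)%N.
have psi_ge j k : (j <= k)%N -> (N j <= psi k)%N.
  move=> jk; rewrite -ltnS in jk; apply: leq_trans (leq_addr _ _).
  exact: (@leq_bigmax_cond _ xpredT (fun i : 'I_k.+1 => N i) (Ordinal jk)).
pose D k := X (psi k.+1) \- X (psi k).
have hD k : D k \in Lfun P 2%:E by exact: L2B.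
have mX n := L2_measurable (hX n).
have intG : (\int[P]_w (\sum_(0 <= k <oo) (4 ^+ k * D k w ^+ 2)%:E) < +oo)%E.
  rewrite integral_nneseries//; last 2 first.
  - move=> k; apply/measurable_EFinP/measurable_funM => //.
    exact/measurable_funX/measurable_funB.
  - by move=> *; rewrite lee_fin mulr_ge0 ?sqr_ge0 ?exprn_ge0.
  have eD n : (\int[P]_w (4 ^+ n * D n w ^+ 2)%:E)%E = (4 ^+ n * ip P (D n) (D n))%:E.
    rewrite EFinM EFin_ip// -integralZl//.
      exact: L2_integrableM.
  under eq_eseriesr => n _ do rewrite eD.
  apply: (@le_lt_trans _ _ (\sum_(0 <= k <oo) (2 / (2 ^ (k + 1))%:R : R)%:E)%E).
    apply: lee_nneseries => [k _ _|k _].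
      by rewrite lee_fin mulr_ge0 ?ip_ge0 ?exprn_ge0.
    rewrite lee_fin addn1 expnS natrM natrX invfM mulrA mulfV// mul1r.
    apply: (@le_trans _ _ (4 ^+ k * 8^-1 ^+ k)).
      by rewrite ler_pM2l ?exprn_gt0// hN ?psi_ge.
    by rewrite -exprMn -exprVn (_ : 4 / 8 = 2^-1 :> R)//; field.
  have := @cvg_geometric_eseries_half R 2 0 => /cvg_lim.
  rewrite /eseries/= => ->//; by rewrite ltry.
(* The upper limit is measurable everywhere and agrees with the limit wherever the latter exists;
   elsewhere its value is irrelevant. *)
pose Z w := fine (limn_esup (fun k => (X (psi k) w)%:E)).
have cZ : {ae P, forall w, X (psi k) w @[k --> \oo] --> Z w}.
  have : P.-integrable setT (fun w => \sum_(0 <= k <oo) (4 ^+ k * D k w ^+ 2)%:E)%E.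
    apply/integrableP; split.
      apply: ge0_emeasurable_sum => [k w _ _|k _].
        by rewrite lee_fin mulr_ge0 ?sqr_ge0 ?exprn_ge0.
      apply/measurable_EFinP/measurable_funM => //.
      exact/measurable_funX/measurable_funB.
    under eq_integral => w _.
      rewrite gee0_abs; last first.
          by apply: nneseries_ge0 => k _ _; rewrite lee_fin mulr_ge0 ?sqr_ge0 ?exprn_ge0.
      over.
    exact: intG.
  move=> /(integrable_ae measurableT); apply: filterS => w /(_ I).
  rewrite fin_numE => /andP[_]; rewrite -ltey => /rapidly_cauchy_cvg.
  move=> /cvg_ex[l xl]; rewrite /Z (_ : limn_esup _ = l%:E)//.
  suff /cvg_limn_einf_sup[_ //] : (X (psi k) w)%:E @[k --> \oo] --> l%:E.
  by apply/fine_cvgP; split; [exact: nearW|].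
have mZ : measurable_fun [set: T] Z.
  apply: measurableT_comp => //; apply: measurable_fun_limn_esup => n.
  exact/measurable_EFinP.
(* This Fatou bound is used twice: for the membership of [Z] in L^2, through X_N1 - Z, and for the
   convergence itself. *)
have fat e n : 0 <= e ->
    (\forall k \near \oo, ip P (X n \- X (psi k)) (X n \- X (psi k)) <= e) ->
    (\int[P]_w ((X n w - Z w) ^+ 2)%:E <= e%:E)%E.
  move=> e0 Xe.
  have -> : (\int[P]_w ((X n w - Z w) ^+ 2)%:E =
      \int[P]_w limn_einf (fun k => ((X n w - X (psi k) w) ^+ 2)%:E))%E.
    apply: ae_eq_integral => //.
    - exact/measurable_EFinP/measurable_funX/measurable_funB.
    - apply: (measurableT_comp (@oppe_measurable R setT)).
      apply: measurable_fun_limn_esup => k.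
      apply: (measurableT_comp (@oppe_measurable R setT)).
      exact/measurable_EFinP/measurable_funX/measurable_funB.
    apply: filterS cZ => w cw _; apply/esym.
    suff /cvg_limn_einf_sup[//] : ((X n w - X (psi k) w) ^+ 2)%:E @[k --> \oo]
        --> ((X n w - Z w) ^+ 2)%:E.
    apply/fine_cvgP; split; first exact: nearW.
    under eq_fun do rewrite /= expr2; rewrite expr2.
    by apply: cvgM; apply: cvgB => //; exact: cvg_cst.
  apply: (le_trans (fatou _ measurableT _ _)) => [k|k w _|].
  - exact/measurable_EFinP/measurable_funX/measurable_funB.
  - by rewrite lee_fin sqr_ge0.
  apply: limn_einf_near_le; apply: filterS Xe => k.
  rewrite -lee_fin EFin_ip ?L2B//; exact.
have hZ : Z \in Lfun P 2%:E.
  have [N1 hN1] := cX 1 ltr01.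
  have h : (X N1 \- Z) \in Lfun P 2%:E.
    apply/L2_memP; split; first exact: measurable_funB.
    apply: (le_lt_trans (fat 1 N1 _ _)) => //; last exact: ltry.
    near=> k; apply: hN1 => //; apply: leq_trans (leq_addl _ k).
    by near: k; exact: nbhs_infty_ge.
  rewrite (_ : Z = X N1 \- (X N1 \- Z)); first exact: L2B.
  by apply/funext => w /=; rewrite opprB addrC subrK.
exists Z => //.
apply/cvgr0Pnorm_le => e e0; have [N1 hN1] := cX e e0.
near=> n; rewrite ger0_norm ?ip_ge0// -lee_fin EFin_ip ?L2B//.
apply: fat; first exact: ltW.
near=> k; apply: hN1; first by near: n; exact: nbhs_infty_ge.
apply: leq_trans (leq_addl _ k); by near: k; exact: nbhs_infty_ge.
Unshelve. all: by end_near. Qed.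

End L2_completeness.

(** * Processes with normal increments *)

Definition adapted {R : realType} {T : Type} (G : set (set T)) (X : T -> R) :=
  forall A : set R, measurable A -> G (X @^-1` A).

Section adapted.
Context {R : realType} {d : measure_display} {T : measurableType d}.
Implicit Types (G H : set (set T)) (X Y : T -> R).

(** A sub-sigma-algebra is a bare set of events here; passing to the type that it generates gives
    access to the closure properties of measurable functions. *)
Lemma adaptedP G X : sigma_algebra [set: T] G ->
  adapted G X <-> measurable_fun [set: g_sigma_algebraType G] (X : g_sigma_algebraType G -> R).
Proof.
move=> sG; split => [aX _ A mA|mX A mA].
  by rewrite setTI; apply: sub_sigma_algebra; exact: aX.
have := mX measurableT A mA; rewrite setTI.
by rewrite /measurable/= (sigma_algebra_id sG).
Qed.

Lemma adapted_sub G H X : G `<=` H -> adapted G X -> adapted H X.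
Proof. by move=> GH aX A mA; exact/GH/aX. Qed.

Lemma adapted_measurable G X : G `<=` @measurable d T -> adapted G X ->
  measurable_fun [set: T] X.
Proof. by move=> GT aX _ A mA; rewrite setTI; exact/GT/aX. Qed.

Lemma adapted_cst G c : sigma_algebra [set: T] G -> adapted G (cst c : T -> R).
Proof. by move=> sG; apply/(adaptedP _ sG); exact: measurable_cst. Qed.

Lemma adaptedD G X Y : sigma_algebra [set: T] G -> adapted G X -> adapted G Y ->
  adapted G (X \+ Y).
Proof.
move=> sG /(adaptedP _ sG) aX /(adaptedP _ sG) aY.
by apply/(adaptedP _ sG); exact: measurable_funD.
Qed.

Lemma adaptedM G X Y : sigma_algebra [set: T] G -> adapted G X -> adapted G Y ->
  adapted G (fun w => X w * Y w).
Proof.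
move=> sG /(adaptedP _ sG) aX /(adaptedP _ sG) aY.
by apply/(adaptedP _ sG); exact: measurable_funM.
Qed.

Lemma adapted_comp G X (f : R -> R) : measurable_fun [set: R] f -> adapted G X ->
  adapted G (f \o X).
Proof.
move=> mf aX A mA; rewrite comp_preimage; apply: aX.
by rewrite -[X in measurable X]setTI; exact: mf.
Qed.

Lemma adaptedB G X Y : sigma_algebra [set: T] G -> adapted G X -> adapted G Y ->
  adapted G (X \- Y).
Proof.
move=> sG aX aY; apply: adaptedD => //.
by apply: (@adapted_comp G Y -%R) => //; exact: oppr_measurable.
Qed.

Lemma integral_setE (mu : {measure set T -> \bar R}) (A : set T) (f : T -> R) :
  (\int[mu]_(w in A) (f w)%:E = \int[mu]_w (\1_A w * f w)%:E)%E.
Proof.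
rewrite integral_mkcond; apply: eq_integral => w _.
rewrite patchE indicE; case: (w \in A); rewrite ?mul1r ?mul0r//.
Qed.

(** The measures D1.mu and D2.nu agree on [G], hence on simple functions with level sets in [G],
    hence on nonnegative adapted functions by monotone convergence. With mu = nu this plays the role
    of conditional expectation; with mu and nu distinct it turns an integral against a law into one
    against its density. *)
Lemma integral_adaptedM (mu nu : {measure set T -> \bar R}) G (D1 D2 Z : T -> R) :
  sigma_algebra [set: T] G -> G `<=` @measurable d T ->
  measurable_fun [set: T] D1 -> measurable_fun [set: T] D2 ->
  (forall w, 0 <= D1 w) -> (forall w, 0 <= D2 w) ->
  (forall A, G A ->
     \int[mu]_(w in A) (D1 w)%:E = \int[nu]_(w in A) (D2 w)%:E)%E ->
  adapted G Z -> (forall w, 0 <= Z w) ->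
  (\int[mu]_w (Z w * D1 w)%:E = \int[nu]_w (Z w * D2 w)%:E)%E.
Proof.
move=> sG GT mD1 mD2 D10 D20 D12 aZ Z0.
have mZ := adapted_measurable GT aZ.
have mEZ : measurable_fun [set: T] (EFin \o Z) by exact/measurable_EFinP.
pose a := approx setT (EFin \o Z).
(* The level sets of the dyadic approximations are preimages of intervals under [Z], so they belong
   to [G]. *)
have GA n k : G (dyadic_approx setT (EFin \o Z) n k).
  rewrite /dyadic_approx; case: ifP => _; last by case: sG.
  rewrite setTI (_ : [set x | _] = Z @^-1` [set` dyadic_itv R n k]).
    by apply: aZ; exact: measurable_itv.
  apply/seteqP; split => w /=; rewrite inE/=.
    by move=> [r hr [<-]].
  by move=> h; exists (Z w).
have GB n : G (integer_approx setT (EFin \o Z) n).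
  rewrite /integer_approx setTI (_ : [set x | _] = Z @^-1` `[n%:R, +oo[%classic).
    by apply: aZ; exact: measurable_itv.
  by apply/seteqP; split => w /=; rewrite in_itv/= andbT lee_fin.
have ea (P : {measure set T -> \bar R}) n (D : T -> R) : measurable_fun [set: T] D -> (forall w, 0 <= D w) ->
  (\int[P]_w (a n w * D w)%:E =
   \sum_(k < n * 2 ^ n) (k%:R * 2 ^- n)%:E *
     \int[P]_(w in dyadic_approx setT (EFin \o Z) n k) (D w)%:E +
   n%:R%:E * \int[P]_(w in integer_approx setT (EFin \o Z) n) (D w)%:E)%E.
  move=> mD D0.
  under eq_integral => w _.
    rewrite mulrDl mulr_suml EFinD -sumEFin -(mulrA n%:R) (EFinM n%:R).
    under eq_bigr => k _ do rewrite -(mulrA (k%:R * 2 ^- n)) EFinM.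
    over.
  have mI A : G A -> measurable_fun setT (fun w => (\1_A w * D w)%:E).
    move=> hA; apply/measurable_EFinP/measurable_funM => //.
    by apply: measurable_indic; exact: GT.
  rewrite ge0_integralD//; last first.
  - by apply: measurable_funeM; exact: mI.
  - by move=> w _; rewrite -EFinM lee_fin !mulr_ge0.
  - apply: emeasurable_sum => k.
    exact: measurable_funeM (mI _ (GA n k)).
  - move=> w _; apply: sume_ge0 => k _.
    by rewrite -EFinM lee_fin !mulr_ge0 ?invr_ge0 ?exprn_ge0.
  congr (_ + _)%E.
    rewrite ge0_integral_sum//; last first.
    - by move=> k w _; rewrite -EFinM lee_fin !mulr_ge0 ?invr_ge0 ?exprn_ge0.
    - by move=> k; apply: measurable_funeM; exact: mI.
    apply: eq_bigr => k _; rewrite ge0_integralZl_EFin//.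
    - by rewrite -integral_setE.
    - by move=> w _; rewrite lee_fin mulr_ge0.
    - exact: mI.
  rewrite ge0_integralZl_EFin//.
  - by rewrite -integral_setE.
  - by move=> w _; rewrite lee_fin mulr_ge0.
  - exact: mI.
have a0 n w : 0 <= a n w.
  apply: addr_ge0; last by rewrite mulr_ge0.
  by apply: sumr_ge0 => k _; rewrite !mulr_ge0 ?invr_ge0 ?exprn_ge0.
have ma n : measurable_fun setT (a n).
  apply: measurable_funD; last first.
    by apply: measurable_funM => //; exact/measurable_indic/GT/GB.
  apply: measurable_sum => k; apply: measurable_funM => //.
  exact/measurable_indic/GT/GA.
have cva (P : {measure set T -> \bar R}) (D : T -> R) : measurable_fun [set: T] D -> (forall w, 0 <= D w) ->
    (\int[P]_w (a n w * D w)%:E @[n --> \oo] --> \int[P]_w (Z w * D w)%:E)%E.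
  move=> mD D0.
  have -> : (\int[P]_w (Z w * D w)%:E = \int[P]_w (limn (fun n => (a n w * D w)%:E)))%E.
    apply: eq_integral => w _; apply/esym/cvg_lim => //.
    apply/fine_cvgP; split; first exact: nearW.
    have := @cvg_approx _ _ _ setT (EFin \o Z) w (fun w _ => Z0 w) I (ltry _).
    by move=> h; exact: (cvgM h (cvg_cst (D w))).
  apply: cvg_monotone_convergence => //.
  - by move=> n; exact/measurable_EFinP/measurable_funM.
  - by move=> n w _; rewrite lee_fin mulr_ge0.
  - move=> w _ m n mn; rewrite lee_fin ler_wpM2r//.
    by have /(_ m n mn)/lefP/(_ w) := nd_approx setT (EFin \o Z).
have c1 := cva mu _ mD1 D10; have c2 := cva nu _ mD2 D20.
have e : (fun n => \int[mu]_w (a n w * D1 w)%:E)%E = (fun n => \int[nu]_w (a n w * D2 w)%:E)%E.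
  apply/funext => n; rewrite !ea// D12//; congr (_ + _)%E.
  by apply: eq_bigr => k _; rewrite D12.
by rewrite e in c1; exact: (cvg_unique _ c1 c2).
Qed.

Variable P : probability T R.

(* pi-lambda theorem for the finite measures D1.P and D2.P *)
Lemma integral_eq_generated (C : set (set T)) (D1 D2 : T -> R) :
  setI_closed C -> C [set: T] -> C `<=` @measurable d T ->
  P.-integrable [set: T] (EFin \o D1) -> P.-integrable [set: T] (EFin \o D2) ->
  (forall w, 0 <= D1 w) -> (forall w, 0 <= D2 w) ->
  (forall A, C A ->
     \int[P]_(w in A) (D1 w)%:E = \int[P]_(w in A) (D2 w)%:E)%E ->
  forall A, <<s C >> A ->
     (\int[P]_(w in A) (D1 w)%:E = \int[P]_(w in A) (D2 w)%:E)%E.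
Proof.
move=> CI CT Cm iD1 iD2 D10 D20 D12 A.
have mD1 : measurable_fun setT (EFin \o D1) by exact: measurable_int iD1.
have mD2 : measurable_fun setT (EFin \o D2) by exact: measurable_int iD2.
rewrite -setI_closed_g_dynkin_g_sigma_algebra//.
pose E := [set A | measurable A /\
  (\int[P]_(w in A) (D1 w)%:E = \int[P]_(w in A) (D2 w)%:E)%E].
suff dE : dynkin E.
  move=> /(_ E) h; have [//|_ //] := h _.
  by split => // B CB; split; [exact: Cm|exact: D12].
split.
- by split; [|exact: D12].
- move=> B [mB eB]; split; first exact: measurableC.
  have h (D : T -> R) : measurable_fun setT (EFin \o D) -> (forall w, 0 <= D w) ->
      P.-integrable [set: T] (EFin \o D) ->
      (\int[P]_(w in ~` B) (D w)%:E =
       \int[P]_w (D w)%:E - \int[P]_(w in B) (D w)%:E)%E.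
    move=> mD D0 iD; rewrite -[X in (\int[P]_(w in X) _ - _)%E](setUv B) ge0_integral_setU//.
    - rewrite addeAC subee ?add0e//.
      by apply: integrable_fin_num => //; exact: integrableS iD.
    - exact: measurableC.
    - exact: measurable_funTS.
    - by move=> w _; rewrite lee_fin.
    - by rewrite disj_set2E setICr.
  by rewrite !h// eB (D12 _ CT).
- move=> F tF EF; split; first by apply: bigcupT_measurable => k; case: (EF k).
  have h (D : T -> R) : measurable_fun setT (EFin \o D) -> (forall w, 0 <= D w) ->
      (\int[P]_(w in \bigcup_k F k) (D w)%:E =
       \sum_(k <oo) \int[P]_(w in F k) (D w)%:E)%E.
    move=> mD D0; apply: ge0_integral_bigcup => //.
    + by move=> k; case: (EF k).
    + exact: measurable_funTS.
    + by move=> w _; rewrite lee_fin.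
  rewrite !h//; by apply: eq_eseriesr => k _; case: (EF k).
Qed.

End adapted.

(** * Conditional means relative to a sub-sigma-algebra *)

Section adapted_mean.
Context {R : realType} {d : measure_display} {T : measurableType d}.
Variable P : probability T R.
Implicit Types (G : set (set T)) (X D Z : T -> R).

Lemma integrable_le X D : measurable_fun [set: T] X ->
  P.-integrable [set: T] (EFin \o D) -> (forall w, `|X w| <= `|D w|) ->
  P.-integrable [set: T] (EFin \o X).
Proof.
move=> mX iD XD; apply: (le_integrable measurableT _ _ iD).
  exact/measurable_EFinP.
by move=> w _ /=; rewrite lee_fin.
Qed.

(** This stands for E[Z E[D | G]] = 0. The positive and negative parts of [D] have equal integrals
    over every event of [G], hence against both the positive and the negative part of [Z], and the
    four products cancel in pairs. *)
Lemma adapted_mean0 G D Z : sigma_algebra [set: T] G ->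
  G `<=` @measurable d T -> P.-integrable [set: T] (EFin \o D) ->
  (forall A, G A -> \int[P]_(w in A) D w = 0) ->
  adapted G Z -> P.-integrable [set: T] (EFin \o (fun w => Z w * D w)) ->
  \int[P]_w (Z w * D w) = 0.
Proof.
move=> sG GT iD D0 aZ iZD.
have mZ := adapted_measurable GT aZ.
have mD : measurable_fun setT D by apply/measurable_EFinP; exact: measurable_int iD.
pose p (x : R) : R := (`|x| + x) / 2; pose n (x : R) : R := (`|x| - x) / 2.
have pE x : x = p x - n x by rewrite /p /n; field.
have pn x : 0 <= p x <= `|x| /\ 0 <= n x <= `|x|.
  have h := ler_norm x; have h' := ler_norm (- x); rewrite normrN in h'.
  by rewrite /p /n; split; apply/andP; split; lra.
have p0 x : 0 <= p x by have [/andP[]] := pn x.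
have n0 x : 0 <= n x by have [_ /andP[]] := pn x.
have pp x : `|p x| <= `|x| by rewrite ger0_norm//; have [/andP[]] := pn x.
have nn x : `|n x| <= `|x| by rewrite ger0_norm//; have [_ /andP[]] := pn x.
have mp : measurable_fun [set: R] p.
  by apply: measurable_funM => //; apply: measurable_funD => //; exact: normr_measurable.
have mn : measurable_fun [set: R] n.
  by apply: measurable_funM => //; apply: measurable_funB => //; exact: normr_measurable.
have ipD : P.-integrable setT (EFin \o (p \o D)).
  by apply: (integrable_le _ iD) => [|w]; [exact: measurableT_comp|exact: pp].
have inD : P.-integrable setT (EFin \o (n \o D)).
  by apply: (integrable_le _ iD) => [|w]; [exact: measurableT_comp|exact: nn].
have eD A : G A -> (\int[P]_(w in A) ((p \o D) w)%:E = \int[P]_(w in A) ((n \o D) w)%:E)%E.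
  move=> GA; have mA := GT _ GA; have := D0 _ GA.
  have -> : \int[P]_(w in A) D w = \int[P]_(w in A) ((p \o D) w - (n \o D) w).
    by apply: eq_Rintegral => w _; rewrite /= -pE.
  rewrite RintegralB//; last 2 first.
  - exact: integrableS ipD.
  - exact: integrableS inD.
  move/eqP; rewrite subr_eq0 => /eqP e; have := congr1 EFin e; rewrite /Rintegral.
  rewrite !fineK//; apply: integrable_fin_num => //.
    exact: integrableS inD.
  exact: integrableS ipD.
have mpD : measurable_fun setT (p \o D) by exact: measurableT_comp.
have mnD : measurable_fun setT (n \o D) by exact: measurableT_comp.
have eW W : adapted G W -> (forall w, 0 <= W w) ->
    \int[P]_w (W w * (p \o D) w) = \int[P]_w (W w * (n \o D) w).
  move=> aW W0; congr fine.
  by apply: (integral_adaptedM sG GT mpD mnD _ _ eD aW W0) => w; [exact: p0|exact: n0].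
have apZ := adapted_comp mp aZ; have anZ := adapted_comp mn aZ.
have i (u v : R -> R) : (forall x, `|u x| <= `|x|) -> (forall x, `|v x| <= `|x|) ->
    measurable_fun setT u -> measurable_fun setT v ->
    P.-integrable setT (EFin \o (fun w => u (Z w) * v (D w))).
  move=> hu hv mu mv; apply: (integrable_le _ iZD).
    by apply: measurable_funM; exact: measurableT_comp.
  by move=> w; rewrite !normrM ler_pM.
have -> : \int[P]_w (Z w * D w) = \int[P]_w
   ((p (Z w) * p (D w) - p (Z w) * n (D w)) - (n (Z w) * p (D w) - n (Z w) * n (D w))).
  apply: eq_Rintegral => w _; rewrite {1}(pE (Z w)) {1}(pE (D w)); ring.
have e1 := eW _ apZ (fun w => p0 _); have e2 := eW _ anZ (fun w => n0 _).
rewrite RintegralB//; last 2 first.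
- by apply: (@integrableB _ _ _ P setT measurableT (fun w => (p (Z w) * p (D w))%:E)
    (fun w => (p (Z w) * n (D w))%:E)); exact: i.
- by apply: (@integrableB _ _ _ P setT measurableT (fun w => (n (Z w) * p (D w))%:E)
    (fun w => (n (Z w) * n (D w))%:E)); exact: i.
rewrite !RintegralB//; try exact: i.
by rewrite e1 e2 !subrr.
Qed.

Lemma adapted_mean G D Z c : sigma_algebra [set: T] G ->
  G `<=` @measurable d T -> P.-integrable [set: T] (EFin \o D) ->
  (forall A, G A -> \int[P]_(w in A) D w = c * fine (P A)) ->
  adapted G Z -> P.-integrable [set: T] (EFin \o Z) ->
  P.-integrable [set: T] (EFin \o (fun w => Z w * D w)) ->
  \int[P]_w (Z w * D w) = c * \int[P]_w Z w.
Proof.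
move=> sG GT iD Dc aZ iZ iZD.
have icst : P.-integrable setT (EFin \o cst c).
  exact: finite_measure_integrable_cst.
have iZc : P.-integrable setT (EFin \o (fun w => Z w * c)).
  rewrite (_ : _ \o _ = (fun w => c%:E * (EFin \o Z) w)%E).
    exact: integrableZl.
  by apply/funext => w /=; rewrite -EFinM mulrC.
have : \int[P]_w (Z w * (D w - c)) = 0.
  apply: (@adapted_mean0 G) => //.
  - exact: (@integrableB _ _ _ P setT measurableT (EFin \o D) (EFin \o cst c)).
  - move=> A GA; have mA := GT _ GA.
    rewrite RintegralB//; last 2 first.
    + exact: integrableS iD.
    + exact: integrableS icst.
    by rewrite Dc// Rintegral_cst// subrr.
  - rewrite (_ : _ \o _ = (fun w => (Z w * D w)%:E - (Z w * c)%:E)%E).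
      exact: integrableB.
    by apply/funext => w /=; rewrite -EFinB mulrBr.
under eq_Rintegral do rewrite mulrBr.
rewrite RintegralB// RintegralZr// => /eqP; rewrite subr_eq0 => /eqP ->.
by rewrite mulrC.
Qed.

(** The conditional mean of D^2 is the constant c, so E[X^2 D^2] = c E[X^2] is finite. A product of
    two square integrable variables is in general only integrable; this is what keeps products of
    successive increments in L^2. *)
Lemma L2_adaptedM G X D c : sigma_algebra [set: T] G ->
  G `<=` @measurable d T -> D \in Lfun P 2%:E -> 0 <= c ->
  (forall A, G A -> \int[P]_(w in A) (D w ^+ 2) = c * fine (P A)) ->
  adapted G X -> X \in Lfun P 2%:E -> (fun w => X w * D w) \in Lfun P 2%:E.
Proof.
move=> sG GT hD c0 Dc aX hX.
have mX := L2_measurable hX; have mD := L2_measurable hD.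
apply/L2_memP; split; first exact: measurable_funM.
under eq_integral do rewrite exprMn.
rewrite (@integral_adaptedM R d T P P G (fun w => D w ^+ 2) (cst c) (fun w => X w ^+ 2))//.
- under eq_integral do rewrite mulrC EFinM.
  rewrite ge0_integralZl_EFin//.
  + rewrite lte_mul_pinfty// ?lee_fin//.
    by have /L2_memP[] := hX.
  + by move=> w _; rewrite lee_fin sqr_ge0.
  + exact/measurable_EFinP/measurable_funX.
- exact: measurable_funX.
- by move=> w; exact: sqr_ge0.
- move=> A GA; have mA := GT _ GA; have := congr1 EFin (Dc _ GA).
  rewrite /Rintegral fineK.
    move=> ->; have -> : (\int[P]_(w in A) (cst c w)%:E = c%:E * P A)%E.
      exact: (integral_cst P mA c%:E).
    by rewrite EFinM fineK// fin_num_measure.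
  apply: integrable_fin_num => //; apply: (integrableS measurableT) => //.
  exact: (L2_integrableM hD hD).
- by apply: (@adapted_comp _ _ _ G X (fun x => x ^+ 2)).
- by move=> w; exact: sqr_ge0.
Qed.

End adapted_mean.

(** What the isometry uses of a normal martingale, stated on increments alone so that Brownian
    motion with the filtration of its increments, normal martingales and rotations all fall under
    it. *)
Definition normal_increments {R : realType} {d} {T : measurableType d}
    (P : probability T R) (H : R -> set (set T)) (Y : R -> T -> R) : Prop :=
  filtration H /\ forall s t, 0 <= s -> s <= t ->
    [/\ (Y t \- Y s) \in Lfun P 2%:E, adapted (H t) (Y t \- Y s),
        forall A, H s A -> \int[P]_(w in A) (Y t w - Y s w) = 0 &
        forall A, H s A ->
          \int[P]_(w in A) (Y t w - Y s w) ^+ 2 = (t - s) * fine (P A)].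

(* d<Y, Y'>_t = k dt *)
Definition joint_increments {R : realType} {d} {T : measurableType d}
    (P : probability T R) (H : R -> set (set T)) (k : R)
    (Y Y' : R -> T -> R) : Prop :=
  [/\ normal_increments P H Y, normal_increments P H Y' &
    forall s t, 0 <= s -> s <= t -> forall A, H s A ->
      \int[P]_(w in A) ((Y t w - Y s w) * (Y' t w - Y' s w)) =
      k * (t - s) * fine (P A)].

Section increments.
Context {R : realType} {d : measure_display} {T : measurableType d}.
Variables (P : probability T R) (H : R -> set (set T)).
Implicit Types (X : T -> R) (s t : R).

Definition L2_adapted t X := X \in Lfun P 2%:E /\ adapted (H t) X.

(** The Lebesgue measure of the intersection of ]s, t] and ]s', t']. *)
Definition overlap s t s' t' : R :=
  Num.max 0 (Num.min t t' - Num.max s s').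

Lemma joint_increments_sym k Y Y' :
  joint_increments P H k Y Y' -> joint_increments P H k Y' Y.
Proof.
move=> [hY hY' c]; split => // s t s0 st A HA; rewrite -c//.
by apply: eq_Rintegral => w _; rewrite mulrC.
Qed.

Section one_process.
Variable Y : R -> T -> R.
Hypothesis hY : normal_increments P H Y.

Lemma L2_adapted_sub s t X : 0 <= s -> s <= t -> L2_adapted s X -> L2_adapted t X.
Proof.
move=> s0 st [X2 aX]; split => //; apply: adapted_sub aX.
by have [[_ Hle] _] := hY; exact: Hle.
Qed.

Lemma L2_adapted1 s : 0 <= s -> L2_adapted s (cst 1).
Proof.
move=> s0; split; first exact: L2_cst.
by apply: adapted_cst; have [[/(_ _ s0)[]]] := hY.
Qed.

Lemma L2_adapted_increment s t X : 0 <= s -> s <= t -> L2_adapted s X ->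
  L2_adapted t (fun w => X w * (Y t w - Y s w)).
Proof.
move=> s0 st [X2 aX].
have t0 := le_trans s0 st.
have [[Hs Hle] /(_ s t s0 st)[D2 aD _ D2m]] := hY.
have [sG GT] := Hs _ s0; have [sGt GTt] := Hs _ t0.
split.
  by apply: (L2_adaptedM sG GT D2 _ D2m aX X2); rewrite subr_ge0.
by apply: adaptedM => //; apply: adapted_sub aX; exact: Hle.
Qed.

(** X X' is known at time s, and the increment has zero mean over the events of that time. As X X'
    is merely integrable, the integrability of the triple product is obtained by pairing X (Y_t -
    Y_s), which lies in L^2, with X'. *)
Lemma ip_increment s t X X' : 0 <= s -> s <= t ->
  L2_adapted s X -> L2_adapted s X' ->
  ip P (fun w => X w * (Y t w - Y s w)) X' = 0.
Proof.
move=> s0 st hX hX'.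
have [XD2 _] := L2_adapted_increment s0 st hX.
have [[Hs _] /(_ s t s0 st)[D2 aD Dm _]] := hY; have [sG GT] := Hs _ s0.
have [[X2 aX] [X2' aX']] := (hX, hX').
have e w : X w * (Y t w - Y s w) * X' w = X w * X' w * (Y t w - Y s w).
  by rewrite mulrAC.
rewrite /ip; under eq_Rintegral do rewrite e.
apply: (@adapted_mean0 _ _ _ P (H s)) => //.
- exact: (L2_integrable D2).
- exact: adaptedM.
- have := L2_integrableM XD2 X2'; congr (P.-integrable _ _).
  by apply/funext => w; rewrite e.
Qed.

End one_process.

Lemma ip_increments_same k Y Y' s t X X' : joint_increments P H k Y Y' ->
  0 <= s -> s <= t -> L2_adapted s X -> L2_adapted s X' ->
  ip P (fun w => X w * (Y t w - Y s w)) (fun w => X' w * (Y' t w - Y' s w)) =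
  k * (t - s) * ip P X X'.
Proof.
move=> [hY hY' hk] s0 st hX hX'.
have [XD2 _] := L2_adapted_increment hY s0 st hX.
have [XD2' _] := L2_adapted_increment hY' s0 st hX'.
have [[Hs _] /(_ s t s0 st)[D2 aD Dm _]] := hY; have [sG GT] := Hs _ s0.
have [_ /(_ s t s0 st)[D2' _ _ _]] := hY'.
have [[X2 aX] [X2' aX']] := (hX, hX').
have e w : X w * (Y t w - Y s w) * (X' w * (Y' t w - Y' s w)) =
    X w * X' w * ((Y t w - Y s w) * (Y' t w - Y' s w)) by ring.
rewrite /ip; under eq_Rintegral do rewrite e.
apply: (@adapted_mean _ _ _ P (H s)) => //.
- exact: (L2_integrableM D2 D2').
- by move=> A HA; exact: hk.
- exact: adaptedM.
- exact: L2_integrableM.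
- have := L2_integrableM XD2 XD2'; congr (P.-integrable _ _).
  by apply/funext => w; rewrite e.
Qed.

Lemma incrementD (Y : R -> T -> R) s u t X :
  (fun w => X w * (Y t w - Y s w)) =
  (fun w => X w * (Y u w - Y s w)) \+ (fun w => X w * (Y t w - Y u w)).
Proof. by apply/funext => w /=; ring. Qed.

(** The longer increment is cut at t: its part after t is orthogonal to everything known at time
    t. *)
Lemma ip_increments_start k Y Y' s t t' X X' : joint_increments P H k Y Y' ->
  0 <= s -> s <= t -> t <= t' -> L2_adapted s X -> L2_adapted s X' ->
  ip P (fun w => X w * (Y t w - Y s w)) (fun w => X' w * (Y' t' w - Y' s w)) =
  k * (t - s) * ip P X X'.
Proof.
move=> hj s0 st tt' hX hX'; have [hY hY' _] := hj.
have t0 := le_trans s0 st.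
have hXt' := L2_adapted_sub hY s0 st hX'.
have hXD := L2_adapted_increment hY s0 st hX.
rewrite (incrementD Y' s t t') ipDr; last 3 first.
- by case: (L2_adapted_increment hY' s0 st hX').
- by case: (L2_adapted_increment hY' t0 tt' hXt').
- by case: hXD.
rewrite (ip_increments_same hj)// [X in _ + X]ipC.
by rewrite (ip_increment hY') ?addr0.
Qed.

(** If t <= s' the second increment is orthogonal to the past. Otherwise the first one is cut at s':
    the part before s' is known at time s' and contributes nothing, and the remaining increments
    start together. *)
Lemma ip_increments_le k Y Y' s t s' t' X X' : joint_increments P H k Y Y' ->
  0 <= s -> s <= t -> s <= s' -> s' <= t' -> L2_adapted s X -> L2_adapted s' X' ->
  ip P (fun w => X w * (Y t w - Y s w)) (fun w => X' w * (Y' t' w - Y' s' w)) =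
  k * overlap s t s' t' * ip P X X'.
Proof.
move=> hj s0 st ss' st' hX hX'; have [hY hY' _] := hj.
have t0 := le_trans s0 st; have s'0 := le_trans s0 ss'.
have hXD := L2_adapted_increment hY s0 st hX.
have hXs' := L2_adapted_sub hY s0 ss' hX.
rewrite /overlap (max_idPr ss').
have [ts'|/ltW s't] := leP t s'.
  rewrite max_l; last by rewrite subr_le0 (le_trans _ ts')// ge_min lexx.
  rewrite mulr0 mul0r ipC (ip_increment hY')//.
  exact: (L2_adapted_sub hY t0 ts' hXD).
rewrite max_r; last by rewrite subr_ge0 le_min s't.
rewrite (incrementD Y s s' t) ipDl; last 3 first.
- by case: (L2_adapted_increment hY s0 ss' hX).
- by case: (L2_adapted_increment hY s'0 s't hXs').
- by case: (L2_adapted_increment hY' s'0 st' hX').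
rewrite [X in X + _]ipC (ip_increment hY')//; last exact: L2_adapted_increment.
rewrite add0r; have [tt'|/ltW t't] := leP t t'.
  exact: ip_increments_start.
rewrite ipC (ip_increments_start (joint_increments_sym hj))//.
by rewrite (ipC P X').
Qed.

Lemma ip_increments k Y Y' s t s' t' X X' : joint_increments P H k Y Y' ->
  0 <= s -> s <= t -> 0 <= s' -> s' <= t' -> L2_adapted s X -> L2_adapted s' X' ->
  ip P (fun w => X w * (Y t w - Y s w)) (fun w => X' w * (Y' t' w - Y' s' w)) =
  k * overlap s t s' t' * ip P X X'.
Proof.
move=> hj s0 st s0' st' hX hX'.
have [ss'|/ltW s's] := leP s s'; first exact: ip_increments_le.
rewrite ipC (ip_increments_le (joint_increments_sym hj))// (ipC P X').
by rewrite /overlap (minC t') (maxC s').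
Qed.

End increments.

(** * Isometry on step functions *)

Definition endpoints {R : realType} (b : seq (R * R)) : seq R :=
  flatten [seq [:: p.1; p.2] | p <- b].

Definition box_increment {R : realType} {T : Type} (Y : R -> T -> R)
    (b : seq (R * R)) (w : T) : R :=
  \prod_(p <- b) (Y p.2 w - Y p.1 w).

(** The volume of the intersection of the two boxes, when they have the same dimension. *)
Definition box_overlap {R : realType} (b b' : seq (R * R)) : R :=
  \prod_(p <- zip b b') overlap p.1.1 p.1.2 p.2.1 p.2.2.

(** The L^2(R^n) inner product of the two step functions, as a finite sum free of integrator and
    probability. Being the same on every space, it is what links integrals against [B] to integrals
    against the rotations. *)
Definition step_gram {R : realType} (n : nat) (e e' : step n) : R :=
  \sum_(b <- e) \sum_(b' <- e') b.1 * b'.1 * box_overlap b.2 b'.2.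

Section box_isometry.
Context {R : realType} {d : measure_display} {T : measurableType d}.
Variables (P : probability T R) (H : R -> set (set T)).

Lemma ip_cst1 : ip P (cst 1) (cst 1) = 1.
Proof.
have e : (\int[P]_w ((cst 1 w : R) * cst 1 w)%:E = \int[P]_w cst 1%E w)%E.
  by apply: eq_integral => w _; rewrite /= mulr1.
rewrite /ip /Rintegral e integral_cst//=.
by rewrite probability_setT mule1.
Qed.

Lemma endpoints_rcons (b : seq (R * R)) q :
  endpoints (rcons b q) = endpoints b ++ [:: q.1; q.2].
Proof. by rewrite /endpoints map_rcons flatten_rcons. Qed.

Lemma path_endpoints_rcons (b : seq (R * R)) q :
  path <=%R 0 (endpoints (rcons b q)) =
  [&& path <=%R 0 (endpoints b), last 0 (endpoints b) <= q.1 & q.1 <= q.2].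
Proof. by rewrite endpoints_rcons cat_path /= andbT. Qed.

Lemma box_increment_rcons (Y : R -> T -> R) b q : box_increment Y (rcons b q) =
  (fun w => box_increment Y b w * (Y q.2 w - Y q.1 w)).
Proof.
by apply/funext => w; rewrite /box_increment -cats1 big_cat big_seq1.
Qed.

Lemma box_increment0 (Y : R -> T -> R) : box_increment Y [::] = cst 1.
Proof. by apply/funext => w; rewrite /box_increment big_nil. Qed.

Lemma box_increment_adapted (Y : R -> T -> R) b : normal_increments P H Y ->
  path <=%R 0 (endpoints b) ->
  0 <= last 0 (endpoints b) /\
  L2_adapted P H (last 0 (endpoints b)) (box_increment Y b).
Proof.
move=> hY; elim/last_ind: b => [|b q ih].
  by move=> _; rewrite box_increment0; split => //; exact: (L2_adapted1 hY).
rewrite path_endpoints_rcons => /and3P[/ih[l0 ab] lq qq].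
rewrite endpoints_rcons last_cat /= box_increment_rcons.
have q0 := le_trans l0 lq; split; first exact: le_trans qq.
apply: (L2_adapted_increment hY) => //; exact: (L2_adapted_sub hY l0 lq).
Qed.

(** The last factors are peeled off together: in an ordered box all other factors are known at the
    start of the last interval, so each peeling yields k times an overlap. A factor left over on one
    side is orthogonal to the constant 1. No permuted pairing of the factors arises, both boxes
    lying in the simplex. *)
Lemma ip_box_increment k (Y Y' : R -> T -> R) b b' :
  joint_increments P H k Y Y' ->
  path <=%R 0 (endpoints b) -> path <=%R 0 (endpoints b') ->
  ip P (box_increment Y b) (box_increment Y' b') =
  if size b == size b' then k ^+ size b * box_overlap b b' else 0.
Proof.
move=> hj; have [hY hY' _] := hj.
elim/last_ind: b b' => [|b q ih]; elim/last_ind => [|b' q' _].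
- move=> _ _; rewrite /= expr0 mul1r /box_overlap big_nil !box_increment0.
  exact: ip_cst1.
- move=> _; rewrite path_endpoints_rcons size_rcons /= => /and3P[pb' lq qq].
  have [l0 ab'] := box_increment_adapted hY' pb'.
  have q0 := le_trans l0 lq.
  rewrite box_increment0 box_increment_rcons ipC (ip_increment hY')//.
    exact: (L2_adapted_sub hY' l0 lq).
  exact: (L2_adapted1 hY).
- rewrite path_endpoints_rcons size_rcons /= => /and3P[pb lq qq] _.
  have [l0 ab] := box_increment_adapted hY pb.
  have q0 := le_trans l0 lq.
  rewrite box_increment0 box_increment_rcons (ip_increment hY)//.
    exact: (L2_adapted_sub hY l0 lq).
  exact: (L2_adapted1 hY).
rewrite !path_endpoints_rcons => /and3P[pb lq qq] /and3P[pb' lq' qq'].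
have [l0 ab] := box_increment_adapted hY pb.
have [l0' ab'] := box_increment_adapted hY' pb'.
have q0 := le_trans l0 lq; have q0' := le_trans l0' lq'.
rewrite !box_increment_rcons (ip_increments hj)//; last 2 first.
- exact: (L2_adapted_sub hY l0 lq).
- exact: (L2_adapted_sub hY' l0' lq').
rewrite ih// !size_rcons eqSS; case: eqP => [bb'|_]; last by rewrite mulr0.
rewrite /box_overlap zip_rcons// -cats1 big_cat big_seq1/= exprS.
ring.
Qed.

(** The redundant condition [b \in e] makes the ordering of each box available under the sum. *)
Lemma step_integralE (Y : R -> T -> R) n (e : step n) :
  step_integral Y e =
  fun w => \sum_(b <- e | b \in e) b.1 * box_increment Y b.2 w.
Proof.
apply/funext => w; rewrite -big_seq.
by apply: eq_bigr => b _; rewrite /box_increment big_tuple.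
Qed.

Lemma step_integral_L2 (Y : R -> T -> R) n (e : step n) :
  normal_increments P H Y -> ordered_step e ->
  step_integral Y e \in Lfun P 2%:E.
Proof.
move=> hY /allP he; rewrite step_integralE.
apply: L2_sum => b /he hb; apply: L2Z.
by have [_ []] := box_increment_adapted hY hb.
Qed.

Lemma ip_step_integral k (Y Y' : R -> T -> R) n m (e : step n) (e' : step m) :
  joint_increments P H k Y Y' -> ordered_step e -> ordered_step e' ->
  ip P (step_integral Y e) (step_integral Y' e') =
  \sum_(b <- e) \sum_(b' <- e') b.1 * b'.1 *
    (if n == m then k ^+ n * box_overlap b.2 b'.2 else 0).
Proof.
move=> hj he he'; have [hY hY' _] := hj.
have L2b b : b \in e -> box_increment Y b.2 \in Lfun P 2%:E.
  by move=> /(allP he)/(box_increment_adapted hY)[_ []].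
have L2b' b : b \in e' -> box_increment Y' b.2 \in Lfun P 2%:E.
  by move=> /(allP he')/(box_increment_adapted hY')[_ []].
have := step_integral_L2 hY' he'; rewrite !step_integralE => L2e'.
rewrite ip_suml//; last by move=> b /L2b hb; exact: L2Z.
rewrite [RHS]big_seq; apply: eq_bigr => b be.
rewrite ip_sumr//; last 2 first.
- by move=> b' /L2b' hb; exact: L2Z.
- by apply: L2Z; exact: L2b.
rewrite [RHS]big_seq; apply: eq_bigr => b' be'.
rewrite ipZl ?ipZr ?L2b ?L2b' ?L2Z ?L2b'// (ip_box_increment hj) ?size_tuple.
- by rewrite mulrA.
- exact: (allP he).
- exact: (allP he').
Qed.

Lemma ip_step_gram k (Y Y' : R -> T -> R) n (e e' : step n) :
  joint_increments P H k Y Y' -> ordered_step e -> ordered_step e' ->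
  ip P (step_integral Y e) (step_integral Y' e') = k ^+ n * step_gram e e'.
Proof.
move=> hj he he'; rewrite (ip_step_integral hj)// eqxx mulr_sumr.
apply: eq_bigr => b _; rewrite mulr_sumr; apply: eq_bigr => b' _; ring.
Qed.

Lemma ip_step_orthogonal k (Y Y' : R -> T -> R) n m (e : step n) (e' : step m) :
  n != m -> joint_increments P H k Y Y' -> ordered_step e -> ordered_step e' ->
  ip P (step_integral Y e) (step_integral Y' e') = 0.
Proof.
move=> nm hj he he'; rewrite (ip_step_integral hj)// (negbTE nm).
by apply: big1 => b _; apply: big1 => b' _; rewrite mulr0.
Qed.

End box_isometry.

(** * Brownian motion and normal martingales *)

Section gaussian_moments.
Context {R : realType}.
Notation mu := (@lebesgue_measure R).

Lemma cvg_inv_pinfty : (x : R)^-1 @[x --> +oo%R] --> (0 : R).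
Proof.
have h : \forall x \near +oo%R, 0 < (@id R) x by exact: nbhs_pinfty_gt.
by have [_] := gtr0_cvgV0 h; apply; exact: cvg_id.
Qed.

Lemma is_derive_continuous (g dg : R -> R) :
  (forall x : R, is_derive x (1 : R) g (dg x)) -> continuous g.
Proof.
move=> hg x; apply: differentiable_continuous; apply/derivable1_diffP.
exact: (@ex_derive _ _ _ _ _ _ _ (hg x)).
Qed.

Lemma is_derive_normal_fun (s x : R) : s != 0 ->
  is_derive x (1 : R) (normal_fun 0 s) (- x / s ^+ 2 * normal_fun 0 s x).
Proof.
move=> s0.
have -> : normal_fun 0 s = (fun y => expR (- y ^+ 2 * (s ^+ 2 *+ 2)^-1)).
  by apply/funext => y; rewrite /normal_fun subr0.
by apply: is_derive_eq; rewrite /GRing.scale/=; field.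
Qed.

(** Integration by parts: - x s^2 [normal_fun] has derivative (x^2 - s^2) [normal_fun]. The
    fundamental theorem on the half-line is applied to nonnegative integrands, so an exponential is
    added to the integrand, integrated separately, and cancelled at the end. *)
Lemma integral0y_sqr_gauss (s : R) : 0 < s ->
  (\int[mu]_(x in `[0%R, +oo[) (x ^+ 2 * normal_fun 0 s x)%:E =
   (s ^+ 2)%:E * \int[mu]_(x in `[0%R, +oo[) (normal_fun 0 s x)%:E)%E.
Proof.
move=> s0.
pose nf (x : R) : R := normal_fun 0 s x.
(* For x <= s this gives K e^(-x) >= 1; since [nf] <= 1, the term K s^2 e^(-x) outweighs (x^2 - s^2)
   [nf] on [0, s], the only range where the latter is negative. *)
pose K := expR s.
pose F (x : R) : R := - (x * s ^+ 2 * nf x) - K * s ^+ 2 * expR (- x).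
pose f (x : R) : R := (x ^+ 2 - s ^+ 2) * nf x + K * s ^+ 2 * expR (- x).
have s2 : 0 < s ^+ 2 by rewrite exprn_gt0.
have nf0 x : 0 < nf x by exact: expR_gt0.
have nf1 x : nf x <= 1.
  rewrite /nf /normal_fun -expR0 ler_expR subr0 mulNr oppr_le0.
  by rewrite divr_ge0 ?sqr_ge0// mulrn_wge0// ltW.
have dnf (x : R) : is_derive x (1 : R) nf (- x / s ^+ 2 * nf x).
  by apply: is_derive_normal_fun; rewrite gt_eqF.
have dF (x : R) : is_derive x (1 : R) F (f x).
  apply: is_derive_eq.
  rewrite /GRing.scale/= /f; field.
  by rewrite gt_eqF.
have cnf : continuous nf by exact: is_derive_continuous dnf.
pose E x : R := - (K * s ^+ 2 * expR (- x)).
pose e x : R := K * s ^+ 2 * expR (- x).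
have dE (x : R) : is_derive x (1 : R) E (e x).
  by apply: is_derive_eq; rewrite /GRing.scale/= /e; ring.
have de (x : R) : is_derive x (1 : R) e (- e x).
  by apply: is_derive_eq; rewrite /GRing.scale/= /e; ring.
have ce : continuous e by exact: is_derive_continuous de.
have cf : continuous f.
  move=> x; apply: cvgD; last exact: ce.
  apply: cvgM; last exact: cnf.
  by apply: cvgB; [exact: exprn_continuous|exact: cvg_cst].
have K0 : 0 < K by exact: expR_gt0.
have f0 (x : R) : 0 <= x -> 0 <= f x.
  move=> x0; have [sx|xs] := leP s x.
    rewrite /f addr_ge0//.
      by rewrite mulr_ge0 ?(ltW (nf0 x))// subr_ge0 lerXn2r// nnegrE ltW.
    by rewrite !mulr_ge0 ?expR_ge0// ltW.
  have Ke : 1 <= K * expR (- x).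
    by rewrite -expRD -expR0 ler_expR subr_ge0 ltW.
  have h1 : s ^+ 2 * nf x <= s ^+ 2 by rewrite ler_piMr// ltW.
  have h2 : s ^+ 2 <= s ^+ 2 * (K * expR (- x)) by rewrite ler_peMr// ltW.
  have h3 : 0 <= x ^+ 2 * nf x by rewrite mulr_ge0 ?sqr_ge0// ltW.
  by rewrite /f; lra.
(* From e^y >= 1 + y one gets [nf x] <= 2 s^2 / x^2 and e^(-x) <= 1 / x, so both primitives are O(1
   / x). *)
have small (x : R) : 0 < x -> `|F x| <= (2 * s ^+ 4 + K * s ^+ 2) * x^-1 /\ `|E x| <= (K * s ^+ 2) * x^-1.
  move=> x0.
  have hn : nf x <= 2 * s ^+ 2 / x ^+ 2.
    rewrite /nf /normal_fun subr0 mulNr expRN -[leRHS]invrK lef_pV2 ?posrE ?expR_gt0 ?invr_gt0 ?divr_gt0 ?mulr_gt0 ?exprn_gt0//.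
    apply: le_trans (expR_ge1Dx _).
    have -> : (2 * s ^+ 2 / x ^+ 2)^-1 = x ^+ 2 / (s ^+ 2 *+ 2).
      by field; rewrite !gt_eqF.
    by rewrite lerDr ler01.
  have he : expR (- x) <= x^-1.
    rewrite expRN lef_pV2 ?posrE ?expR_gt0//; apply: le_trans (expR_ge1Dx _).
    by rewrite lerDr ler01.
  have hE : `|E x| <= (K * s ^+ 2) * x^-1.
    rewrite /E normrN ger0_norm; first by rewrite ler_pM2l// mulr_gt0.
    by rewrite mulr_ge0 ?expR_ge0// mulr_ge0// ltW.
  split => //; rewrite mulrDl /F; apply: (le_trans (ler_normD _ _)); apply: lerD => //.
  rewrite normrN ger0_norm; last by rewrite !mulr_ge0// ltW.
  apply: (@le_trans _ _ (x * s ^+ 2 * (2 * s ^+ 2 / x ^+ 2))).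
    by rewrite ler_wpM2l// mulr_ge0// ltW.
  by rewrite le_eqVlt; apply/orP; left; apply/eqP; field; rewrite gt_eqF.
have lim0 (c : R) : c * (x : R)^-1 @[x --> +oo%R] --> (0 : R).
  by have := cvgM (cvg_cst c) cvg_inv_pinfty; rewrite mulr0; exact.
have limF : F x @[x --> +oo%R] --> (0 : R).
  apply: cvg0_norm_le (lim0 (2 * s ^+ 4 + K * s ^+ 2)).
  by near=> x; apply: (small x _).1.
have limE : E x @[x --> +oo%R] --> (0 : R).
  apply: cvg0_norm_le (lim0 (K * s ^+ 2)).
  by near=> x; apply: (small x _).2.
have ftc (g dg : R -> R) : (forall x : R, is_derive x (1 : R) g (dg x)) ->
    continuous dg -> (forall x, 0 <= x -> 0 <= dg x) ->
    g x @[x --> +oo%R] --> (0 : R) ->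
    (\int[mu]_(x in `[0%R, +oo[) (dg x)%:E = (- g 0)%:E)%E.
  move=> hg cdg dg0 lg.
  rewrite (@ge0_continuous_FTC2y _ dg g 0 0)//.
  - by rewrite sub0e EFinN.
  - exact: continuous_subspaceT.
  - by apply: cvg_at_right_filter; exact: (is_derive_continuous hg).
  - by move=> x _; rewrite derive1E; apply: derive_val.
have If := ftc _ _ dF cf f0 limF.
have Ie : (\int[mu]_(x in `[0%R, +oo[) (e x)%:E = (- E 0)%:E)%E.
  by apply: ftc => // x _; rewrite /e !mulr_ge0 ?expR_ge0// ltW.
have mcont (g : R -> R) : continuous g ->
    measurable_fun (`[0%R, +oo[%classic : set R) (EFin \o g).
  move=> cg; apply/measurable_EFinP/measurable_funTS.
  exact: continuous_measurable_fun.
have cx : continuous (fun x : R => x ^+ 2 * nf x).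
  by move=> x; apply: cvgM; [exact: exprn_continuous|exact: cnf].
have : (\int[mu]_(x in `[0%R, +oo[) ((x ^+ 2 * nf x)%:E + (e x)%:E) =
       \int[mu]_(x in `[0%R, +oo[) ((s ^+ 2)%:E * (nf x)%:E + (f x)%:E))%E.
  by apply: eq_integral => x _; rewrite -EFinM -!EFinD; congr EFin; rewrite /f /e; ring.
rewrite ge0_integralD//; last 4 first.
- by move=> x _; rewrite lee_fin mulr_ge0 ?sqr_ge0// ltW.
- exact: mcont.
- by move=> x _; rewrite lee_fin /e !mulr_ge0 ?expR_ge0// ltW.
- exact: mcont.
rewrite ge0_integralD//; last 4 first.
- by move=> x _; rewrite -EFinM lee_fin mulr_ge0// ltW.
- by apply: measurable_funeM; exact: mcont.
- by move=> x; rewrite /= in_itv/= andbT => x0; rewrite lee_fin f0.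
- exact: mcont.
rewrite ge0_integralZl_EFin//; last 3 first.
- by move=> x _; rewrite lee_fin ltW.
- exact: mcont.
- exact: ltW.
rewrite If Ie /E /F mul0r mul0r oppr0 sub0r opprK.
set c := (X in (_ + X)%E = _) => h.
by rewrite -[LHS](@addeK _ c) // h addeK.
Unshelve. all: by end_near. Qed.

Lemma ge0_integral_fold (h : R -> R) : (forall x, 0 <= h x) -> continuous h ->
  (\int[mu]_x (h x)%:E = \int[mu]_(x in `[0%R, +oo[) (h x + h (- x))%:E)%E.
Proof.
move=> h0 ch.
have mh : measurable_fun [set: R] h by exact: continuous_measurable_fun.
have mhN : measurable_fun [set: R] (h \o -%R) by apply: measurableT_comp => //.
under [RHS]eq_integral do rewrite EFinD.
rewrite ge0_integralD//=; last 4 first.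
- by move=> x _; rewrite lee_fin.
- exact/measurable_EFinP/measurable_funTS.
- by move=> x _; rewrite lee_fin.
- exact/measurable_EFinP/measurable_funTS.
rewrite -[in LHS](setUv `[0%R, +oo[%classic) ge0_integral_setU//=; last 4 first.
- exact: measurableC.
- by apply/measurable_EFinP; rewrite setUv.
- by move=> x _; rewrite lee_fin.
- exact/disj_setPCl.
congr (_ + _)%E; rewrite setCitvr.
rewrite integral_itv_bndo_bndc; last exact/measurable_EFinP/measurable_funTS.
rewrite -{1}oppr0 ge0_integration_by_substitutionNy//.
exact: continuous_subspaceT.
Qed.

(** The shift c lets the mean be recovered as well, by comparing c = 0 with c = 1, while every
    integrand stays nonnegative. *)
Lemma gaussian_moment d (T : measurableType d) (P : probability T R)
    (X : T -> R) (s c : R) : 0 < s -> measurable_fun [set: T] X ->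
  (forall A : set R, measurable A -> P (X @^-1` A) = normal_prob 0 s A) ->
  (\int[P]_w ((X w + c) ^+ 2)%:E = (s ^+ 2 + c ^+ 2)%:E)%E.
Proof.
move=> s0 mX lX; have sn0 : s != 0 by rewrite gt_eqF.
pose RX := @mfun_Sub _ _ T (measurableTypeR R) X (mem_set mX).
pose g (x : R) : R := (x + c) ^+ 2.
have mg : measurable_fun [set: R] g by apply/measurable_funX/measurable_funD.
have -> : (\int[P]_w ((X w + c) ^+ 2)%:E = \int[distribution P RX]_x (g x * 1)%:E)%E.
  under [RHS]eq_integral do rewrite mulr1.
  rewrite ge0_integral_distribution//; first exact/measurable_EFinP.
  by move=> x; rewrite lee_fin sqr_ge0.
pose pk := normal_peak s.
have pk0 : 0 < pk by exact: normal_peak_gt0.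
have cnf : continuous (normal_fun 0 s).
  by apply: is_derive_continuous => x; exact: is_derive_normal_fun.
have epdf x : normal_pdf 0 s x = pk * normal_fun 0 s x.
  by rewrite normal_pdfE.
(* The law of [X] with density 1 and Lebesgue measure with the normal density agree on all Borel
   sets, so [integral_adaptedM] applies with G the whole Borel sigma-algebra. *)
have -> : (\int[distribution P RX]_x (g x * 1)%:E = \int[mu]_x (g x * normal_pdf 0 s x)%:E)%E.
  refine (@integral_adaptedM R _ (measurableTypeR R) (distribution P RX) (@lebesgue_measure R) measurable (cst 1) (normal_pdf 0 s) g _ _ _ _ _ _ _ _ _).
  - exact: sigma_algebra_measurable.
  - by [].
  - exact: measurable_cst.
  - exact: measurable_normal_pdf.
  - by [].
  - by move=> x; exact: normal_pdf_ge0.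
  - move=> A mA.
    by rewrite (integral_cst _ mA 1%E) mul1e [LHS]lX.
  - by move=> A mA; rewrite -[X in measurable X]setTI; exact: mg.
  - by move=> x; exact: sqr_ge0.
pose I0 := (\int[mu]_(x in `[0%R, +oo[) (normal_fun 0 s x)%:E)%E.
have nfN x : normal_fun 0 s (- x) = normal_fun 0 s x by rewrite /normal_fun !subr0 sqrrN.
have mnf : measurable_fun [set: R] (normal_fun 0 s) by exact: measurable_normal_fun.
(* The total mass of the law gives the normalization of [I0], so the Gaussian integral itself is
   never evaluated. *)
have e1 : (1 = (2 * pk)%:E * I0)%E.
  rewrite -(integral_normal_pdf 0 s).
  under eq_integral do rewrite epdf.
  rewrite ge0_integral_fold; last 2 first.
  - by move=> x; rewrite mulr_ge0 ?normal_fun_ge0// ltW.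
  - by move=> x; apply: cvgM; [exact: cvg_cst|exact: cnf].
  rewrite /I0 -ge0_integralZl_EFin//; last 3 first.
  - by move=> x _; rewrite lee_fin normal_fun_ge0.
  - exact/measurable_EFinP/measurable_funTS.
  - by rewrite mulr_ge0// ltW.
  by apply: eq_integral => x _; rewrite nfN -EFinM; congr EFin; ring.
under eq_integral do rewrite epdf.
rewrite ge0_integral_fold; last 2 first.
- by move=> x; rewrite mulr_ge0 ?sqr_ge0// mulr_ge0 ?normal_fun_ge0// ltW.
- move=> x; apply: cvgM; last by apply: cvgM; [exact: cvg_cst|exact: cnf].
  apply: (@continuous_comp _ _ _ (fun x => x + c) (fun x => x ^+ 2)).
    by apply: cvgD; [exact: cvg_id|exact: cvg_cst].
  exact: exprn_continuous.
transitivity (\int[mu]_(x in `[0%R, +oo[) ((2 * pk)%:E * ((x ^+ 2 * normal_fun 0 s x)%:E +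
    (c ^+ 2)%:E * (normal_fun 0 s x)%:E)))%E.
  apply: eq_integral => x _; rewrite nfN.
  rewrite -[RHS]/((2 * pk * (x ^+ 2 * normal_fun 0 s x + c ^+ 2 * normal_fun 0 s x))%:E).
  by congr EFin; rewrite /g; ring.
have mx2 : measurable_fun (`[0%R, +oo[%classic : set R) (fun x => (x ^+ 2 * normal_fun 0 s x)%:E).
  exact/measurable_EFinP/measurable_funTS/measurable_funM.
have mnf' : measurable_fun (`[0%R, +oo[%classic : set R) (fun x => (normal_fun 0 s x)%:E).
  exact/measurable_EFinP/measurable_funTS.
rewrite ge0_integralZl_EFin//; last 3 first.
- move=> x _; rewrite adde_ge0// -?EFinM lee_fin mulr_ge0 ?normal_fun_ge0 ?sqr_ge0//.
- by apply: emeasurable_funD => //; exact: measurable_funeM.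
- by rewrite mulr_ge0// ltW.
rewrite ge0_integralD//; last 3 first.
- by move=> x _; rewrite lee_fin mulr_ge0 ?normal_fun_ge0 ?sqr_ge0.
- by move=> x _; rewrite -EFinM lee_fin mulr_ge0 ?normal_fun_ge0 ?sqr_ge0.
- exact: measurable_funeM.
rewrite integral0y_sqr_gauss// ge0_integralZl_EFin//; last 2 first.
- by move=> x _; rewrite lee_fin normal_fun_ge0.
- exact: sqr_ge0.
rewrite -/I0 -ge0_muleDl ?lee_fin ?sqr_ge0//.
by rewrite muleCA -e1 mule1 EFinD.
Qed.

End gaussian_moments.

(** * Increments of a normal martingale *)

Section normal_martingale.
Context {R : realType} {d : measure_display} {T : measurableType d}.
Variable P : probability T R.

Lemma adapted_indic (G : set (set T)) A : sigma_algebra [set: T] G -> G A ->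
  adapted G (\1_A : T -> R).
Proof.
move=> sG GA; apply/(adaptedP _ sG).
by apply: measurable_indic; exact: sub_sigma_algebra.
Qed.

(** (M_t - M_s)^2 = M_t^2 - M_s^2 - 2 M_s (M_t - M_s). On an event of time s the first difference
    integrates to (t - s) times the probability, because M^2 - t is a martingale, and the last term
    integrates to 0, because M_s and the event are known at time s. *)
Lemma normal_martingale_increments (G : R -> set (set T)) (M : R -> T -> R) :
  normal_martingale P G M -> normal_increments P G M.
Proof.
move=> [fG [aM iM mM] M2 _ [_ iQ mQ]]; split => // s t s0 st.
have t0 := le_trans s0 st; have [Hs Hle] := fG.
have [sG GT] := Hs _ s0; have [sGt GTt] := Hs _ t0.
have as' : adapted (G t) (M s) by apply: adapted_sub (aM _ s0); exact: Hle.
have Dm A : G s A -> \int[P]_(w in A) (M t w - M s w) = 0.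
  move=> GA; have mA := GT _ GA.
  rewrite RintegralB//; last 2 first.
  - exact: integrableS (iM _ t0).
  - exact: integrableS (iM _ s0).
  by rewrite /Rintegral (mM s t)// subrr.
have D2 : (M t \- M s) \in Lfun P 2%:E by apply: L2B; exact: M2.
split => //.
- by apply: adaptedB => //; exact: aM.
move=> A GA; have mA := GT _ GA.
have i2 r : 0 <= r -> P.-integrable setT (EFin \o (fun w => M r w ^+ 2)).
  by move=> r0; exact: (L2_integrableM (M2 _ r0) (M2 _ r0)).
have i2A r : 0 <= r -> P.-integrable A (EFin \o (fun w => M r w ^+ 2)).
  by move=> r0; apply: integrableS (i2 _ r0).
have ic c : P.-integrable A (EFin \o cst c).
  by apply: (integrableS measurableT) => //; exact: finite_measure_integrable_cst.
have e : \int[P]_(w in A) (M t w ^+ 2) - t * fine (P A) =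
         \int[P]_(w in A) (M s w ^+ 2) - s * fine (P A).
  have h r : 0 <= r -> \int[P]_(w in A) (M r w ^+ 2) - r * fine (P A) =
      \int[P]_(w in A) (M r w ^+ 2 - r).
    by move=> r0; rewrite RintegralB ?Rintegral_cst//; [exact: i2A|exact: ic].
  by rewrite !h// /Rintegral (mQ s t).
have iX : P.-integrable setT (EFin \o (fun w => M s w * (M t w - M s w))).
  exact: (L2_integrableM (M2 _ s0) D2).
have X0 : \int[P]_(w in A) (M s w * (M t w - M s w)) = 0.
  rewrite /Rintegral integral_setE -/(Rintegral P setT _).
  under eq_Rintegral do rewrite mulrA.
  apply: (@adapted_mean0 _ _ _ P (G s)) => //.
  - exact: (L2_integrable D2).
  - by apply: adaptedM => //; [exact: adapted_indic|exact: aM].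
  - apply: (integrable_le _ iX).
      apply: measurable_funM; last exact: (L2_measurable D2).
      apply: measurable_funM; first exact: measurable_indic.
      exact: (L2_measurable (M2 _ s0)).
    move=> w /=; rewrite -mulrA normrM ler_piMl// indicE.
    by case: (w \in A); rewrite ?normr1 ?normr0.
transitivity (\int[P]_(w in A) (M t w ^+ 2 - M s w ^+ 2 - 2 * (M s w * (M t w - M s w)))).
  by apply: eq_Rintegral => w _; ring.
have iXA : P.-integrable A (EFin \o (fun w => M s w * (M t w - M s w))).
  exact: integrableS iX.
rewrite RintegralB//; last 2 first.
- by apply: (@integrableB _ _ _ P A mA (fun w => (M t w ^+ 2)%:E) (fun w => (M s w ^+ 2)%:E)); exact: i2A.
- exact: (integrableZl mA 2 iXA).
rewrite RintegralZl// X0 mulr0 subr0 RintegralB//; [|exact: i2A|exact: i2A].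
lra.
Qed.

End normal_martingale.

Section independence.
Context {R : realType} {d : measure_display} {T : measurableType d}.
Variable P : probability T R.

(** The densities 1_D and the constant P(D) have the same integrals over the generating class, hence
    over the sigma-algebra it generates. *)
Lemma independent_generated (C : set (set T)) (D : set T) :
  setI_closed C -> C [set: T] -> C `<=` @measurable d T -> measurable D ->
  (forall E, C E -> P (E `&` D) = (P E * P D)%E) ->
  forall E, <<s C >> E -> P (E `&` D) = (P E * P D)%E.
Proof.
move=> CI CT Cm mD CD.
have sCm : <<s C >> `<=` @measurable d T.
  by apply: smallest_sub => //; exact: sigma_algebra_measurable.
have fD : (fine (P D))%:E = P D by rewrite fineK// fin_num_measure.
have e1 E : measurable E -> (\int[P]_(w in E) (\1_D w)%:E = P (E `&` D))%E.
  by move=> mE; rewrite integral_indic// setIC.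
have e2 E : measurable E -> (\int[P]_(w in E) (cst (fine (P D)) w)%:E = P E * P D)%E.
  by move=> mE; rewrite (integral_cst _ mE (fine (P D))%:E) fD muleC.
move=> E CE; rewrite -e1; last exact: sCm.
rewrite -e2; last exact: sCm.
apply: (integral_eq_generated CI CT Cm) => //.
- by apply: integrable_indic => //; rewrite ltey_eq fin_num_measure.
- exact: finite_measure_integrable_cst.
- by move=> w; rewrite fine_ge0.
- by move=> A CA; rewrite e1 ?e2 ?CD//; exact: Cm.
Qed.

(** On the sigma-algebra of [X], the densities 1_E and P(E) define the same measure, so the integral
    of (X + c)^2 over [E] is P(E) times its full integral. Subtracting the case c = 0 from the case
    c = 1 gives the vanishing first moment. *)
Lemma independent_gaussian (X : T -> R) (s : R) E : 0 < s ->
  measurable_fun [set: T] X -> measurable E ->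
  (forall A : set R, measurable A -> P (X @^-1` A) = normal_prob 0 s A) ->
  (forall A : set R, measurable A -> P (E `&` X @^-1` A) = (P E * P (X @^-1` A))%E) ->
  X \in Lfun P 2%:E /\ \int[P]_(w in E) X w = 0 /\
  \int[P]_(w in E) (X w ^+ 2) = s ^+ 2 * fine (P E).
Proof.
move=> s0 mX mE lX iX.
have PE : (fine (P E))%:E = P E by rewrite fineK// fin_num_measure.
have X2 : X \in Lfun P 2%:E.
  apply/L2_memP; split => //.
  have := gaussian_moment 0 s0 mX lX; under eq_integral do rewrite addr0.
  by move=> ->; exact: ltry.
have mom c : \int[P]_(w in E) ((X w + c) ^+ 2) = (s ^+ 2 + c ^+ 2) * fine (P E).
  rewrite /Rintegral integral_setE.
  have -> : (\int[P]_w (\1_E w * (X w + c) ^+ 2)%:E =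
             \int[P]_w ((X w + c) ^+ 2 * fine (P E))%:E)%E.
    under eq_integral do rewrite mulrC.
    apply: (@integral_adaptedM R d T P P (preimage_set_system setT X measurable)
      (\1_E) (cst (fine (P E))) (fun w => (X w + c) ^+ 2)).
    - by apply: sigma_algebra_preimage; exact: sigma_algebra_measurable.
    - by move=> _ [A mA <-]; exact: mX.
    - exact: measurable_indic.
    - exact: measurable_cst.
    - by move=> w; rewrite indicE.
    - by move=> w; rewrite fine_ge0.
    - move=> _ [A mA <-]; have mXA := mX measurableT A mA.
      rewrite integral_indic// (integral_cst _ mXA (fine (P E))%:E) PE.
      by rewrite !setTI; exact: iX.
    - move=> A mA; exists ((fun x : R => (x + c) ^+ 2) @^-1` A).
        rewrite -[X in measurable X]setTI.
        by apply: (@measurable_funX _ _ _ setT (fun x : R => x + c) 2) => //; exact: measurable_funD.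
      by rewrite setTI.
    - by move=> w; exact: sqr_ge0.
  under eq_integral do rewrite EFinM.
  rewrite ge0_integralZr//.
  - by rewrite (gaussian_moment c s0 mX lX).
  - by apply/measurable_EFinP/measurable_funX/measurable_funD.
  - by move=> w _; rewrite lee_fin sqr_ge0.
  - by rewrite lee_fin fine_ge0.
have m0 : \int[P]_(w in E) (X w ^+ 2) = s ^+ 2 * fine (P E).
  by have := mom 0; under eq_Rintegral do rewrite addr0; rewrite expr0n addr0.
split => //; split => //.
have XE : P.-integrable E (EFin \o X).
  by apply: (integrableS measurableT) => //; exact: L2_integrable.
have c1 : P.-integrable E (EFin \o cst 1).
  by apply: (integrableS measurableT) => //; exact: finite_measure_integrable_cst.
have X2E : P.-integrable E (EFin \o (fun w => X w ^+ 2)).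
  by apply: (integrableS measurableT) => //; exact: (L2_integrableM X2 X2).
have := mom 1.
have -> : \int[P]_(w in E) (X w + 1) ^+ 2 =
    \int[P]_(w in E) ((X w ^+ 2 + 2 * X w) + cst 1 w).
  by apply: eq_Rintegral => w _ /=; ring.
have X2' : P.-integrable E (EFin \o (fun w => 2 * X w)) by exact: (integrableZl mE 2 XE).
rewrite RintegralD//; last first.
  exact: (@integrableD _ _ _ P E mE (fun w => (X w ^+ 2)%:E) (fun w => (2 * X w)%:E)).
rewrite RintegralD// RintegralZl// Rintegral_cst// m0.
lra.
Qed.

End independence.

(** * The filtration of Brownian increments *)

Section brownian_filtration.
Context {R : realType} {d : measure_display} {T : measurableType d}.
Variable P : probability T R.
Implicit Types (B : R -> T -> R).

(** Increments are taken from time 0 because independence is available for increments. The times are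
    unordered, so that intersecting two cylinders amounts to concatenating their lists of times. *)
Definition increment_cylinder B (s : R) : set (set T) :=
  [set E | exists n (u : nat -> R) (A : nat -> set R),
    [/\ forall i, (i < n)%N -> 0 <= u i <= s, forall i, measurable (A i) &
        E = \bigcap_(i < n) ((B (u i) \- B 0) @^-1` A i)]].

Definition increment_filtration B (s : R) : set (set T) :=
  <<s increment_cylinder B s >>.

(** The same kind of event written with consecutive increments, the form in which independence is
    given. *)
Definition grid_cylinder B (n : nat) (t : nat -> R) : set (set T) :=
  [set E | exists2 A : nat -> set R, forall i, measurable (A i) &
    E = \bigcap_(i < n) ((B (t i.+1) \- B (t i)) @^-1` A i)].

Lemma setT_cylinder B s : increment_cylinder B s [set: T].
Proof.
exists 0%N, (fun=> 0), (fun=> setT); split => //.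
by rewrite bigcap_mkord big_ord0.
Qed.

Lemma setI_cylinder B s : setI_closed (increment_cylinder B s).
Proof.
move=> _ _ [n [u [A [us mA ->]]]] [m [v [A' [vs mA' ->]]]].
exists (n + m)%N, (fun i => if (i < n)%N then u i else v (i - n)%N),
  (fun i => if (i < n)%N then A i else A' (i - n)%N); split.
- move=> i inm; case: ifPn => [|]; first exact: us.
  by rewrite -leqNgt => ni; apply: vs; rewrite ltn_subLR.
- by move=> i; case: ifP.
apply/seteqP; split => w /=.
  move=> [h1 h2] i /= inm; case: ifPn => [|]; first exact: h1.
  by rewrite -leqNgt => ni; apply: h2; rewrite /= ltn_subLR.
move=> h; split => i /= ni.
  by have := h i (ltn_addr _ ni); rewrite ni.
have := h (n + i)%N; rewrite /= ltn_add2l => /(_ ni).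
by rewrite ltnNge leq_addr/= addKn.
Qed.

Lemma measurable_cylinder B s : (forall t, 0 <= t -> measurable_fun setT (B t)) ->
  increment_cylinder B s `<=` @measurable d T.
Proof.
move=> mB _ [n [u [A [us mA ->]]]].
apply: fin_bigcap_measurable => // i ni; rewrite -[X in measurable X]setTI.
have /andP[u0 _] := us _ ni.
by apply: measurable_funB => //; exact: mB.
Qed.

Lemma increment_filtrationP B : (forall t, 0 <= t -> measurable_fun setT (B t)) ->
  filtration (increment_filtration B).
Proof.
move=> mB; split => [t t0|s t s0 st].
  split; first exact: smallest_sigma_algebra.
  apply: smallest_sub; first exact: sigma_algebra_measurable.
  exact: measurable_cylinder.
apply: sub_sigma_algebra2 => _ [n [u [A [us mA ->]]]].
exists n, u, A; split => // i /us/andP[-> ui]; exact: le_trans st.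
Qed.

Lemma adapted_increment_filtration B s t : 0 <= s -> s <= t ->
  adapted (increment_filtration B t) (B t \- B s).
Proof.
move=> s0 st.
have h r : 0 <= r <= t -> adapted (increment_filtration B t) (B r \- B 0).
  move=> rt A mA; apply: sub_sigma_algebra.
  exists 1%N, (fun=> r), (fun=> A); split => //.
  by rewrite bigcap_mkord big_ord1.
rewrite (_ : B t \- B s = (B t \- B 0) \- (B s \- B 0)).
  apply: adaptedB; [exact: smallest_sigma_algebra|apply: h|apply: h].
    by rewrite (le_trans s0 st) lexx.
  by rewrite s0 st.
by apply/funext => w /=; ring.
Qed.

Lemma setI_grid_cylinder B n t : setI_closed (grid_cylinder B n t).
Proof.
move=> _ _ [A mA ->] [A' mA' ->]; exists (fun i => A i `&` A' i).
  by move=> i; exact: measurableI.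
apply/seteqP; split => w /=.
  by move=> [h h'] i ni; split; [apply: h|apply: h'].
by move=> h; split => i ni; have [] := h i ni.
Qed.

Lemma setT_grid_cylinder B n t : grid_cylinder B n t [set: T].
Proof. by exists (fun=> setT) => //; apply/seteqP; split => w //= _ i _. Qed.

Lemma measurable_grid_cylinder B n t :
  (forall r, 0 <= r -> measurable_fun setT (B r)) -> (forall i, 0 <= t i) ->
  grid_cylinder B n t `<=` @measurable d T.
Proof.
move=> mB t0 _ [A mA ->].
apply: fin_bigcap_measurable => // i ni; rewrite -[X in measurable X]setTI.
by apply: measurable_funB => //; exact: mB.
Qed.

Lemma adapted_grid_cylinder B n t j : (j <= n)%N ->
  adapted <<s grid_cylinder B n t >> (B (t j) \- B (t 0%N)).
Proof.
have sG : sigma_algebra [set: T] <<s grid_cylinder B n t >>.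
  exact: smallest_sigma_algebra.
elim: j => [_|j ih jn].
  rewrite (_ : _ \- _ = cst 0); first exact: adapted_cst.
  by apply/funext => w /=; rewrite subrr.
rewrite (_ : _ \- _ = (B (t j) \- B (t 0%N)) \+ (B (t j.+1) \- B (t j))).
  apply: adaptedD => //; first exact: (ih (ltnW jn)).
  move=> A mA; apply: sub_sigma_algebra.
  exists (fun i => if i == j then A else setT).
    by move=> i; case: ifP.
  apply/seteqP; split => w /= => [h i ni|/(_ j jn)]; last by rewrite eqxx.
  by case: eqP => // ->.
by apply/funext => w /=; ring.
Qed.

(** Two pi-lambda reductions. The first one leaves a cylinder at finitely many times. Sorting these
    times makes a grid whose consecutive increments generate the cylinder, and the second one leaves
    a cylinder in those increments, to which mutual independence applies. *)
Lemma brownian_independent B s t : brownian_motion P B -> 0 <= s -> s < t ->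
  forall E A, increment_filtration B s E -> measurable A ->
  P (E `&` (B t \- B s)%R @^-1` A) = (P E * P ((B t \- B s)%R @^-1` A))%E.
Proof.
move=> [mB _ _ iB _] s0 st E A FE mA; have t0 := le_trans s0 (ltW st).
have mD : measurable ((B t \- B s) @^-1` A).
  by rewrite -[X in measurable X]setTI; apply: measurable_funB => //; exact: mB.
move: E FE; apply: independent_generated => //.
- exact: setI_cylinder.
- exact: setT_cylinder.
- exact: measurable_cylinder.
move=> _ [n [u [A' [us mA' ->]]]].
pose tt := sort <=%R (mkseq u n).
pose g := rcons (0 :: tt) s.
(* [g] lists 0, the sorted times and s, at the indices 0 to n + 1. The default value t makes [tau]
   equal to t from index n + 2 on, so B_t - B_s is the grid increment of index n + 1. *)
pose tau j := nth t g j.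
have stt : size tt = n by rewrite size_sort size_mkseq.
have att x : x \in tt -> 0 <= x <= s.
  rewrite mem_sort => h.
  have [k nk <-] := elimT (nthP (0 : R)) h; rewrite size_mkseq in nk.
  by rewrite nth_mkseq// us.
have sg : sorted <=%R g.
  rewrite /= rcons_path path_min_sorted; last by apply/allP => x /att/andP[].
  rewrite (sort_sorted (@le_total _ R))/=.
  by have := mem_last 0 tt; rewrite inE => /predU1P[->//|/att/andP[]].
have tau0 : tau 0%N = 0 by [].
have sizeg : size g = n.+2 by rewrite size_rcons/= stt.
have taus : tau n.+1 = s by rewrite /tau nth_rcons/= stt ltnn eqxx.
have taut j : (n.+2 <= j)%N -> tau j = t by move=> nj; rewrite /tau nth_default// sizeg.
have tau_nd j : tau j <= tau j.+1.
  have [jn|] := ltnP j.+1 (size g); first exact: (sortedP t sg).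
  rewrite sizeg ltnS leq_eqVlt => /predU1P[<-|nj].
    by rewrite taus taut// ltW.
  by rewrite !taut// ltnW.
have tau_ge0 j : 0 <= tau j.
  by elim: j => [|j ih]; [rewrite tau0|exact: le_trans (tau_nd j)].
have FE : <<s grid_cylinder B n.+1 tau >>
    (\bigcap_(i < n) ((B (u i) \- B 0) @^-1` A' i)).
  apply: (@fin_bigcap_measurable _ (g_sigma_algebraType (grid_cylinder B n.+1 tau))) => // i ni.
  have : u i \in tt by rewrite mem_sort -(nth_mkseq (0 : R) u ni) mem_nth// size_mkseq.
  move=> uitt; have itt : (index (u i) tt < n)%N by rewrite -stt index_mem.
  have -> : u i = tau (index (u i) tt).+1.
    by rewrite /tau /g /= nth_rcons stt itt nth_index.
  have := @adapted_grid_cylinder B n.+1 tau _ (leqW itt); rewrite tau0.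
  by move=> aj; exact: aj.
apply: independent_generated FE => //.
- exact: setI_grid_cylinder.
- exact: setT_grid_cylinder.
- exact: measurable_grid_cylinder.
move=> _ [C mC ->].
have eD : B t \- B s = B (tau n.+2) \- B (tau n.+1) by rewrite taus taut.
have h1 := iB n.+1 tau (tau_ge0 0%N) tau_nd C mC.
(* The joint event is itself a grid event with one more increment, constrained by [A]; independence
   for n + 2 increments factors it. *)
pose C' i := if (i < n.+1)%N then C i else A.
have mC' i : measurable (C' i) by rewrite /C'; case: ifP.
have h2 := iB n.+2 tau (tau_ge0 0%N) tau_nd C' mC'.
rewrite h1 eD; move: h2; rewrite big_ord_recr/=.
have -> : C' n.+1 = A by rewrite /C' ltnn.
under eq_bigr => i _.
  have -> : C' i = C i by rewrite /C' ltn_ord.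
  over.
move=> <-; congr (P _); apply/seteqP; split => w /=.
  move=> [h ha] i /=; rewrite ltnS leq_eqVlt => /predU1P[->|ni].
    by rewrite /C' ltnn.
  by rewrite /C' ni; exact: h.
move=> h; split => [i ni|]; last by have := h n.+1 (ltnSn _); rewrite /C' ltnn.
by have := h i (ltnW ni); rewrite /C' ni.
Qed.

Lemma brownian_increments B : brownian_motion P B ->
  normal_increments P (increment_filtration B) B.
Proof.
move=> hB; have [mB _ nB _ _] := hB.
have fB := increment_filtrationP mB; split => // s t s0 st.
have t0 := le_trans s0 st.
have aD := adapted_increment_filtration (B := B) s0 st.
have Fsm : increment_filtration B s `<=` @measurable d T by have [/(_ s s0)[]] := fB.
(* The Gaussian law is prescribed for s < t; for s = t the increment is the zero variable. *)
move: st aD; rewrite le_eqVlt => /predU1P[<-|st] aD.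
  have e0 : B s \- B s = cst 0 by apply/funext => w /=; rewrite subrr.
  split => //; first by rewrite e0; exact: L2_cst.
    move=> A FA; under eq_Rintegral do rewrite subrr.
    by rewrite Rintegral_cst ?mul0r//; exact: Fsm.
  move=> A FA; under eq_Rintegral do rewrite subrr expr0n.
  by rewrite Rintegral_cst ?subrr ?mul0r//; exact: Fsm.
have sq0 : 0 < Num.sqrt (t - s) by rewrite sqrtr_gt0 subr_gt0.
have mD : measurable_fun setT (B t \- B s) by apply: measurable_funB; exact: mB.
have main E : increment_filtration B s E -> _ :=
  fun FE => independent_gaussian sq0 mD (Fsm _ FE) (nB s t s0 st)
    (fun A mA => brownian_independent hB s0 st FE mA).
have [D2 _] := main setT (@sub_sigma_algebra _ setT _ _ (setT_cylinder B s)).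
split => //.
- by move=> A /main[_ []].
- by move=> A /main[_ [_]]; rewrite sqr_sqrtr// subr_ge0 ltW.
Qed.

End brownian_filtration.

Section generated_mean.
Context {R : realType} {d : measure_display} {T : measurableType d}.
Variable P : probability T R.

Lemma Rintegral_setE (A : set T) (f : T -> R) :
  \int[P]_(w in A) f w = \int[P]_w (\1_A w * f w).
Proof. by rewrite /Rintegral integral_setE. Qed.

(** The signed density is split into its positive and negative parts, two finite measures to which
    the pi-lambda argument applies. *)
Lemma Rintegral_generated0 (C : set (set T)) (D : T -> R) :
  setI_closed C -> C [set: T] -> C `<=` @measurable d T ->
  P.-integrable [set: T] (EFin \o D) ->
  (forall A, C A -> \int[P]_(w in A) D w = 0) ->
  forall A, <<s C >> A -> \int[P]_(w in A) D w = 0.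
Proof.
move=> CI CT Cm iD D0 A CA.
have sCm : <<s C >> `<=` @measurable d T.
  by apply: smallest_sub => //; exact: sigma_algebra_measurable.
have mD : measurable_fun setT D by apply/measurable_EFinP; exact: measurable_int iD.
pose p w : R := (`|D w| + D w) / 2; pose n w : R := (`|D w| - D w) / 2.
have pE w : D w = p w - n w by rewrite /p /n; field.
have pn w : 0 <= p w <= `|D w| /\ 0 <= n w <= `|D w|.
  have h := ler_norm (D w); have h' := ler_norm (- D w); rewrite normrN in h'.
  by rewrite /p /n; split; apply/andP; split; lra.
have p0 w : 0 <= p w by have [/andP[]] := pn w.
have n0 w : 0 <= n w by have [_ /andP[]] := pn w.
have mN : measurable_fun setT (fun w => `|D w|) by exact: measurableT_comp.
have ip' : P.-integrable setT (EFin \o p).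
  apply: (integrable_le _ iD).
    by apply: measurable_funM => //; exact: measurable_funD.
  by move=> w; rewrite ger0_norm//; have [/andP[]] := pn w.
have in' : P.-integrable setT (EFin \o n).
  apply: (integrable_le _ iD).
    by apply: measurable_funM => //; exact: measurable_funB.
  by move=> w; rewrite ger0_norm//; have [_ /andP[]] := pn w.
have dec B : measurable B -> \int[P]_(w in B) D w = \int[P]_(w in B) p w - \int[P]_(w in B) n w.
  move=> mB; rewrite -RintegralB//; first by apply: eq_Rintegral => w _; exact: pE.
    exact: integrableS ip'.
  exact: integrableS in'.
rewrite dec; last exact: sCm.
apply/eqP; rewrite subr_eq0; apply/eqP; congr fine.
apply: (integral_eq_generated CI CT Cm ip' in' p0 n0 _ CA) => B CB.
have mB := Cm _ CB; have := D0 _ CB; rewrite dec// => /eqP; rewrite subr_eq0 => /eqP e.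
have := congr1 EFin e; rewrite /Rintegral !fineK//; apply: integrable_fin_num => //.
  exact: integrableS in'.
exact: integrableS ip'.
Qed.

Lemma Rintegral_generated (C : set (set T)) (D : T -> R) c :
  setI_closed C -> C [set: T] -> C `<=` @measurable d T ->
  P.-integrable [set: T] (EFin \o D) ->
  (forall A, C A -> \int[P]_(w in A) D w = c * fine (P A)) ->
  forall A, <<s C >> A -> \int[P]_(w in A) D w = c * fine (P A).
Proof.
move=> CI CT Cm iD Dc A CA.
have sCm : <<s C >> `<=` @measurable d T.
  by apply: smallest_sub => //; exact: sigma_algebra_measurable.
have icst : P.-integrable setT (EFin \o cst c).
  exact: finite_measure_integrable_cst.
have dec B : measurable B -> \int[P]_(w in B) (D w - c) = \int[P]_(w in B) D w - c * fine (P B).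
  move=> mB; rewrite RintegralB ?Rintegral_cst//.
    exact: integrableS iD.
  exact: integrableS icst.
apply/eqP; rewrite -subr_eq0 -dec; last exact: sCm.
apply/eqP; apply: (Rintegral_generated0 CI CT Cm) => //.
- exact: (@integrableB _ _ _ P setT measurableT (EFin \o D) (EFin \o cst c)).
- by move=> B CB; rewrite dec ?Dc ?subrr//; exact: Cm.
Qed.

End generated_mean.

(** * Rotations on the product space *)

Section product_space.
Context {R : realType} {d1 d2 : measure_display}
  {T1 : measurableType d1} {T2 : measurableType d2}.
Variables (P1 : probability T1 R) (P2 : probability T2 R).
Let P : probability (T1 * T2)%type R := (P1 \x P2)%E.

Lemma integrable_prodM (f : T1 -> R) (g : T2 -> R) :
  P1.-integrable [set: T1] (EFin \o f) -> P2.-integrable [set: T2] (EFin \o g) ->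
  P.-integrable [set: T1 * T2] (EFin \o (fun w => f w.1 * g w.2)).
Proof.
move=> iF iG.
have mf : measurable_fun setT f by apply/measurable_EFinP; exact: measurable_int iF.
have mg : measurable_fun setT g by apply/measurable_EFinP; exact: measurable_int iG.
apply/integrable12ltyP.
  apply/measurable_EFinP/measurable_funM; exact: measurableT_comp.
have /integrableP[_ Fo] := iF; have /integrableP[_ Go] := iG.
under eq_integral => x _.
  under eq_integral do rewrite /= normrM EFinM.
  rewrite ge0_integralZl_EFin//; last by do 2 apply: measurableT_comp => //.
  rewrite muleC.
  over.
rewrite ge0_integralZl//; last 2 first.
- by do 2 apply: measurableT_comp => //.
- exact: integral_ge0.
by rewrite lte_mul_pinfty// ?integral_ge0// ge0_fin_numE ?integral_ge0.
Qed.

Lemma Rintegral_prodM (f : T1 -> R) (g : T2 -> R) :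
  P1.-integrable [set: T1] (EFin \o f) -> P2.-integrable [set: T2] (EFin \o g) ->
  \int[P]_w (f w.1 * g w.2) = \int[P1]_x f x * \int[P2]_y g y.
Proof.
move=> iF iG; rewrite {1}/Rintegral.
have := integral12_prod_meas1 (integrable_prodM iF iG).
rewrite /fubini_F/= => <-.
have eg : (\int[P2]_y (g y)%:E = (\int[P2]_y g y)%:E)%E.
  by rewrite /Rintegral fineK//; exact: (integrable_fin_num measurableT iG).
under eq_integral => x _.
  under eq_integral do rewrite EFinM.
  rewrite integralZl// eg -EFinM.
  over.
by rewrite -[LHS]/(\int[P1]_x (f x * \int[P2]_y g y)) RintegralZr.
Qed.

Lemma Rintegral_rectangle (f : T1 -> R) (g : T2 -> R) A1 A2 :
  P1.-integrable [set: T1] (EFin \o f) -> P2.-integrable [set: T2] (EFin \o g) ->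
  measurable A1 -> measurable A2 ->
  \int[P]_(w in A1 `*` A2) (f w.1 * g w.2) =
  \int[P1]_(x in A1) f x * \int[P2]_(y in A2) g y.
Proof.
move=> iF iG mA1 mA2.
rewrite (Rintegral_setE P (A1 `*` A2)) (Rintegral_setE P1 A1) (Rintegral_setE P2 A2).
have iA d (T : measurableType d) (Q : probability T R) A h : measurable A ->
    Q.-integrable setT (EFin \o h) -> Q.-integrable setT (EFin \o (fun w => \1_A w * h w)).
  move=> mA ih; apply: (integrable_le _ ih).
    apply: measurable_funM; first exact: measurable_indic.
    by apply/measurable_EFinP; exact: measurable_int ih.
  move=> w; rewrite normrM ler_piMl// indicE.
  by case: (w \in A); rewrite ?normr1 ?normr0.
rewrite -Rintegral_prodM; [|exact: iA|exact: iA].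
apply: eq_Rintegral => -[x y] _ /=; rewrite !indicE in_setX/=.
by case: (x \in A1); case: (y \in A2); rewrite ?mul1r ?mul0r ?mulr0.
Qed.

Lemma L2_prodM (X : T1 -> R) (Y : T2 -> R) :
  X \in Lfun P1 2%:E -> Y \in Lfun P2 2%:E ->
  (fun w => X w.1 * Y w.2) \in Lfun P 2%:E.
Proof.
move=> hX hY; apply/L2_memP; split.
  have mX := L2_measurable hX; have mY := L2_measurable hY.
  by apply: measurable_funM; exact: measurableT_comp.
have /integrableP[_] := integrable_prodM (L2_integrableM hX hX) (L2_integrableM hY hY).
apply: le_lt_trans; rewrite le_eqVlt; apply/orP; left; apply/eqP.
apply: eq_integral => w _ /=.
by rewrite -!expr2 -exprMn ger0_norm// sqr_ge0.
Qed.

Definition product_filtration (G1 : R -> set (set T1)) (G2 : R -> set (set T2))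
  (s : R) : set (set (T1 * T2)) :=
  <<s [set A `*` B | A in G1 s & B in G2 s] >>.

Lemma product_filtrationP G1 G2 : filtration G1 -> filtration G2 ->
  filtration (product_filtration G1 G2).
Proof.
move=> [f1 l1] [f2 l2]; split => [t t0|s t s0 st].
  split; first exact: smallest_sigma_algebra.
  apply: smallest_sub; first exact: sigma_algebra_measurable.
  have [_ m1] := f1 _ t0; have [_ m2] := f2 _ t0.
  by move=> _ [A A1 [A' A2 <-]]; apply: measurableX; [exact: m1|exact: m2].
apply: sub_sigma_algebra2 => _ [A A1 [A' A2 <-]].
by exists A; [exact: (l1 s t)|exists A' => //; exact: (l2 s t)].
Qed.

Lemma sigma_algebra_setT (T : Type) (G : set (set T)) :
  sigma_algebra [set: T] G -> G [set: T].
Proof. by move=> [G0 GC _]; rewrite -(setD0 [set: T]); exact: GC. Qed.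

Lemma sigma_algebra_setI (T : pointedType) (G : set (set T)) :
  sigma_algebra [set: T] G -> setI_closed G.
Proof.
move=> sG A B GA GB; rewrite -(sigma_algebra_id sG).
apply: (@measurableI _ (g_sigma_algebraType G)).
  exact: sub_sigma_algebra.
exact: sub_sigma_algebra.
Qed.

(** Given the past, the increments of [B] and [M] both have variance t - s and zero covariance;
    expanding the product of the rotated increments leaves cos alpha cos beta + sin alpha sin
    beta. *)
Lemma joint_increments_rotation G1 G2 B M alpha beta :
  normal_increments P1 G1 B -> normal_increments P2 G2 M ->
  joint_increments P (product_filtration G1 G2) (cos (alpha - beta))
    (rotation B M alpha) (rotation B M beta).
Proof.
move=> [fG1 hB] [fG2 hM]; have fH := product_filtrationP fG1 fG2.
pose b s t (w : T1 * T2) := B t w.1 - B s w.1.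
pose m s t (w : T1 * T2) := M t w.2 - M s w.2.
have incE theta s t : rotation B M theta t \- rotation B M theta s =
    (fun w => cos theta * b s t w + sin theta * m s t w).
  by apply/funext => w; rewrite /rotation /b /m /=; ring.
have c1 d (T : measurableType d) (Q : probability T R) : (cst 1 : T -> R) \in Lfun Q 2%:E.
  exact: L2_cst.
have bL2 s t : 0 <= s -> s <= t -> b s t \in Lfun P 2%:E.
  move=> s0 st; have [D2 _ _ _] := hB s t s0 st.
  rewrite (_ : b s t = fun w => (B t \- B s) w.1 * cst 1 w.2).
    exact: (L2_prodM D2 (c1 _ _ P2)).
  by apply/funext => w; rewrite /b /= mulr1.
have mL2 s t : 0 <= s -> s <= t -> m s t \in Lfun P 2%:E.
  move=> s0 st; have [D2 _ _ _] := hM s t s0 st.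
  rewrite (_ : m s t = fun w => cst 1 w.1 * (M t \- M s) w.2).
    exact: (L2_prodM (c1 _ _ P1) D2).
  by apply/funext => w; rewrite /m /= mul1r.
(* Rectangles form a pi-system generating the product filtration, and over a rectangle the integral
   of f(x) g(y) factors. *)
have mean s t (f : T1 -> R) (g : T2 -> R) (cf cg c : R) : 0 <= s -> s <= t ->
    P1.-integrable setT (EFin \o f) -> P2.-integrable setT (EFin \o g) ->
    (forall A, G1 s A -> \int[P1]_(x in A) f x = cf * fine (P1 A)) ->
    (forall A, G2 s A -> \int[P2]_(x in A) g x = cg * fine (P2 A)) ->
    forall A, product_filtration G1 G2 s A ->
    \int[P]_(w in A) (f w.1 * g w.2) = cf * cg * fine (P A).
  move=> s0 st iF iG If Ig.
  have [s1 m1] := fG1.1 _ s0; have [s2 m2] := fG2.1 _ s0.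
  apply: Rintegral_generated.
  - move=> _ _ [A1 hA1 [A2 hA2 <-]] [A1' hA1' [A2' hA2' <-]].
    rewrite -setXI; exists (A1 `&` A1'); first exact: (sigma_algebra_setI s1).
    by exists (A2 `&` A2') => //; exact: (sigma_algebra_setI s2).
  - exists setT; first exact: sigma_algebra_setT.
    by exists setT; [exact: sigma_algebra_setT|rewrite setXTT].
  - by move=> _ [A1 hA1 [A2 hA2 <-]]; apply: measurableX; [exact: m1|exact: m2].
  - exact: integrable_prodM.
  move=> _ [A1 hA1 [A2 hA2 <-]].
  have mA1 := m1 _ hA1; have mA2 := m2 _ hA2.
  rewrite Rintegral_rectangle// If// Ig// /P /= product_measure1E// fineM ?fin_num_measure//.
  by ring.
have i1 d (T : measurableType d) (Q : probability T R) : Q.-integrable setT (EFin \o (cst 1 : T -> R)).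
  exact: finite_measure_integrable_cst.
have I1 d (T : measurableType d) (Q : probability T R) A : measurable A ->
    \int[Q]_(x in A) (cst 1 x : R) = 1 * fine (Q A).
  by move=> mA; rewrite Rintegral_cst.
have bmean s t : 0 <= s -> s <= t -> forall A, product_filtration G1 G2 s A ->
    [/\ \int[P]_(w in A) b s t w = 0, \int[P]_(w in A) m s t w = 0,
     \int[P]_(w in A) (b s t w * m s t w) = 0,
     \int[P]_(w in A) (b s t w * b s t w) = (t - s) * fine (P A) &
     \int[P]_(w in A) (m s t w * m s t w) = (t - s) * fine (P A)].
  move=> s0 st A HA.
  have [B2 _ B0 Bq] := hB s t s0 st; have [M2 _ M0 Mq] := hM s t s0 st.
  have [s1 m1] := fG1.1 _ s0; have [s2 m2] := fG2.1 _ s0.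
  have B0' A' : G1 s A' -> \int[P1]_(x in A') (B t \- B s) x = 0 * fine (P1 A').
    by move=> /B0 ->; rewrite mul0r.
  have M0' A' : G2 s A' -> \int[P2]_(x in A') (M t \- M s) x = 0 * fine (P2 A').
    by move=> /M0 ->; rewrite mul0r.
  have I11 A' : G1 s A' -> \int[P1]_(x in A') cst 1 x = 1 * fine (P1 A').
    by move=> /m1; exact: I1.
  have I12 A' : G2 s A' -> \int[P2]_(x in A') cst 1 x = 1 * fine (P2 A').
    by move=> /m2; exact: I1.
  split.
  - have := mean s t _ _ _ _ 0 s0 st (L2_integrable B2) (i1 _ _ P2) B0' I12 A HA.
    rewrite !mul0r => <-; apply: eq_Rintegral => w _; by rewrite mulr1.
  - have := mean s t _ _ _ _ 0 s0 st (i1 _ _ P1) (L2_integrable M2) I11 M0' A HA.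
    rewrite mulr0 mul0r => <-; apply: eq_Rintegral => w _; by rewrite mul1r.
  - have := mean s t _ _ _ _ 0 s0 st (L2_integrable B2) (L2_integrable M2) B0' M0' A HA.
    by rewrite !mul0r => <-; apply: eq_Rintegral => w _.
  - have := mean s t _ _ _ _ 0 s0 st (L2_integrableM B2 B2) (i1 _ _ P2) Bq I12 A HA.
    rewrite mulr1 => <-; apply: eq_Rintegral => w _; by rewrite mulr1.
  - have := mean s t _ _ _ _ 0 s0 st (i1 _ _ P1) (L2_integrableM M2 M2) I11 Mq A HA.
    rewrite mul1r => <-; apply: eq_Rintegral => w _; by rewrite mul1r.
have cross th th' s t A : 0 <= s -> s <= t -> product_filtration G1 G2 s A ->
    \int[P]_(w in A) ((cos th * b s t w + sin th * m s t w) *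
                      (cos th' * b s t w + sin th' * m s t w)) =
    cos (th - th') * (t - s) * fine (P A).
  move=> s0 st HA; have [_ _ bm bb mm] := bmean s t s0 st A HA.
  have mA : measurable A by have [_] := fH.1 _ s0; apply.
  have iA (X Y : T1 * T2 -> R) c : X \in Lfun P 2%:E -> Y \in Lfun P 2%:E ->
      P.-integrable A (EFin \o (fun w => c * (X w * Y w))).
    move=> hX hY; apply: (integrableS measurableT) => //.
    exact: (integrableZl measurableT c (L2_integrableM hX hY)).
  have hb := bL2 s t s0 st; have hm := mL2 s t s0 st.
  transitivity (\int[P]_(w in A) (((cos th * cos th') * (b s t w * b s t w) +
     (cos th * sin th' + sin th * cos th') * (b s t w * m s t w)) +
     (sin th * sin th') * (m s t w * m s t w))).
    by apply: eq_Rintegral => w _; ring.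
  have L := fun X Y (hX : X \in Lfun P 2%:E) (hY : Y \in Lfun P 2%:E) =>
    integrableS measurableT mA (@subsetT _ A) (L2_integrableM hX hY).
  rewrite RintegralD//; last 2 first.
  - by apply: (@integrableD _ _ _ P A mA (fun w => ((cos th * cos th') * (b s t w * b s t w))%:E)
     (fun w => ((cos th * sin th' + sin th * cos th') * (b s t w * m s t w))%:E)); exact: iA.
  - exact: iA.
  rewrite RintegralD//; [|exact: iA|exact: iA].
  rewrite !RintegralZl//; try exact: L.
  by rewrite bm bb mm cosB; ring.
have normal th : normal_increments P (product_filtration G1 G2) (rotation B M th).
  split => // s t s0 st; have t0 := le_trans s0 st.
  have hb := bL2 s t s0 st; have hm := mL2 s t s0 st.
  have [sH mH] := fH.1 _ t0; have [sHs mHs] := fH.1 _ s0.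
  split.
  - by rewrite incE; exact: (L2D (L2Z _ hb) (L2Z _ hm)).
  - rewrite incE; apply: adaptedD => //; apply: adaptedM => //; try exact: adapted_cst.
    + move=> A mA; apply: sub_sigma_algebra.
      have [_ aB _ _] := hB s t s0 st.
      exists ((B t \- B s) @^-1` A); first exact: aB.
      exists setT; first by have [/sigma_algebra_setT] := fG2.1 _ t0.
      by apply/seteqP; split => w /=; [case|].
    + move=> A mA; apply: sub_sigma_algebra.
      have [_ aM _ _] := hM s t s0 st.
      exists setT; first by have [/sigma_algebra_setT] := fG1.1 _ t0.
      exists ((M t \- M s) @^-1` A); first exact: aM.
      by apply/seteqP; split => w /=; [case|].
  - move=> A HA; have mA := mHs _ HA.
    have [b0 m0 _ _ _] := bmean s t s0 st A HA.
    have ib := integrableS measurableT mA (@subsetT _ A) (L2_integrable hb).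
    have im := integrableS measurableT mA (@subsetT _ A) (L2_integrable hm).
    transitivity (\int[P]_(w in A) (cos th * b s t w + sin th * m s t w)).
      by apply: eq_Rintegral => w _; rewrite -[RHS]/((fun w => cos th * b s t w + sin th * m s t w) w) -incE.
    rewrite RintegralD//; [|exact: (integrableZl mA _ ib)|exact: (integrableZl mA _ im)].
    by rewrite !RintegralZl// b0 m0 !mulr0 addr0.
  (* The variance of a single rotation is the case of equal angles, the factor 1 being written cos
     (th - th). *)
  - move=> A HA; rewrite -[t - s]mul1r -cos0 -(subrr th) -(cross th th s t)//.
    apply: eq_Rintegral => w _; rewrite expr2.
    by have := congr1 (fun f => f w) (incE th s t) => /= ->.
split => // s t s0 st A HA; rewrite -(cross alpha beta s t)//.
apply: eq_Rintegral => w _.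
have := congr1 (fun f => f w) (incE alpha s t) => /= ->.
by have := congr1 (fun f => f w) (incE beta s t) => /= ->.
Qed.

End product_space.

(** * Iterated integrals over the orthant and the simplex *)

Section integral_Rn.
Context {R : realType}.
Notation mu := (@lebesgue_measure R).
Notation pos := (`[0%R, +oo[%classic : set R).

Lemma measurable_snd_R d (X : measurableType d) :
  measurable_fun [set: X * measurableTypeR R] (fun z => z.2 : R).
Proof. exact: measurable_snd. Qed.

Lemma measurable_fun_integral_pos d (X : measurableType d)
    (h : X * measurableTypeR R -> \bar R) :
  measurable_fun setT h -> (forall z, (0 <= h z)%E) ->
  measurable_fun [set: X] (fun x => \int[mu]_(s in pos) h (x, s))%E.
Proof.
move=> mh h0.
pose h' (z : X * measurableTypeR R) : \bar R := ((\1_pos z.2)%:E * h z)%E.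
have mh' : measurable_fun setT h'.
  apply: emeasurable_funM => //; apply/measurable_EFinP.
  apply: (@measurableT_comp _ _ _ _ _ _ (\1_pos : measurableTypeR R -> R)) => //.
have := @measurable_fun_fubini_tonelli_F _ _ X (measurableTypeR R) R mu h' mh'.
rewrite /fubini_F /h'/=; have -> : (fun x : X => \int[mu]_y ((\1_pos y)%:E * h (x, y)))%E =
    (fun x => \int[mu]_(s in pos) h (x, s))%E.
  apply/funext => x; rewrite [RHS]integral_mkcond; apply: eq_integral => y _.
  by rewrite patchE indicE; case: (y \in _); rewrite ?mul1e ?mul0e.
apply => z; rewrite mule_ge0// lee_fin indicE//.
Qed.

Lemma integral_Rn_ge0 n (g : n.-tuple R -> \bar R) :
  (forall x, (0 <= g x)%E) -> (0 <= integral_Rn g)%E.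
Proof.
elim: n g => [|n ih] g g0 /=; first exact: g0.
by apply: integral_ge0 => s _; apply: ih.
Qed.

(** The parameter space [X] is there for the induction: each step moves the first coordinate of the
    tuple into the parameter. *)
Lemma measurable_integral_Rn n d (X : measurableType d)
    (g : X * n.-tuple R -> \bar R) :
  measurable_fun setT g -> (forall z, (0 <= g z)%E) ->
  measurable_fun [set: X] (fun x => integral_Rn (fun y => g (x, y))).
Proof.
elim: n d X g => [|n ih] d X g mg g0 /=.
  apply: (measurableT_comp mg); exact: measurable_fun_pair.
pose g' (z : (X * measurableTypeR R) * n.-tuple R) := g (z.1.1, [tuple of z.1.2 :: z.2]).
have := ih _ _ g'; rewrite /g' /= => H.
apply: (@measurable_fun_integral_pos _ X (fun z => integral_Rn (fun y => g (z.1, [tuple of z.2 :: y])))).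
  apply: H => //; apply: (measurableT_comp mg); apply: measurable_fun_pair => /=.
    exact: measurableT_comp.
  apply: measurable_cons => //.
  have h : measurable_fun [set: (X * measurableTypeR R) * n.-tuple R]
      (fun z => z.1.2 : measurableTypeR R).
    by apply: measurableT_comp => //; exact: measurable_snd.
  exact: h.
by move=> z; exact: integral_Rn_ge0.
Qed.

Lemma measurable_integral_Rn_slice n (g : n.+1.-tuple R -> \bar R) :
  measurable_fun setT g -> (forall x, (0 <= g x)%E) ->
  measurable_fun [set: measurableTypeR R]
    (fun s => integral_Rn (fun y => g [tuple of s :: y])).
Proof.
move=> mg g0.
apply: (@measurable_integral_Rn n _ (measurableTypeR R) (fun z => g [tuple of z.1 :: z.2])) => //.
by apply: (measurableT_comp mg); apply: measurable_cons.
Qed.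

Lemma measurable_slice n d (Y : measurableType d) (g : n.+1.-tuple R -> Y) (s : R) :
  measurable_fun setT g ->
  measurable_fun [set: n.-tuple R] (fun y => g [tuple of s :: y]).
Proof.
by move=> mg; apply: (measurableT_comp mg); apply: measurable_cons.
Qed.

Lemma integral_RnD n (f g : n.-tuple R -> \bar R) :
  measurable_fun setT f -> measurable_fun setT g ->
  (forall x, (0 <= f x)%E) -> (forall x, (0 <= g x)%E) ->
  (integral_Rn (fun x => f x + g x) = integral_Rn f + integral_Rn g)%E.
Proof.
elim: n f g => [//|n ih] f g mf mg f0 g0 /=.
under eq_integral => s _.
  rewrite ih//; [over|exact: measurable_slice|exact: measurable_slice].
rewrite ge0_integralD//.
- by move=> s _; exact: integral_Rn_ge0.
- by apply: measurable_funTS; exact: measurable_integral_Rn_slice.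
- by move=> s _; exact: integral_Rn_ge0.
- by apply: measurable_funTS; exact: measurable_integral_Rn_slice.
Qed.

Lemma integral_RnZl n (c : R) (f : n.-tuple R -> \bar R) : 0 <= c ->
  measurable_fun setT f -> (forall x, (0 <= f x)%E) ->
  (integral_Rn (fun x => c%:E * f x) = c%:E * integral_Rn f)%E.
Proof.
move=> c0; elim: n f => [//|n ih] f mf f0 /=.
under eq_integral => s _.
  rewrite ih//; [over|exact: measurable_slice].
rewrite ge0_integralZl_EFin//.
- by move=> s _; exact: integral_Rn_ge0.
- by apply: measurable_funTS; exact: measurable_integral_Rn_slice.
Qed.

Lemma eq_integral_Rn n (f g : n.-tuple R -> \bar R) : f =1 g ->
  integral_Rn f = integral_Rn g.
Proof. by move=> /funext ->. Qed.

Lemma le_integral_Rn n (f g : n.-tuple R -> \bar R) :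
  measurable_fun setT f -> measurable_fun setT g ->
  (forall x, (0 <= f x)%E) -> (forall x, (f x <= g x)%E) ->
  (integral_Rn f <= integral_Rn g)%E.
Proof.
elim: n f g => [|n ih] f g mf mg f0 fg /=; first exact: fg.
have g0 x : (0 <= g x)%E by exact: le_trans (fg x).
apply: ge0_le_integral => //.
- by move=> s _; exact: integral_Rn_ge0.
- by apply: measurable_funTS; exact: measurable_integral_Rn_slice.
- by apply: measurable_funTS; exact: measurable_integral_Rn_slice.
- move=> s _; apply: ih => //; exact: measurable_slice.
Qed.

Lemma integral_Rn_sum n (I : Type) (r : seq I) (f : I -> n.-tuple R -> \bar R) :
  (forall i, measurable_fun setT (f i)) -> (forall i x, (0 <= f i x)%E) ->
  (integral_Rn (fun x => \sum_(i <- r) f i x) = \sum_(i <- r) integral_Rn (f i))%E.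
Proof.
move=> mf f0; elim: r => [|i r ih].
  rewrite big_nil (@eq_integral_Rn _ _ (fun x => 0%:E * 0)%E); last first.
    by move=> x; rewrite big_nil mul0e.
  by rewrite integral_RnZl ?mul0e.
rewrite big_cons -ih -integral_RnD//; last 2 first.
- exact: emeasurable_sum.
- by move=> x; exact: sume_ge0.
by apply: eq_integral_Rn => x; rewrite big_cons.
Qed.

End integral_Rn.

(** * Integration over the simplex *)

Section simplex.
Context {R : realType}.
Notation mu := (@lebesgue_measure R).
Notation mR := (measurableTypeR R).

(** The domain is a < x_1 < ... < x_n. The lower end is a parameter because fixing the first
    coordinate moves it. *)
Definition simplex_integral n (a : R) (g : n.-tuple R -> \bar R) : \bar R :=
  integral_Rn (fun x => if path <%R a x then g x else 0%E).

(** Symmetry is phrased through [perm_eq] on the underlying sequences, a form that passes to slices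
    and allows swapping two given coordinates. *)
Definition perm_invariant n (g : n.-tuple R -> \bar R) :=
  forall x y : n.-tuple R, perm_eq x y -> g x = g y.

Lemma measurable_path n d (X : measurableType d) (f : X -> R) (y : X -> n.-tuple R) :
  measurable_fun setT f -> measurable_fun setT y ->
  measurable_fun setT (fun x => path <%R (f x) (y x)).
Proof.
elim: n f y => [|n ih] f y mf my.
  rewrite (_ : (fun x => _) = cst true); first exact: measurable_cst.
  by apply/funext => x; rewrite (tuple0 (y x)).
pose h x := tnth (y x) ord0.
have mh : measurable_fun setT h.
  by apply: (measurableT_comp (measurable_tnth ord0)).
rewrite (_ : (fun x => _) = fun x => (f x < h x) && path <%R (h x) [tuple of behead (y x)]).
  apply: measurable_and; first exact: measurable_fun_ltr.
  by apply: ih => //; exact: (measurableT_comp (@measurable_behead _ _ n) my).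
by apply/funext => x; rewrite {1}(tuple_eta (y x)).
Qed.

Lemma measurable_simplex n d (X : measurableType d) (a : X -> R)
    (y : X -> n.-tuple R) (g : X -> \bar R) :
  measurable_fun setT a -> measurable_fun setT y -> measurable_fun setT g ->
  measurable_fun setT (fun x => if path <%R (a x) (y x) then g x else 0%E).
Proof.
move=> ma my mg; apply: measurable_fun_ifT => //; exact: measurable_path.
Qed.

Lemma integral_gt (a : R) (f : R -> \bar R) :
  (\int[mu]_(s in `]a, +oo[) f s = \int[mu]_s (if (a < s)%R then f s else 0))%E.
Proof.
rewrite integral_mkcond; apply: eq_integral => s _.
by rewrite patchE mem_setE in_itv/= andbT.
Qed.

Lemma integral_Rn_cst0 n : integral_Rn (fun _ : n.-tuple R => 0%E : \bar R) = 0%E.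
Proof.
have -> : (fun _ : n.-tuple R => 0%E : \bar R) = (fun x => 0%:E * cst 0 x)%E.
  by apply/funext => x; rewrite mul0e.
by rewrite integral_RnZl ?mul0e//; exact: measurable_cst.
Qed.

Lemma simplex_integral_ge0 n a (g : n.-tuple R -> \bar R) :
  (forall x, (0 <= g x)%E) -> (0 <= simplex_integral a g)%E.
Proof. by move=> g0; apply: integral_Rn_ge0 => x; case: ifP. Qed.

Lemma simplex_integralS n a (g : n.+1.-tuple R -> \bar R) : 0 <= a ->
  simplex_integral a g =
  (\int[mu]_(s in `]a, +oo[)
     simplex_integral s (fun y => g [tuple of s :: y]))%E.
Proof.
move=> a0; rewrite integral_gt /simplex_integral/= integral_mkcond.
apply: eq_integral => s _; rewrite patchE mem_setE in_itv/= andbT.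
case: (ltP a s) => [/(le_lt_trans a0)/ltW ->//|sa] /=.
by rewrite integral_Rn_cst0; case: ifP.
Qed.

Lemma perm_invariant_slice n (g : n.+1.-tuple R -> \bar R) s :
  perm_invariant g -> perm_invariant (fun y => g [tuple of s :: y]).
Proof. by move=> gS x y xy; apply: gS; rewrite /= perm_cons. Qed.

Lemma measurable_simplex_integral n d (X : measurableType d) (a : X -> R)
    (g : X * n.-tuple R -> \bar R) :
  measurable_fun setT a -> measurable_fun setT g -> (forall z, (0 <= g z)%E) ->
  measurable_fun setT (fun x => simplex_integral (a x) (fun y => g (x, y))).
Proof.
move=> ma mg g0.
apply: (@measurable_integral_Rn _ n _ X (fun z => if path <%R (a z.1) z.2 then g z else 0%E)).
  by apply: measurable_simplex => //; exact: measurableT_comp.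
by move=> z; case: ifP.
Qed.

(* Inserting s into an increasing y: either s comes first, or y = r :: y' with
   r <= s, and swapping s and r reduces to the insertion of s into y'. *)
Lemma simplex_insertion n (g : n.+1.-tuple R -> \bar R) a : 0 <= a ->
  measurable_fun setT g -> (forall x, (0 <= g x)%E) -> perm_invariant g ->
  (\int[mu]_(s in `]a, +oo[) simplex_integral a (fun y => g [tuple of s :: y]) =
   n.+1%:R%:E * simplex_integral a g)%E.
Proof.
elim: n g a => [|n ih] g a a0 mg g0 gS; first by rewrite mul1e simplex_integralS.
have mid : measurable_fun [set: mR] (fun x : mR => x : R) by exact: measurable_id.
pose K (z : mR * mR) : \bar R :=
  simplex_integral z.2 (fun y : n.-tuple R => g [tuple of z.1 :: [tuple of z.2 :: y]]).
have K0 z : (0 <= K z)%E by exact: simplex_integral_ge0.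
have m1 : measurable_fun [set: mR * mR] (fun z => z.1 : R) by exact: measurable_fst.
have m2 : measurable_fun [set: mR * mR] (fun z => z.2 : R) by exact: measurable_snd.
have mK : measurable_fun [set: mR * mR] K.
  apply: (@measurable_simplex_integral n _ _ (fun z : mR * mR => z.2 : R)
    (fun z => g [tuple of z.1.1 :: [tuple of z.1.2 :: z.2]])) => //.
  apply: (measurableT_comp mg); apply: measurable_cons.
    exact: (measurableT_comp m1 measurable_fst).
  apply: measurable_cons => //; exact: (measurableT_comp m2 measurable_fst).
pose hA (z : mR * mR) : \bar R := if (a < z.2) && (z.2 <= z.1) then K z else 0%E.
pose hB (z : mR * mR) : \bar R := if (a < z.1) && (z.1 < z.2) then K z else 0%E.
have mhA : measurable_fun setT hA.
  apply: measurable_fun_ifT => //; apply: measurable_and.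
    by apply: measurable_fun_ltr => //; exact: measurable_cst.
  exact: measurable_fun_ler.
have mhB : measurable_fun setT hB.
  apply: measurable_fun_ifT => //; apply: measurable_and.
    by apply: measurable_fun_ltr => //; exact: measurable_cst.
  exact: measurable_fun_ltr.
have hA0 z : (0 <= hA z)%E by rewrite /hA; case: ifP.
have hB0 z : (0 <= hB z)%E by rewrite /hB; case: ifP.
have mFA := @measurable_fun_fubini_tonelli_F _ _ mR mR R mu hA mhA hA0.
have mFB := @measurable_fun_fubini_tonelli_F _ _ mR mR R mu hB mhB hB0.
have msl (s : mR) (h : mR * mR -> \bar R) : measurable_fun setT h ->
    measurable_fun [set: mR] (fun r : mR => h (s, r)).
  move=> mh; apply: (measurableT_comp mh).
  by apply: measurable_fun_pair; [exact: measurable_cst|exact: measurable_id].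
have -> : (\int[mu]_(s in `]a, +oo[) simplex_integral a (fun y => g [tuple of s :: y]) =
  \int[mu]_s (\int[mu]_r hA (s, r) + \int[mu]_r hB (s, r)))%E.
  rewrite integral_gt; apply: eq_integral => s _.
  rewrite -ge0_integralD//; last 2 first.
  - exact: msl.
  - exact: msl.
  case: (ltP a s) => [as'|sa].
    rewrite simplex_integralS// integral_gt; apply: eq_integral => r _.
    rewrite /hA /hB/= as'/=; case: (ltP s r) => [sr|rs].
      by rewrite (lt_trans as' sr) /= add0e.
    by rewrite andbT adde0.
  rewrite -[LHS](integral0 mu setT); apply: eq_integral => r _.
  rewrite /hA /hB/= (ltNge a s) sa/= adde0.
  by case: ifP => // /andP[ar rs]; have := lt_le_trans ar (le_trans rs sa); rewrite ltxx.
rewrite ge0_integralD//; last 2 first.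
- by move=> s _; exact: integral_ge0.
- by move=> s _; exact: integral_ge0.
have -> : (\int[mu]_s \int[mu]_r hB (s, r) = simplex_integral a g)%E.
  rewrite simplex_integralS// integral_gt; apply: eq_integral => s _.
  case: (ltP a s) => [as'|sa].
    rewrite simplex_integralS; last exact: le_trans (ltW as').
    rewrite integral_gt; apply: eq_integral => r _.
    by rewrite /hB/= as'.
  rewrite -[RHS](integral0 mu setT); apply: eq_integral => r _.
  by rewrite /hB/= (ltNge a s) sa.
have -> : (\int[mu]_s \int[mu]_r hA (s, r) = n.+1%:R%:E * simplex_integral a g)%E.
  transitivity (\int[mu]_r \int[mu]_s hA (s, r))%E.
    exact: (@fubini_tonelli _ _ mR mR R mu mu hA mhA hA0).
  rewrite simplex_integralS// -ge0_integralZl_EFin//; last 2 first.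
  - by move=> r _; exact: simplex_integral_ge0.
  - apply: measurable_funTS.
    apply: (@measurable_simplex_integral n.+1 _ mR idfun (fun z => g [tuple of z.1 :: z.2])) => //.
    by apply: (measurableT_comp mg); apply: measurable_cons => //;
      exact: (measurableT_comp mid measurable_fst).
  rewrite integral_gt; apply: eq_integral => r _.
  case: (ltP a r) => [ar|ra]; last first.
    rewrite -[RHS](integral0 mu setT); apply: eq_integral => s _.
    by rewrite /hA/= (ltNge a r) ra.
  have r0 := le_trans a0 (ltW ar).
  rewrite -ih//; last 2 first.
  - exact: measurable_slice.
  - exact: perm_invariant_slice.
  transitivity (\int[mu]_(s in `[r, +oo[) K (s, r))%E.
    rewrite [RHS]integral_mkcond; apply: eq_integral => s _.
    by rewrite patchE mem_setE in_itv/= andbT /hA/= ar.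
  rewrite -integral_itv_obnd_cbnd; last first.
    apply: measurable_funTS; apply: (measurableT_comp mK).
    by apply: measurable_fun_pair; [exact: measurable_id|exact: measurable_cst].
  apply: eq_integral => s _; apply: eq_integral_Rn => y.
  case: ifP => // _; apply: gS => /=.
  rewrite -[s :: r :: y]/([:: s] ++ [:: r] ++ y).
  by rewrite -[r :: s :: y]/([:: r] ++ [:: s] ++ y) perm_catCA.
rewrite -[X in (_ + X)%E]mul1e -ge0_muleDl ?lee_fin//.
by rewrite -EFinD natr1.
Qed.

(** By induction the last n coordinates contribute n! times a simplex; the first coordinate can then
    be inserted in n + 1 positions. *)
Lemma integral_Rn_simplex n (g : n.-tuple R -> \bar R) :
  measurable_fun setT g -> (forall x, (0 <= g x)%E) -> perm_invariant g ->
  (integral_Rn g = n`!%:R%:E * simplex_integral 0 g)%E.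
Proof.
elim: n g => [|n ih] g mg g0 gS; first by rewrite fact0 mul1e /simplex_integral.
rewrite /= -integral_itv_obnd_cbnd; last first.
  by apply: measurable_funTS; exact: measurable_integral_Rn_slice.
under eq_integral => s _.
  rewrite ih//; [over|exact: measurable_slice|exact: perm_invariant_slice].
have mid : measurable_fun [set: mR] (fun x : mR => x : R) by exact: measurable_id.
rewrite ge0_integralZl_EFin//; last 2 first.
- by move=> s _; exact: simplex_integral_ge0.
- apply: measurable_funTS.
  apply: (@measurable_simplex_integral n _ mR (cst 0) (fun z => g [tuple of z.1 :: z.2])) => //.
  by apply: (measurableT_comp mg); apply: measurable_cons => //;
    exact: (measurableT_comp mid measurable_fst).
by rewrite simplex_insertion// muleA -EFinM factS -natrM mulnC.
Qed.

Lemma sqnorm_on_simplex n (f : n.-tuple R -> R) : symmetric_L2 f ->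
  (sqnorm f = n`!%:R%:E * sqnorm (on_simplex f))%E.
Proof.
move=> [mf _ fS]; rewrite /sqnorm integral_Rn_simplex.
- congr (_ * _)%E; apply: eq_integral_Rn => x; rewrite /on_simplex.
  by case: ifP => //; rewrite expr0n.
- exact/measurable_EFinP/measurable_funX.
- by move=> x; rewrite lee_fin sqr_ge0.
- move=> x y /tuple_permP[p xy]; congr ((_ ^+ 2)%:E); rewrite -(fS p y).
  by congr f; apply: val_inj.
Qed.

End simplex.

(** * Norms of step functions and of their limits *)

Section step_norm.
Context {R : realType}.
Notation mu := (@lebesgue_measure R).
Notation pos := (`[0%R, +oo[%classic : set R).

Definition box_indic n (b : n.-tuple (R * R)) (x : n.-tuple R) : R :=
  \prod_(i < n) \1_(`](tnth b i).1, (tnth b i).2]) (tnth x i).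

Lemma measurable_box_indic n (b : n.-tuple (R * R)) :
  measurable_fun [set: n.-tuple R] (box_indic b).
Proof.
apply: measurable_prod => i _.
have mI : measurable_fun [set: R] (\1_`](tnth b i).1, (tnth b i).2] : R -> R).
  by apply: measurable_indic; exact: measurable_itv.
exact: (measurableT_comp mI (measurable_tnth i)).
Qed.

Lemma box_indic_ge0 n (b : n.-tuple (R * R)) x : 0 <= box_indic b x.
Proof. by apply: prodr_ge0 => i _; rewrite indicE. Qed.

Lemma measurable_step_fun n (e : @step R n) :
  measurable_fun [set: n.-tuple R] (step_fun e).
Proof.
apply: measurable_sum => b; apply: measurable_funM => //.
exact: measurable_box_indic.
Qed.

Lemma measurable_on_simplex n (f : n.-tuple R -> R) :
  measurable_fun setT f -> measurable_fun setT (on_simplex f).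
Proof.
move=> mf; apply: measurable_fun_ifT => //.
by apply: measurable_path => //; exact: measurable_id.
Qed.

Lemma integral_indic_overlap (p q : R * R) : 0 <= p.1 -> 
  (\int[mu]_(s in pos) (\1_`]p.1, p.2] s * \1_`]q.1, q.2] s)%:E =
   (overlap p.1 p.2 q.1 q.2)%:E)%E.
Proof.
move=> p0.
transitivity (\int[mu]_(s in pos) (\1_(`]p.1, p.2] `&` `]q.1, q.2]) s)%:E)%E.
  by apply: eq_integral => s _; rewrite !indicE in_setI; case: (_ \in _); rewrite ?mul1r ?mul0r.
have mI : measurable (`]p.1, p.2] `&` `]q.1, q.2] : set R).
  by apply: measurableI; exact: measurable_itv.
rewrite integral_indic//.
have -> : (`]p.1, p.2] `&` `]q.1, q.2]) `&` pos =
    `]Num.max p.1 q.1, Num.min p.2 q.2]%classic :> set R.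
  apply/seteqP; split => s /=; rewrite !in_itv/= andbT gt_max le_min.
    by move=> [[/andP[-> ->] /andP[-> ->]]].
  move=> /andP[/andP[ps qs] /andP[sp sq]]; rewrite ps qs sp sq; split => //.
  by rewrite (le_trans p0)// ltW.
rewrite [LHS](lebesgue_measure_itv `]Num.max p.1 q.1, Num.min p.2 q.2])/= lte_fin /overlap.
case: ltP => [lt|le]; first by rewrite [Num.max 0 _]max_r// subr_ge0 ltW.
by rewrite [Num.max 0 _]max_l// subr_le0.
Qed.

Lemma box_indic_cons n p (b : n.-tuple (R * R)) s (y : n.-tuple R) :
  box_indic [tuple of p :: b] [tuple of s :: y] = \1_`]p.1, p.2] s * box_indic b y.
Proof.
rewrite /box_indic big_ord_recl !tnth0; congr (_ * _).
by apply: eq_bigr => i _; rewrite !tnthS.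
Qed.

Lemma integral_Rn_box n (b b' : n.-tuple (R * R)) :
  all (fun p => 0 <= p.1) b ->
  integral_Rn (fun x => (box_indic b x * box_indic b' x)%:E) =
  (box_overlap b b')%:E.
Proof.
elim: n b b' => [|n ih] b b'.
  by rewrite (tuple0 b) (tuple0 b') /= /box_indic /box_overlap !big_ord0/= big_nil mulr1.
case/tupleP: b => p b; case/tupleP: b' => q b' /= /andP[p0 b0].
under eq_integral => s _.
  rewrite (@eq_integral_Rn _ _ _ (fun y => (\1_`]p.1, p.2] s * \1_`]q.1, q.2] s)%:E *
    (box_indic b y * box_indic b' y)%:E)%E); last first.
    by move=> y; rewrite !box_indic_cons -EFinM mulrACA.
  rewrite integral_RnZl; first last.
  - by move=> y; rewrite lee_fin mulr_ge0 ?box_indic_ge0.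
  - by apply/measurable_EFinP/measurable_funM; exact: measurable_box_indic.
  - by rewrite !indicE mulr_ge0.
  rewrite ih// muleC.
  over.
have ov0 : 0 <= box_overlap b b'.
  by apply: prodr_ge0 => i _; rewrite /overlap le_max lexx.
rewrite ge0_integralZl_EFin//; last first.
  apply/measurable_EFinP/measurable_funM; apply: measurable_indic; exact: measurable_itv.
rewrite [X in (_ * X)%E](integral_indic_overlap q p0).
by rewrite /box_overlap /= big_cons -EFinM mulrC.
Qed.

(** Additivity of [integral_Rn] is available for nonnegative functions, so the negative parts of the
    coefficients are added to both sides; their total is finite and is cancelled at the end. *)
Lemma integral_Rn_signed_sum n (I : eqType) (r : seq I) (c v : I -> R)
    (g : I -> n.-tuple R -> R) :
  (forall i, measurable_fun setT (g i)) -> (forall i x, 0 <= g i x) ->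
  (forall i, i \in r -> integral_Rn (EFin \o g i) = (v i)%:E) ->
  (forall x, 0 <= \sum_(i <- r) c i * g i x) ->
  integral_Rn (fun x => (\sum_(i <- r) c i * g i x)%:E) =
  (\sum_(i <- r) c i * v i)%:E.
Proof.
move=> mg g0 gv s0.
pose p (x : R) : R := (`|x| + x) / 2; pose m (x : R) : R := (`|x| - x) / 2.
have pE x : x = p x - m x by rewrite /p /m; field.
have p0 x : 0 <= p x.
  by rewrite /p; have := ler_norm (- x); rewrite normrN; lra.
have m0 x : 0 <= m x by rewrite /m; have := ler_norm x; lra.
have val (a : I -> R) : (forall i, 0 <= a i) ->
    integral_Rn (fun x => (\sum_(i <- r) (a i)%:E * (g i x)%:E))%E =
    (\sum_(i <- r) a i * v i)%:E.
  move=> a0; rewrite integral_Rn_sum.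
  - rewrite -sumEFin; apply: eq_big_seq => i ir.
    rewrite integral_RnZl//; first by rewrite gv.
    + exact/measurable_EFinP.
    + by move=> x; rewrite lee_fin.
  - by move=> i; apply: measurable_funeM; exact/measurable_EFinP.
  - by move=> i x; rewrite -EFinM lee_fin mulr_ge0.
have mS (a : I -> R) : measurable_fun setT (fun x => \sum_(i <- r) (a i)%:E * (g i x)%:E)%E.
  by apply: emeasurable_sum => i; apply: measurable_funeM; exact/measurable_EFinP.
have h := val (fun i => p (c i)) (fun i => p0 _).
rewrite (@eq_integral_Rn _ _ _ (fun x => (\sum_(i <- r) c i * g i x)%:E +
   (\sum_(i <- r) (m (c i))%:E * (g i x)%:E))%E) in h; last first.
  move=> x; rewrite -sumEFin -big_split/=; apply: eq_bigr => i _.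
  by rewrite -!EFinM -EFinD; congr EFin; rewrite {2}(pE (c i)); ring.
rewrite integral_RnD ?(val (fun i => m (c i)))// in h; last 2 first.
- apply/measurable_EFinP; apply: measurable_sum => i; exact: measurable_funM.
- by move=> x; apply: sume_ge0 => i _; rewrite -EFinM lee_fin mulr_ge0.
set M := (X in (_ + X)%E = _) in h.
rewrite -[LHS](@addeK _ M)// h /M -EFinB -sumrB; congr EFin.
by apply: eq_bigr => i _; rewrite -mulrBl -pE.
Qed.

(** Here [step_gram] meets the Lebesgue integral. The diagonal case suffices, the difference of two
    step functions being a step function. *)
Lemma sqnorm_step_fun n (e : @step R n) : ordered_step e ->
  sqnorm (step_fun e) = (step_gram e e)%:E.
Proof.
move=> oe; rewrite /sqnorm.
have start0 (b : seq (R * R)) x : 0 <= x -> path <=%R x (endpoints b) -> all (fun p => 0 <= p.1) b.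
  elim: b x => //= p b ih x x0 /and3P[xp pp pb].
  by rewrite (le_trans x0 xp) (ih p.2)// (le_trans x0)// (le_trans xp).
pose r := [seq (b, b') | b <- e, b' <- e].
have E x : step_fun e x ^+ 2 = \sum_(z <- r) z.1.1 * z.2.1 * (box_indic z.1.2 x * box_indic z.2.2 x).
  rewrite big_allpairs_dep/= expr2 /step_fun mulr_suml; apply: eq_bigr => b _.
  by rewrite mulr_sumr; apply: eq_bigr => b' _; rewrite /box_indic; ring.
under eq_integral_Rn do rewrite E.
rewrite (@integral_Rn_signed_sum _ _ r (fun z => z.1.1 * z.2.1) (fun z => box_overlap z.1.2 z.2.2)).
- by rewrite big_allpairs_dep.
- by move=> z; apply: measurable_funM; exact: measurable_box_indic.
- by move=> z x; rewrite mulr_ge0 ?box_indic_ge0.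
- move=> z /allpairsP[[b b'] /= [be be' ->]]; apply: integral_Rn_box.
  by apply: start0 (lexx 0) _; exact: (allP oe).
- by move=> x; rewrite -E sqr_ge0.
Qed.

(** With d = f - g, the right side minus f^2 is (eps g - d)^2 / eps pointwise. This replaces the
    triangle inequality for [sqnorm], with a loss that vanishes as eps tends to 0. *)
Lemma sqnorm_quasi_triangle n (f g : n.-tuple R -> R) (eps : R) : 0 < eps ->
  measurable_fun setT f -> measurable_fun setT g ->
  (sqnorm f <= (1 + eps)%:E * sqnorm g + (1 + eps^-1)%:E * sqnorm (f \- g)%R)%E.
Proof.
move=> e0 mf mg; have ei0 : 0 < eps^-1 by rewrite invr_gt0.
have Z c (h : n.-tuple R -> R) : 0 <= c -> measurable_fun setT h ->
    (c%:E * sqnorm h = integral_Rn (fun x => c%:E * (h x ^+ 2)%:E))%E.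
  move=> c0 mh; rewrite integral_RnZl//; first exact/measurable_EFinP/measurable_funX.
  by move=> x; rewrite lee_fin sqr_ge0.
rewrite !Z; last 4 first.
- by rewrite addr_ge0// ltW.
- exact: measurable_funB.
- by rewrite addr_ge0// ltW.
- by [].
rewrite /sqnorm.
have s1 x : (0 <= (1 + eps)%:E * (g x ^+ 2)%:E)%E.
  by rewrite -EFinM lee_fin mulr_ge0 ?sqr_ge0// addr_ge0// ltW.
have s2 x : (0 <= (1 + eps^-1)%:E * ((f x - g x) ^+ 2)%:E)%E.
  by rewrite -EFinM lee_fin mulr_ge0 ?sqr_ge0// addr_ge0// ltW.
have m1 : measurable_fun setT (fun x => (1 + eps)%:E * (g x ^+ 2)%:E)%E.
  by apply: measurable_funeM; exact/measurable_EFinP/measurable_funX.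
have m2 : measurable_fun setT (fun x => (1 + eps^-1)%:E * ((f x - g x) ^+ 2)%:E)%E.
  by apply: measurable_funeM; exact/measurable_EFinP/measurable_funX/measurable_funB.
rewrite -integral_RnD//; apply: le_integral_Rn.
- exact/measurable_EFinP/measurable_funX.
- exact: emeasurable_funD.
- by move=> x; rewrite lee_fin sqr_ge0.
move=> x; rewrite -!EFinM -EFinD lee_fin /=.
set a := g x; set d := f x - g x; have -> : f x = a + d by rewrite /a /d; ring.
have -> : (1 + eps) * a ^+ 2 + (1 + eps^-1) * d ^+ 2 =
   (a + d) ^+ 2 + eps^-1 * (eps * a - d) ^+ 2 by field; rewrite gt_eqF.
by rewrite lerDl mulr_ge0 ?sqr_ge0// ltW.
Qed.

(** Letting k tend to infinity in [sqnorm_quasi_triangle] compares |h|^2 and L in both directions up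
    to a factor 1 + eps, and eps is arbitrary. Finiteness of |h|^2 comes from a single k at finite
    distance. *)
Lemma sqnorm_limit n (e : nat -> @step R n) (h : n.-tuple R -> R) (L : R) :
  measurable_fun setT h -> (forall k, ordered_step (e k)) ->
  sqnorm (step_fun (e k) \- h) @[k --> \oo] --> 0%E ->
  step_gram (e k) (e k) @[k --> \oo] --> L -> sqnorm h = L%:E.
Proof.
move=> mh oe eh eL; have me k := measurable_step_fun (e k).
have r0 k : (0 <= sqnorm (step_fun (e k) \- h)%R)%E.
  by apply: integral_Rn_ge0 => x; rewrite lee_fin sqr_ge0.
have q0 : (0 <= sqnorm h)%E.
  by apply: integral_Rn_ge0 => x; rewrite lee_fin sqr_ge0.
have rsym k : sqnorm (h \- step_fun (e k)) = sqnorm (step_fun (e k) \- h).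
  by apply: eq_integral_Rn => x /=; congr EFin; ring.
have /fine_cvgP[rfin rlim] := eh.
have qfin : sqnorm h \is a fin_num.
  have [k _ hk] := rfin; have rk := hk k (leqnn k).
  have := sqnorm_quasi_triangle (@ltr01 R) mh (me k).
  rewrite rsym sqnorm_step_fun// ge0_fin_numE//; move/le_lt_trans; apply.
  by rewrite -(fineK rk) -!EFinM -EFinD ltry.
set q := fine (sqnorm h).
have qE : sqnorm h = q%:E by rewrite fineK.
have step1 eps : 0 < eps -> q <= (1 + eps) * L.
  move=> e0; have lim : (1 + eps) * step_gram (e k) (e k) + (1 + eps^-1) *
     fine (sqnorm (step_fun (e k) \- h)) @[k --> \oo] --> (1 + eps) * L + (1 + eps^-1) * 0.
    by apply: cvgD; apply: cvgM => //; exact: cvg_cst.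
  rewrite mulr0 addr0 in lim.
  apply: (ler_cvg_to (cvg_cst q) lim); near=> k.
  have rk : sqnorm (step_fun (e k) \- h) \is a fin_num by near: k.
  have := sqnorm_quasi_triangle e0 mh (me k).
  by rewrite rsym sqnorm_step_fun// qE -(fineK rk) -!EFinM -EFinD lee_fin.
have step2 eps : 0 < eps -> L <= (1 + eps) * q.
  move=> e0; have lim : (1 + eps) * q + (1 + eps^-1) *
     fine (sqnorm (step_fun (e k) \- h)) @[k --> \oo] --> (1 + eps) * q + (1 + eps^-1) * 0.
    by apply: cvgD; [exact: cvg_cst|apply: cvgM => //; exact: cvg_cst].
  rewrite mulr0 addr0 in lim.
  apply: (ler_cvg_to eL lim); near=> k.
  have rk : sqnorm (step_fun (e k) \- h) \is a fin_num by near: k.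
  have := sqnorm_quasi_triangle e0 (me k) mh.
  by rewrite sqnorm_step_fun// qE -(fineK rk) -!EFinM -EFinD lee_fin.
have q0' : 0 <= q by rewrite fine_ge0.
have L0 : 0 <= L by have := step2 1 ltr01; have := step1 1 ltr01; lra.
have gen (x y : R) : 0 <= y -> (forall eps, 0 < eps -> x <= (1 + eps) * y) -> x <= y.
  move=> y0 H; apply/ler_addgt0Pr => d d0.
  have y1 : 0 < y + 1 by lra.
  apply: (le_trans (H (d / (y + 1)) (divr_gt0 d0 y1))).
  rewrite mulrDl mul1r lerD2l mulrAC ler_pdivrMr// ler_wpM2l ?ltW//; lra.
rewrite qE; congr EFin; apply/eqP; rewrite eq_le; apply/andP; split; exact: gen.
Unshelve. all: by end_near. Qed.

End step_norm.

(** * Multiple integrals and chaos expansions *)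

Section step_algebra.
Context {R : realType}.

Definition step_sub n (e e' : @step R n) : step n :=
  e ++ [seq (- b.1, b.2) | b <- e'].

Lemma step_fun_sub n (e e' : @step R n) :
  step_fun (step_sub e e') = step_fun e \- step_fun e'.
Proof.
apply/funext => x; rewrite /step_fun big_cat big_map/=; congr (_ + _).
by rewrite -sumrN; apply: eq_bigr => b _; rewrite mulNr.
Qed.

Lemma step_integral_sub d (T : measurableType d) (Y : R -> T -> R) n (e e' : @step R n) :
  step_integral Y (step_sub e e') = step_integral Y e \- step_integral Y e'.
Proof.
apply/funext => w; rewrite /step_integral big_cat big_map/=; congr (_ + _).
by rewrite -sumrN; apply: eq_bigr => b _; rewrite mulNr.
Qed.

Lemma ordered_step_sub n (e e' : @step R n) :
  ordered_step e -> ordered_step e' -> ordered_step (step_sub e e').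
Proof.
by move=> he he'; rewrite /ordered_step all_cat all_map; apply/andP; split.
Qed.

End step_algebra.

Section multiple_integrals.
Context {R : realType} {d : measure_display} {T : measurableType d}.
Variables (P : probability T R) (H : R -> set (set T)).

Lemma normal_joint_increments Y : normal_increments P H Y ->
  joint_increments P H 1 Y Y.
Proof.
move=> hY; split => // s t s0 st A HA; have [_ h] := hY.
have [_ _ _ q] := h s t s0 st; rewrite mul1r -q//.
Qed.

Lemma ip_triangle (X Y Z : T -> R) : X \in Lfun P 2%:E -> Y \in Lfun P 2%:E ->
  Z \in Lfun P 2%:E ->
  ip P (X \- Z) (X \- Z) <= 2 * ip P (X \- Y) (X \- Y) + 2 * ip P (Y \- Z) (Y \- Z).
Proof.
move=> hX hY hZ; have h1 := L2B hX hY; have h2 := L2B hY hZ.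
have -> : ip P (X \- Z) (X \- Z) =
    ip P ((X \- Y) \+ (Y \- Z)) ((X \- Y) \+ (Y \- Z)).
  by apply: eq_ip => w /=; ring.
rewrite ip_sqrD//.
have := ip_ge0 P ((X \- Y) \- (Y \- Z)); rewrite ip_sqr//; lra.
Qed.

Lemma ip_sqr_eq0 (X Y : T -> R) : X \in Lfun P 2%:E -> Y \in Lfun P 2%:E ->
  ip P X X = 0 -> ip P X Y = 0.
Proof.
move=> hX hY X0; have := ip_cauchy_schwarz hX hY; rewrite X0 mul0r => h.
by apply/eqP; rewrite -sqrf_eq0 eq_le h sqr_ge0.
Qed.

(** The definition provides one approximating sequence. Any other one for the same kernel is close
    to it in L^2 of the simplex, so by the isometry their integrals are close in L^2(P). Different
    integrators can thus be given the same steps. *)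
Lemma multiple_integral_step Y n (f : n.-tuple R -> R) J e :
  normal_increments P H Y -> measurable_fun setT f -> multiple_integral P Y f J ->
  (forall k, ordered_step (e k)) ->
  sqnorm (step_fun (e k) \- on_simplex f) @[k --> \oo] --> 0%E ->
  let X k w := n`!%:R * step_integral Y (e k) w in
  ip P (X k \- J) (X k \- J) @[k --> \oo] --> (0 : R).
Proof.
move=> hY mf [J2 [e0 [oe0 ce0 cJ]]] oe ce X.
have mh := measurable_on_simplex mf.
have hj := normal_joint_increments hY.
have X2 k : X k \in Lfun P 2%:E by apply: L2Z; exact: step_integral_L2 hY (oe k).
pose X0 k w := n`!%:R * step_integral Y (e0 k) w.
have X02 k : X0 k \in Lfun P 2%:E by apply: L2Z; exact: step_integral_L2 hY (oe0 k).
have {}cJ : ip P (X0 k \- J) (X0 k \- J) @[k --> \oo] --> (0 : R).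
  exact: (proj1 (L2_cvgP X02 J2)).
have r0 (g : n.-tuple R -> R) : (0 <= sqnorm g)%E.
  by apply: integral_Rn_ge0 => x; rewrite lee_fin sqr_ge0.
have /fine_cvgP[f1 l1] := ce; have /fine_cvgP[f0 l0] := ce0.
have D k : ip P (X k \- X0 k) (X k \- X0 k) =
    n`!%:R ^+ 2 * step_gram (step_sub (e k) (e0 k)) (step_sub (e k) (e0 k)).
  have os := ordered_step_sub (oe k) (oe0 k).
  have := ip_step_gram hj os os; rewrite expr1n mul1r => <-.
  have S2 := step_integral_L2 hY os.
  have -> : X k \- X0 k = fun w => n`!%:R * step_integral Y (step_sub (e k) (e0 k)) w.
    by apply/funext => w; rewrite step_integral_sub /X /X0 /= mulrBr.
  have Z2 := L2Z n`!%:R S2.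
  by rewrite ipZl// ipZr// mulrA expr2.
apply: (@cvg0_norm_le _ _ _ _ _ (fun k => 2 * (n`!%:R ^+ 2 *
    (2 * fine (sqnorm (step_fun (e k) \- on_simplex f)) +
     2 * fine (sqnorm (step_fun (e0 k) \- on_simplex f)))) +
    2 * ip P (X0 k \- J) (X0 k \- J))); last first.
  rewrite -[X in _ --> X](_ : 2 * (n`!%:R ^+ 2 * (2 * 0 + 2 * 0)) + 2 * 0 = 0); last by ring.
  apply: cvgD; last by apply: cvgM => //; exact: cvg_cst.
  apply: cvgM; first exact: cvg_cst.
  apply: cvgM; first exact: cvg_cst.
  by apply: cvgD; apply: cvgM => //; exact: cvg_cst.
near=> k; rewrite ger0_norm ?ip_ge0//.
apply: (le_trans (ip_triangle (X2 k) (X02 k) J2)).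
rewrite lerD2r ler_pM2l// D ler_wpM2l ?sqr_ge0//.
have fk : sqnorm (step_fun (e k) \- on_simplex f) \is a fin_num by near: k.
have fk0 : sqnorm (step_fun (e0 k) \- on_simplex f) \is a fin_num by near: k.
rewrite -lee_fin -sqnorm_step_fun; last exact: ordered_step_sub.
have := sqnorm_quasi_triangle (@ltr01 R)
  (measurable_step_fun (step_sub (e k) (e0 k)))
  (measurable_funB (measurable_step_fun (e k)) mh).
rewrite (_ : sqnorm (_ \- (_ \- _)) = sqnorm (step_fun (e0 k) \- on_simplex f)).
  by rewrite invr1 -(fineK fk) -(fineK fk0).
by apply: eq_integral_Rn => x; rewrite step_fun_sub /=; congr EFin; ring.
Unshelve. all: by end_near. Qed.

End multiple_integrals.

(** The second moment of the term of order n of the expansion. *)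
Definition chaos_weight {R : realType} (f : forall n, n.-tuple R -> R) (n : nat) : R :=
  n`!%:R * fine (sqnorm (f n)).

Section isometry.
Context {R : realType} {d : measure_display} {T : measurableType d}.
Variables (P : probability T R) (H : R -> set (set T)).

Lemma cvgn_ip (X Y : nat -> T -> R) (X0 Y0 : T -> R) :
  (forall i, X i \in Lfun P 2%:E) -> (forall i, Y i \in Lfun P 2%:E) ->
  X0 \in Lfun P 2%:E -> Y0 \in Lfun P 2%:E ->
  ip P (X i \- X0) (X i \- X0) @[i --> \oo] --> (0 : R) ->
  ip P (Y i \- Y0) (Y i \- Y0) @[i --> \oo] --> (0 : R) ->
  ip P (X i) (Y i) @[i --> \oo] --> ip P X0 Y0.
Proof. exact: cvg_ip. Qed.

Lemma multiple_integral_gram k Y Y' n (f f' : n.-tuple R -> R) J J'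
    (e e' : nat -> step n) :
  joint_increments P H k Y Y' ->
  measurable_fun setT f -> measurable_fun setT f' ->
  multiple_integral P Y f J -> multiple_integral P Y' f' J' ->
  (forall i, ordered_step (e i)) -> (forall i, ordered_step (e' i)) ->
  sqnorm (step_fun (e i) \- on_simplex f) @[i --> \oo] --> 0%E ->
  sqnorm (step_fun (e' i) \- on_simplex f') @[i --> \oo] --> 0%E ->
  k ^+ n * (n`!%:R ^+ 2 * step_gram (e i) (e' i)) @[i --> \oo] --> ip P J J'.
Proof.
move=> hj mf mf' hJ hJ' oe oe' ce ce'; have [hY hY' _] := hj.
have S2 i := step_integral_L2 hY (oe i); have S2' i := step_integral_L2 hY' (oe' i).
have X2 i := L2Z n`!%:R (S2 i); have X2' i := L2Z n`!%:R (S2' i).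
have := cvgn_ip X2 X2' (proj1 hJ) (proj1 hJ')
  (multiple_integral_step hY mf hJ oe ce) (multiple_integral_step hY' mf' hJ' oe' ce').
apply: cvg_trans; apply: near_eq_cvg; apply: nearW => i.
rewrite ipZl// ipZr// (ip_step_gram hj)//; ring.
Qed.

Lemma multiple_integral_orthogonal k Y Y' n m (f : n.-tuple R -> R)
    (f' : m.-tuple R -> R) J J' :
  n != m -> joint_increments P H k Y Y' ->
  measurable_fun setT f -> measurable_fun setT f' ->
  multiple_integral P Y f J -> multiple_integral P Y' f' J' -> ip P J J' = 0.
Proof.
move=> nm hj mf mf' hJ hJ'; have [hY hY' _] := hj.
have [J2 [e [oe ce _]]] := hJ; have [J2' [e' [oe' ce' _]]] := hJ'.
have S2 i := step_integral_L2 hY (oe i); have S2' i := step_integral_L2 hY' (oe' i).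
have X2 i := L2Z n`!%:R (S2 i); have X2' i := L2Z m`!%:R (S2' i).
have h := cvgn_ip X2 X2' J2 J2'
  (multiple_integral_step hY mf hJ oe ce) (multiple_integral_step hY' mf' hJ' oe' ce').
apply: (norm_cvg_unique h).
rewrite (_ : (fun i => _) = cst 0); first exact: cvg_cst.
apply/funext => i; rewrite ipZl// ipZr// (ip_step_orthogonal nm hj)//=; ring.
Qed.

(** The second moment is n!^2 times the squared norm on the simplex, and the simplex carries the
    fraction 1 / n! of |f|^2 by symmetry. *)
Lemma multiple_integral_sqnorm Y n (f : n.-tuple R -> R) J :
  normal_increments P H Y -> symmetric_L2 f -> multiple_integral P Y f J ->
  ip P J J = n`!%:R * fine (sqnorm f).
Proof.
move=> hY sf hJ; have [mf _ _] := sf; have [J2 [e [oe ce _]]] := hJ.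
have n0 : (n`!%:R : R) != 0 by rewrite pnatr_eq0 -lt0n fact_gt0.
have := multiple_integral_gram (normal_joint_increments hY) mf mf hJ hJ oe oe ce ce.
under eq_fun do rewrite expr1n mul1r.
move=> h; have L : step_gram (e i) (e i) @[i --> \oo] --> (n`!%:R ^+ 2)^-1 * ip P J J.
  have : (n`!%:R ^+ 2)^-1 * (n`!%:R ^+ 2 * step_gram (e i) (e i)) @[i --> \oo]
      --> (n`!%:R ^+ 2)^-1 * ip P J J by apply: cvgM h; exact: cvg_cst.
  by under eq_fun do rewrite mulrA mulVf ?expf_neq0// mul1r.
 rewrite (sqnorm_on_simplex sf) (sqnorm_limit (measurable_on_simplex mf) oe ce L) /=.
by field.
Qed.

End isometry.

Section transfer.
Context {R : realType} {d d1 : measure_display} {T : measurableType d} {T1 : measurableType d1}.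
Variables (P : probability T R) (H : R -> set (set T)).
Variables (P1 : probability T1 R) (H1 : R -> set (set T1)) (B : R -> T1 -> R).
Hypothesis hB : normal_increments P1 H1 B.

(** The step sequences given with [J] and [J'] are reused for [I] and [I']. Both inner products are
    then limits of the same [step_gram], up to the factor k^n. *)
Lemma multiple_integral_transfer k Y Y' n (f f' : n.-tuple R -> R) J J' I I' :
  joint_increments P H k Y Y' ->
  measurable_fun setT f -> measurable_fun setT f' ->
  multiple_integral P Y f J -> multiple_integral P Y' f' J' ->
  multiple_integral P1 B f I -> multiple_integral P1 B f' I' ->
  ip P J J' = k ^+ n * ip P1 I I'.
Proof.
move=> hj mf mf' hJ hJ' hI hI'.
have [J2 [e [oe ce _]]] := hJ; have [J2' [e' [oe' ce' _]]] := hJ'.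
have h := multiple_integral_gram hj mf mf' hJ hJ' oe oe' ce ce'.
apply: (norm_cvg_unique h).
have := multiple_integral_gram (normal_joint_increments hB) mf mf' hI hI' oe oe' ce ce'.
under eq_fun do rewrite expr1n mul1r.
by move=> h1; apply: cvgM h1; exact: cvg_cst.
Qed.

End transfer.

(** * Uniqueness of the terms of a chaos expansion *)

Section chaos_uniqueness.
Context {R : realType} {d : measure_display} {T : measurableType d}.
Variables (P : probability T R) (H : R -> set (set T)) (Y : R -> T -> R).
Hypothesis hY : normal_increments P H Y.

Lemma ip_orthogonal_sum (X X' : nat -> T -> R) N :
  (forall n, X n \in Lfun P 2%:E) -> (forall n, X' n \in Lfun P 2%:E) ->
  (forall n m, n != m -> ip P (X n) (X' m) = 0) ->
  ip P (fun w => \sum_(n < N) X n w) (fun w => \sum_(n < N) X' n w) =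
  \sum_(n < N) ip P (X n) (X' n).
Proof.
move=> X2 X2' o.
rewrite ip_suml//; last by apply: L2_sum.
apply: eq_bigr => i _; rewrite ip_sumr// (bigD1 i)//= big1 ?addr0// => j ji.
by apply: o; rewrite eq_sym.
Qed.

(* Only the terms J n, and hence n! |f_n|^2, are shown to be unique: this is all
   that the covariance function depends on. *)
Lemma chaos_terms_unique (f f' : forall n, n.-tuple R -> R) F (J J' : nat -> T -> R) :
  (forall n, measurable_fun setT (f n)) -> (forall n, measurable_fun setT (f' n)) ->
  F \in Lfun P 2%:E ->
  (forall n, multiple_integral P Y (f n) (J n)) ->
  (forall n, multiple_integral P Y (f' n) (J' n)) ->
  L2_cvg P (fun N w => \sum_(n < N) J n w) F ->
  L2_cvg P (fun N w => \sum_(n < N) J' n w) F ->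
  forall n, ip P (J n \- J' n) (J n \- J' n) = 0.
Proof.
move=> mf mf' F2 hJ hJ' cJ cJ' m.
have hj := normal_joint_increments hY.
have J2 n := proj1 (hJ n); have J2' n := proj1 (hJ' n).
have D2 n := L2B (J2 n) (J2' n).
pose S (X : nat -> T -> R) N w := \sum_(n < N) X n w.
have S2 X : (forall n, X n \in Lfun P 2%:E) -> forall N, S X N \in Lfun P 2%:E.
  by move=> X2 N; apply: L2_sum.
have o n l : n != l -> ip P (J n \- J' n) (J l \- J' l) = 0.
  move=> nl; rewrite ipBl// !ipBr//.
  rewrite (multiple_integral_orthogonal nl hj (mf n) (mf l) (hJ n) (hJ l)).
  rewrite (multiple_integral_orthogonal nl hj (mf n) (mf' l) (hJ n) (hJ' l)).
  rewrite (multiple_integral_orthogonal nl hj (mf' n) (mf l) (hJ' n) (hJ l)).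
  rewrite (multiple_integral_orthogonal nl hj (mf' n) (mf' l) (hJ' n) (hJ' l)).
  by rewrite !subr0.
have c1 := proj1 (L2_cvgP (S2 J J2) F2) cJ.
have c2 := proj1 (L2_cvgP (S2 J' J2') F2) cJ'.
(* By orthogonality this sum is the squared distance between the two partial sums, both of which
   tend to [F]; each of its terms is therefore 0. *)
have c : \sum_(n < N) ip P (J n \- J' n) (J n \- J' n) @[N --> \oo] --> (0 : R).
  apply: (@cvg0_norm_le _ _ _ _ _ (fun N => 2 * ip P (S J N \- F) (S J N \- F) +
      2 * ip P (S J' N \- F) (S J' N \- F))).
    apply: nearW => N; rewrite ger0_norm; last by apply: sumr_ge0 => i _; exact: ip_ge0.
    rewrite -(ip_orthogonal_sum (X := fun n => J n \- J' n) (X' := fun n => J n \- J' n) N)//.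
    have := ip_triangle (S2 _ J2 N) F2 (S2 _ J2' N).
    rewrite [X in _ <= _ + 2 * X](_ : _ = ip P (S J' N \- F) (S J' N \- F)); last first.
      have h := S2 _ J2' N.
      by rewrite !ip_sqr// (ipC P F); ring.
    by apply: le_trans; rewrite le_eqVlt; apply/orP; left; apply/eqP; apply: eq_ip => w;
      rewrite /S/= -sumrB.
  rewrite -[X in _ --> X](_ : 2 * 0 + 2 * 0 = 0); last by ring.
  by apply: cvgD; apply: cvgM => //; exact: cvg_cst.
apply/eqP; rewrite eq_le ip_ge0 andbT.
have /cvg_lim <- := c; last exact: norm_hausdorff.
apply: limr_ge; first by apply/cvg_ex; exists 0.
exists m.+1 => // N /= mN.
rewrite (bigD1 (Ordinal mN))//= lerDl sumr_ge0// => i _; exact: ip_ge0.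
Qed.

Lemma chaos_weight_unique f f' F :
  chaos_expansion P Y f F -> chaos_expansion P Y f' F ->
  chaos_weight f =1 chaos_weight f'.
Proof.
move=> [sf F2 [J [hJ cJ]]] [sf' _ [J' [hJ' cJ']]] n.
have mf m : measurable_fun setT (f m) by have [] := sf m.
have mf' m : measurable_fun setT (f' m) by have [] := sf' m.
have h := chaos_terms_unique mf mf' F2 hJ hJ' cJ cJ' n.
rewrite /chaos_weight -(multiple_integral_sqnorm hY (sf n) (hJ n)).
rewrite -(multiple_integral_sqnorm hY (sf' n) (hJ' n)).
have J2 := proj1 (hJ n); have J2' := proj1 (hJ' n); have D2 := L2B J2 J2'.
have := ip_sqr_eq0 D2 J2 h; have := ip_sqr_eq0 D2 J2' h.
by rewrite !ipBl// (ipC P (J' n) (J n)) => /subr0_eq-> /subr0_eq->.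
Qed.

Lemma chaos_weight_ge0 (f : forall n, n.-tuple R -> R) n : 0 <= chaos_weight f n.
Proof.
rewrite /chaos_weight mulr_ge0// fine_ge0// integral_Rn_ge0// => x.
by rewrite lee_fin sqr_ge0.
Qed.

End chaos_uniqueness.

Section chaos_covariance.
Context {R : realType} {d d1 : measure_display} {T : measurableType d} {T1 : measurableType d1}.
Variables (P : probability T R) (H : R -> set (set T)).
Variables (P1 : probability T1 R) (H1 : R -> set (set T1)) (B : R -> T1 -> R).
Hypothesis hB : normal_increments P1 H1 B.

(** The kernels behind [X] and [X'] may differ from each other and from the reference kernels [f0].
    Order by order the inner product is k^n times the one on the space of [B]; there the two terms
    coincide almost surely and have the weight of [f0]. *)
Lemma chaos_covariance k Y Y' f0 f f' F X X' :
  joint_increments P H k Y Y' -> chaos_expansion P1 B f0 F ->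
  chaos_expansion P1 B f F -> chaos_expansion P Y f X ->
  chaos_expansion P1 B f' F -> chaos_expansion P Y' f' X' ->
  \sum_(n < N) k ^+ n * chaos_weight f0 n @[N --> \oo] --> ip P X X'.
Proof.
move=> hj e0 e1 [_ X2 [J [hJ cJ]]] e1' [_ X2' [J' [hJ' cJ']]].
have [hY hY' _] := hj.
have [sf F2 [I [hI cI]]] := e1; have [sf' _ [I' [hI' cI']]] := e1'.
have mf m : measurable_fun setT (f m) by have [] := sf m.
have mf' m : measurable_fun setT (f' m) by have [] := sf' m.
have J2 n := proj1 (hJ n); have J2' n := proj1 (hJ' n).
have I2 n := proj1 (hI n); have I2' n := proj1 (hI' n).
pose S (Z : nat -> T -> R) N w := \sum_(n < N) Z n w.
have S2 Z : (forall n, Z n \in Lfun P 2%:E) -> forall N, S Z N \in Lfun P 2%:E.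
  by move=> Z2 N; apply: L2_sum.
have := cvgn_ip (S2 J J2) (S2 J' J2') X2 X2' (proj1 (L2_cvgP (S2 J J2) X2) cJ)
  (proj1 (L2_cvgP (S2 J' J2') X2') cJ').
apply: cvg_trans; apply: near_eq_cvg; apply: nearW => N.
rewrite ip_orthogonal_sum//; last first.
  move=> n m nm.
  exact: (multiple_integral_orthogonal nm hj (mf n) (mf' m) (hJ n) (hJ' m)).
apply: eq_bigr => n _.
rewrite (multiple_integral_transfer hB hj (mf n) (mf' n) (hJ n) (hJ' n) (hI n) (hI' n)).
congr (_ * _); have h := chaos_terms_unique hB mf mf' F2 hI hI' cI cI' n.
have := ip_sqr_eq0 (L2B (I2 n) (I2' n)) (I2 n) h; rewrite ipBl//.
rewrite (ipC P1 (I' n)) => /subr0_eq <-.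
by rewrite (multiple_integral_sqnorm hB (sf n) (hI n)) (chaos_weight_unique hB e0 e1).
Qed.

End chaos_covariance.

(** * Mean square differentiability *)

Section cosine_powers.
Context {R : realType}.
Implicit Types (h k x : R) (n : nat).

(** The point c depends on x, but |c| <= |x| is enough both for |sin x| <= |x| and for the lower
    bound on sin x / x. *)
Lemma sin_mvt x : exists2 c, `|c| <= `|x| & sin x = x * cos c.
Proof.
have pos (y : R) : 0 <= y -> exists2 c, `|c| <= `|y| & sin y = y * cos c.
  rewrite le_eqVlt => /predU1P[<-|y0]; first by exists 0; rewrite ?sin0 ?mul0r.
  have dsin u : u \in `]0, y[ -> is_derive u (1 : R) sin (cos u).
    by move=> _; exact: is_derive_sin.
  have cs : {within `[0, y], continuous (@sin R)}.
    by apply: continuous_subspaceT => u; exact: continuous_sin.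
  have [c] := MVT y0 dsin cs; rewrite in_itv/= => /andP[c0 cy].
  rewrite sin0 !subr0 => ->; exists c; last by rewrite mulrC.
  by rewrite !ger0_norm// ltW.
have [x0|x0] := leP 0 x; first exact: pos.
have [|c cx e] := pos (- x); first by rewrite oppr_ge0 ltW.
exists c; first by rewrite -(normrN x).
by apply: oppr_inj; rewrite -sinN e mulNr.
Qed.

Lemma norm_cos_le1 x : `|cos x| <= 1.
Proof. by rewrite ler_norml cos_geN1 cos_le1. Qed.

Lemma norm_sin_le x : `|sin x| <= `|x|.
Proof.
have [c _ ->] := sin_mvt x.
by rewrite normrM ler_piMr// norm_cos_le1.
Qed.

Lemma cos_ge_parabola x : 1 - x ^+ 2 / 2 <= cos x.
Proof.
have e : cos x = 1 - 2 * sin (x / 2) ^+ 2.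
  have {1}-> : x = x / 2 + x / 2 by lra.
  rewrite cosD; have := cos2Dsin2 (x / 2).
  rewrite -!expr2 => h; lra.
have h : sin (x / 2) ^+ 2 <= (x / 2) ^+ 2.
  rewrite -[leRHS]real_normK ?num_real// -[leLHS]real_normK ?num_real//.
  by rewrite lerXn2r ?nnegrE// norm_sin_le.
rewrite e; rewrite expr_div_n in h; lra.
Qed.

Lemma sinc_ge x : x != 0 -> 1 - x ^+ 2 / 2 <= x^-1 * sin x.
Proof.
move=> x0; have [c cx ->] := sin_mvt x; rewrite mulrA mulVf// mul1r.
apply: le_trans (cos_ge_parabola c); rewrite lerD2l lerN2 ler_pM2r//.
by rewrite -[leRHS]real_normK ?num_real// -[leLHS]real_normK ?num_real// lerXn2r ?nnegrE.
Qed.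

Lemma bernoulli_ineq (a : R) n : 0 <= a <= 1 -> 1 - n%:R * (1 - a) <= a ^+ n.
Proof.
move=> /andP[a0 a1]; elim: n => [|n ih]; first by rewrite mul0r subr0.
rewrite exprS; apply: le_trans (ler_wpM2l a0 ih).
rewrite -natr1; have n0 : (0 : R) <= n%:R by [].
have : 0 <= n%:R * (1 - a) ^+ 2 by rewrite mulr_ge0// sqr_ge0.
rewrite expr2; nra.
Qed.

Lemma norm_powB_le (a b : R) n : `|a| <= 1 -> `|b| <= 1 ->
  `|a ^+ n - b ^+ n| <= n%:R * `|a - b|.
Proof.
move=> a1 b1; rewrite subrXX normrM mulrC ler_wpM2r//.
apply: (le_trans (ler_norm_sum _ _ _)).
rewrite -[leRHS]mulr1 -[X in _ <= X%:R * _](card_ord n) -sumr_const mulr_suml.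
apply: ler_sum => i _; rewrite mul1r normrM !normrX.
by rewrite mulr_ile1// ?exprn_ge0// exprn_ile1.
Qed.


Lemma cosX_le n h : 0 <= 1 - cos h ^+ n <= n%:R * (h ^+ 2 / 2).
Proof.
have c1 := norm_cos_le1 h; apply/andP; split.
  rewrite subr_ge0; apply: (le_trans (ler_norm _)).
  by rewrite normrX exprn_ile1.
apply: (le_trans (ler_norm _)).
have n1 : `|1 : R| <= 1 by rewrite normr1.
have := norm_powB_le n n1 c1; rewrite expr1n => /le_trans; apply.
rewrite ler_wpM2l// ger0_norm; last by have := cos_le1 h; lra.
have := cos_ge_parabola h; lra.
Qed.

(* The covariance of (X_h - X_0) / h and (X_k - X_0) / k for a stationary
   process X with covariance function cos ^ n. *)
Definition cos_quotient n h k : R :=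
  h^-1 * k^-1 * (cos (h - k) ^+ n - cos h ^+ n - cos k ^+ n + 1).

Lemma cos_quotient_diag n h : h != 0 -> cos_quotient n h h <= n%:R.
Proof.
move=> h0; have /andP[_] := cosX_le n h.
have h2 : 0 < h^-1 * h^-1 by rewrite -expr2 lt_def sqr_ge0 andbT expf_neq0// invr_eq0.
rewrite /cos_quotient subrr cos0 expr1n => H.
have -> : n%:R = h^-1 * h^-1 * (n%:R * h ^+ 2) :> R by field.
rewrite ler_wpM2l//; last lra.
exact: ltW.
Qed.

(** With a = cos (h - k) and b = cos h cos k, the bracket is a^n - b^n plus (1 - cos^n h) (1 - cos^n
    k). As a - b = sin h sin k, factoring a^n - b^n lets the divisions by h and k be absorbed into
    sin h / h and sin k / k. *)
Lemma cos_quotientE n h k : h != 0 -> k != 0 -> cos_quotient n h k =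
  (h^-1 * sin h) * (k^-1 * sin k) * \sum_(i < n)
     cos (h - k) ^+ (n.-1 - i) * (cos h * cos k) ^+ i +
  h^-1 * (1 - cos h ^+ n) * (k^-1 * (1 - cos k ^+ n)).
Proof.
move=> h0 k0.
have e : sin h * sin k = cos (h - k) - cos h * cos k by rewrite cosB; ring.
have -> : h^-1 * sin h * (k^-1 * sin k) * (\sum_(i < n)
     cos (h - k) ^+ (n.-1 - i) * (cos h * cos k) ^+ i) =
     h^-1 * k^-1 * (cos (h - k) ^+ n - (cos h * cos k) ^+ n).
  by rewrite subrXX -e; ring.
rewrite /cos_quotient exprMn; ring.
Qed.

(** Each of the two summands of the decomposition is at most n in absolute value: the first because
    |a^n - b^n| <= n |a - b| = n |sin h sin k|, the second by [W]. The bound is uniform in h and k,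
    as the tail of the series requires. *)
Lemma cos_quotient_ge n h k : h != 0 -> k != 0 ->
  - (2 * n%:R) <= cos_quotient n h k.
Proof.
move=> h0 k0; rewrite lerNl; apply: (le_trans (ler_norm _)); rewrite normrN.
have -> : cos_quotient n h k =
    h^-1 * k^-1 * (cos (h - k) ^+ n - (cos h * cos k) ^+ n) +
    h^-1 * (1 - cos h ^+ n) * (k^-1 * (1 - cos k ^+ n)).
  by rewrite /cos_quotient exprMn; ring.
have V x : x != 0 -> `|x^-1 * sin x| <= 1.
  by move=> x0; rewrite normrM normfV ler_pdivrMl ?normr_gt0// mulr1 norm_sin_le.
(* 1 - cos^n x is at most 2 and at most n x^2 / 2, so its square is at most n x^2. *)
have W x : x != 0 -> `|x^-1 * (1 - cos x ^+ n)| ^+ 2 <= n%:R.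
  move=> x0; rewrite real_normK ?num_real// exprMn exprVn mulrC ler_pdivrMr; last first.
    by rewrite lt_def sqr_ge0 andbT expf_neq0.
  have /andP[H1 H2] := cosX_le n x.
  have H3 : 1 - cos x ^+ n <= 2.
    have := ler_norm (- cos x ^+ n); rewrite normrN normrX => H.
    have : `|cos x| ^+ n <= 1 by rewrite exprn_ile1// norm_cos_le1.
    lra.
  have : (1 - cos x ^+ n) ^+ 2 <= 2 * (1 - cos x ^+ n) by rewrite expr2 ler_wpM2r.
  lra.
have -> : 2 * n%:R = n%:R + n%:R :> R by lra.
apply: (le_trans (ler_normD _ _)); apply: lerD.
  have c2 : `|cos h * cos k| <= 1.
    by rewrite normrM mulr_ile1// norm_cos_le1.
  have e : sin h * sin k = cos (h - k) - cos h * cos k by rewrite cosB; ring.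
  rewrite normrM; apply: (le_trans (ler_wpM2l (normr_ge0 _) (norm_powB_le n (norm_cos_le1 _) c2))).
  rewrite -e mulrCA -normrM ler_piMr//.
  have -> : h^-1 * k^-1 * (sin h * sin k) = (h^-1 * sin h) * (k^-1 * sin k) by ring.
  by rewrite normrM mulr_ile1// V.
rewrite normrM.
have := W h h0; have := W k k0.
move: `|h^-1 * _| `|k^-1 * _| => a b; rewrite !expr2.
have : 0 <= (a - b) ^+ 2 by exact: sqr_ge0.
rewrite expr2; nra.
Qed.

(** The number a = 1 - 2 delta^2 bounds from below cos (h - k), where |h - k| <= 2 delta, as well as
    cos h cos k and the product of the two sine quotients. The first summand is thus at least n a^n
    >= n - 2 n^2 delta^2 by Bernoulli, and the second at least - n^2 delta^2. The condition delta <=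
    1 / 2 keeps a positive. *)
Lemma cos_quotient_near n h k delta : h != 0 -> k != 0 ->
  `|h| <= delta -> `|k| <= delta -> delta <= 1 / 2 ->
  n%:R - 3 * n%:R ^+ 2 * delta ^+ 2 <= cos_quotient n h k.
Proof.
move=> h0 k0 hd kd d2.
have d0 : 0 <= delta by apply: le_trans hd.
have S x y : `|x| <= y -> x ^+ 2 <= y ^+ 2.
  move=> xy; rewrite -[leLHS]real_normK ?num_real// lerXn2r ?nnegrE//.
  exact: le_trans xy.
have h2 := S _ _ hd; have k2 := S _ _ kd.
have hk2 : (h - k) ^+ 2 <= (2 * delta) ^+ 2.
  apply: S; apply: (le_trans (ler_normB _ _)); lra.
have dd : delta ^+ 2 <= 1 / 4.
  have -> : 1 / 4 = (1 / 2) ^+ 2 :> R by field.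
  by rewrite lerXn2r ?nnegrE//; lra.
have dd0 : 0 <= delta ^+ 2 by exact: sqr_ge0.
pose a := 1 - 2 * delta ^+ 2.
have a0 : 0 <= a by rewrite /a; lra.
have a1 : a <= 1 by rewrite /a; lra.
have A1 : a <= cos (h - k).
  apply: le_trans (cos_ge_parabola _); rewrite /a; rewrite exprMn in hk2; lra.
have P2 u v : 1 - delta ^+ 2 / 2 <= u -> 1 - delta ^+ 2 / 2 <= v -> a <= u * v.
  by move=> *; rewrite /a; nra.
have A2 : a <= cos h * cos k.
  by apply: P2; [have := cos_ge_parabola h|have := cos_ge_parabola k]; lra.
have A3 : a <= h^-1 * sin h * (k^-1 * sin k).
  by apply: P2; [have := sinc_ge h0|have := sinc_ge k0]; lra.
have B x : x != 0 -> `|x| <= delta -> `|x^-1 * (1 - cos x ^+ n)| <= n%:R * delta.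
  move=> x0 xd; rewrite normrM normfV ler_pdivrMl ?normr_gt0//.
  have /andP[H1 H2] := cosX_le n x; rewrite ger0_norm//.
  apply: (le_trans H2); rewrite [leRHS]mulrCA ler_wpM2l//.
  rewrite -(real_normK (num_real x)) expr2 -mulrA ler_wpM2l//.
  have : 0 <= `|x| by []. lra.
have C : - (n%:R ^+ 2 * delta ^+ 2) <=
    h^-1 * (1 - cos h ^+ n) * (k^-1 * (1 - cos k ^+ n)).
  rewrite lerNl; apply: (le_trans (ler_norm _)); rewrite normrN normrM.
  have -> : n%:R ^+ 2 * delta ^+ 2 = (n%:R * delta) * (n%:R * delta) by ring.
  by apply: ler_pM => //; exact: B.
rewrite cos_quotientE//.
suff D : n%:R - 2 * n%:R ^+ 2 * delta ^+ 2 <=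
    (h^-1 * sin h) * (k^-1 * sin k) * \sum_(i < n)
     cos (h - k) ^+ (n.-1 - i) * (cos h * cos k) ^+ i by lra.
have E : n%:R * a ^+ n.-1 <= \sum_(i < n) cos (h - k) ^+ (n.-1 - i) * (cos h * cos k) ^+ i.
  rewrite -[X in X%:R * _ <= _](card_ord n) -sumr_const mulr_suml.
  apply: ler_sum => i _; rewrite mul1r.
  have {1}-> : n.-1 = ((n.-1 - i) + i)%N by rewrite subnK// -ltnS (ltn_predK (ltn_ord i)).
  by rewrite exprD; apply: ler_pM; rewrite ?exprn_ge0// lerXn2r ?nnegrE//; exact: le_trans a0 _.
apply: (@le_trans _ _ (a * (n%:R * a ^+ n.-1))); last first.
  by apply: ler_pM => //; rewrite mulr_ge0// exprn_ge0.
case: n {B C E} => [|n]; first by rewrite expr0n/= !mul0r !mulr0 mul0r subr0.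
have := bernoulli_ineq n.+1 (introT andP (conj a0 a1)).
rewrite [X in _ -> _ <= X]mulrCA -exprS /= => /(ler_wpM2l (ler0n R n.+1)).
by apply: le_trans; rewrite /a le_eqVlt; apply/orP; left; apply/eqP; ring.
Qed.

End cosine_powers.

(** * Mean square derivative of a process with covariance a series of powers of the cosine *)

Section mean_square_derivative.
Context {R : realType} {d : measure_display} {T : measurableType d}.
Variables (P : probability T R) (b : nat -> R) (L : R) (X : R -> T -> R).
Hypothesis b_ge0 : forall n, 0 <= b n.
Hypothesis sum_nb : \sum_(n < N) n%:R * b n @[N --> \oo] --> L.
Hypothesis X2 : forall t, X t \in Lfun P 2%:E.
Hypothesis covX : forall s t,
  \sum_(n < N) cos (s - t) ^+ n * b n @[N --> \oo] --> ip P (X s) (X t).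

Definition rate (t h : R) (w : T) : R := h^-1 * (X (t + h) w - X t w).

Lemma rate_L2 t h : rate t h \in Lfun P 2%:E.
Proof. exact/L2Z/L2B. Qed.

Lemma ip_rate t h k :
  \sum_(n < N) cos_quotient n h k * b n @[N --> \oo] -->
  ip P (rate t h) (rate t k).
Proof.
have D2 u := L2B (X2 (t + u)) (X2 t).
have -> : ip P (rate t h) (rate t k) = h^-1 * k^-1 * (ip P (X (t + h)) (X (t + k)) -
    ip P (X (t + h)) (X t) - ip P (X t) (X (t + k)) + ip P (X t) (X t)).
  by rewrite /rate ipZl ?ipZr ?D2// ?ipBl ?ipBr ?X2 ?D2//; [ring|exact: rate_L2].
pose S u N := \sum_(n < N) cos u ^+ n * b n.
have c1 : S (h - k) N @[N --> \oo] --> ip P (X (t + h)) (X (t + k)).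
  have := @covX (t + h) (t + k); rewrite (_ : t + h - (t + k) = h - k); [exact|ring].
have c2 : S h N @[N --> \oo] --> ip P (X (t + h)) (X t).
  have := @covX (t + h) t; rewrite (_ : t + h - t = h); [exact|ring].
have c3 : S k N @[N --> \oo] --> ip P (X t) (X (t + k)).
  have := @covX t (t + k); rewrite (_ : t - (t + k) = - k); last ring.
  under eq_fun => N do under eq_bigr do rewrite cosN.
  exact.
have c4 : S 0 N @[N --> \oo] --> ip P (X t) (X t).
  by have := @covX t t; rewrite subrr.
rewrite (_ : (fun N => _) = fun N => h^-1 * k^-1 * (S (h - k) N - S h N - S k N + S 0 N)).
  apply: cvgM; first exact: cvg_cst.
  by apply: cvgD => //; apply: cvgB => //; apply: cvgB.
apply/funext => N; rewrite /S -!sumrB -big_split /= mulr_sumr.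
by apply: eq_bigr => n _; rewrite cos0 expr1n /cos_quotient; ring.
Qed.

Lemma sum_nb_le N : \sum_(n < N) n%:R * b n <= L.
Proof.
have /cvg_lim <- := sum_nb; last exact: norm_hausdorff.
apply: limr_ge; first by apply/cvg_ex; exists L.
exists N => // m /= Nm; rewrite -!(big_mkord xpredT (fun n => n%:R * b n)).
rewrite (big_cat_nat (leq0n N) Nm)//= lerDl sumr_ge0// => n _; exact: mulr_ge0.
Qed.

Lemma ip_rate_le t h : h != 0 -> ip P (rate t h) (rate t h) <= L.
Proof.
move=> h0; have /cvg_lim <- := @ip_rate t h h; last exact: norm_hausdorff.
apply: limr_le; first by apply/cvg_ex; exists (ip P (rate t h) (rate t h)); exact: (@ip_rate t _ _).
apply: nearW => N; apply: (le_trans _ (sum_nb_le N)).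
by apply: ler_sum => n _; rewrite ler_wpM2r// cos_quotient_diag.
Qed.

(* With the upper bound ip_rate_le, this lower bound is all that is needed for
   the Cauchy property: |Q_h - Q_k|^2 <= 2 L - 2 <Q_h, Q_k>. The terms n < N0 are
   nearly equal to n b_n, the others are bounded below by - 2 n b_n. *)
Lemma ip_rate_ge t e : 0 < e -> exists2 delta, 0 < delta &
  forall h k, h != 0 -> k != 0 -> `|h| <= delta -> `|k| <= delta ->
  L - e <= ip P (rate t h) (rate t k).
Proof.
(* The budget e is spent in quarters: one on truncating the series at N0, one on the error of the
   head, and two on the tail, whose sum is at most e / 4 and enters with the factor - 2. *)
move=> e0; have e4 : 0 < e / 4 by rewrite divr_gt0.
have [N0 _ HN] : \forall N \near \oo, L - e / 4 <= \sum_(n < N) n%:R * b n.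
  have /cvgrPdist_le/(_ _ e4)[N _ H] := sum_nb.
  exists N => // M NM; have := H M NM; rewrite /= ler_norml => /andP[_]; lra.
have {HN} hN := HN N0 (leqnn N0).
pose C := \sum_(n < N0) 3 * n%:R ^+ 2 * b n.
have C0 : 0 <= C by apply: sumr_ge0 => n _; rewrite !mulr_ge0// sqr_ge0.
(* The bound 1 / 2 is the range of [cos_quotient_near] and also gives delta^2 <= delta; C + 1
   replaces C, which may vanish, in the denominator. *)
pose delta := Num.min (1 / 2) (e / 4 / (C + 1)).
have d0 : 0 < delta by rewrite /delta lt_min !divr_gt0 ?ltr_wpDl.
have d1 : delta <= 1 / 2 by rewrite /delta ge_min lexx.
have d2 : C * delta ^+ 2 <= e / 4.
  have : delta * (C + 1) <= e / 4.
    by rewrite -ler_pdivlMr ?ltr_wpDl// /delta ge_min lexx orbT.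
  rewrite expr2; nra.
exists delta => // h k h0 k0 hd kd.
have /cvg_lim <- := @ip_rate t h k; last exact: norm_hausdorff.
apply: limr_ge; first by apply/cvg_ex; exists (ip P (rate t h) (rate t k)); exact: (@ip_rate t _ _).
exists N0 => // M /= NM; rewrite -(big_mkord xpredT (fun n => cos_quotient n h k * b n)).
have sM := sum_nb_le M.
rewrite -(big_mkord xpredT (fun n => n%:R * b n)) (big_cat_nat (leq0n N0) NM)//= in sM.
rewrite (big_cat_nat (leq0n N0) NM)//=.
have A : \sum_(0 <= n < N0) n%:R * b n - C * delta ^+ 2 <=
    \sum_(0 <= n < N0) cos_quotient n h k * b n.
  rewrite !big_mkord /C mulr_suml -sumrB; apply: ler_sum => n _.
  have -> : n%:R * b n - 3 * n%:R ^+ 2 * b n * delta ^+ 2 =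
      (n%:R - 3 * n%:R ^+ 2 * delta ^+ 2) * b n by ring.
  by rewrite ler_wpM2r// cos_quotient_near.
have A' : - 2 * \sum_(N0 <= n < M) n%:R * b n <= \sum_(N0 <= n < M) cos_quotient n h k * b n.
  rewrite mulr_sumr; apply: ler_sum => n _.
  rewrite mulrA ler_wpM2r// mulNr; exact: cos_quotient_ge.
rewrite -(big_mkord xpredT (fun n => n%:R * b n)) in hN.
lra.
Qed.

Lemma rate_dist t e : 0 < e -> exists2 delta, 0 < delta &
  forall h k, h != 0 -> k != 0 -> `|h| <= delta -> `|k| <= delta ->
  ip P (rate t h \- rate t k) (rate t h \- rate t k) <= e.
Proof.
move=> e0; have e2 : 0 < e / 2 by rewrite divr_gt0.
have [delta d0 H] := ip_rate_ge t e2; exists delta => // h k h0 k0 hd kd.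
rewrite ip_sqr; [|exact: rate_L2|exact: rate_L2].
have := H _ _ h0 k0 hd kd; have := ip_rate_le t h0; have := ip_rate_le t k0; lra.
Qed.

Lemma L2_derivativeP t Z : L2_derivative P X t Z <->
  Z \in Lfun P 2%:E /\
  ip P (rate t h \- Z) (rate t h \- Z) @[h --> 0^'] --> (0 : R).
Proof.
have h (Z2 : Z \in Lfun P 2%:E) := L2_norm_cvg0
  (Proper_dnbhs_numFieldType (0 : R)) (fun h => L2B (rate_L2 t h) Z2).
by split => -[Z2 hZ]; split => //; apply/(h Z2).
Qed.

(** Completeness yields a candidate along h = 1 / (j + 1). The Cauchy estimate holds for all small h
    and k, so the limit along this sequence is the limit for h tending to 0. *)
Lemma mean_square_differentiable : L2_differentiable P X.
Proof.
move=> t; pose u j : R := j.+1%:R^-1.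
have u0 j : u j != 0 by rewrite invr_eq0 pnatr_eq0.
have u_small delta : 0 < delta -> exists N, forall j, (N <= j)%N -> `|u j| <= delta.
  move=> d0; have /cvgrPdist_le/(_ _ d0)[N _ H] := @cvg_harmonic R.
  exists N => j Nj; have := H j Nj; rewrite /= sub0r normrN; exact.
have [|Z Z2 cZ] := @L2_complete _ _ _ P (fun j => rate t (u j)) (fun j => rate_L2 t (u j)).
  move=> e e0; have [delta d0 H] := rate_dist t e0.
  have [N HN] := u_small _ d0; exists N => m n Nm Nn.
  by apply: H => //; exact: HN.
exists Z; apply/L2_derivativeP; split => //; apply/cvgrPdist_le => e e0.
have e4 : 0 < e / 4 by rewrite divr_gt0.
have [delta d0 H] := rate_dist t e4.
have [N HN] := u_small _ d0.
have /cvgrPdist_le/(_ _ e4)[M _ HM] := cZ.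
near=> h; rewrite sub0r normrN ger0_norm ?ip_ge0//.
have h0 : h != 0 by near: h; exact: nbhs_dnbhs_neq.
have hd : `|h| <= delta.
  near: h; apply: dnbhs0_le; exact: d0.
pose j := maxn M N.
apply: (le_trans (ip_triangle (rate_L2 t h) (rate_L2 t (u j)) Z2)).
have := H _ _ h0 (u0 j) hd (HN _ (leq_maxr _ _)).
have := HM j (leq_maxl _ _); rewrite /= sub0r normrN ger0_norm ?ip_ge0//; lra.
Unshelve. all: by end_near. Qed.

Lemma cvg_ip_rate t Z : L2_derivative P X t Z ->
  ip P (rate t h) (rate t h) @[h --> 0^'] --> ip P Z Z.
Proof.
by move=> /L2_derivativeP[Z2 cZ]; exact: (cvg_ip _ (rate_L2 t) (rate_L2 t) Z2 Z2 cZ cZ).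
Qed.

(** The squared norms of the rates are squeezed between L - e and L; the lower bound is [ip_rate_ge]
    at equal steps. *)
Lemma mean_square_derivative_norm t Z : L2_derivative P X t Z -> ip P Z Z = L.
Proof.
move=> /cvg_ip_rate; move=> h; apply: (norm_cvg_unique h).
apply/cvgrPdist_le => e e0; have [delta d0 H] := ip_rate_ge t e0.
near=> k; have k0 : k != 0 by near: k; exact: nbhs_dnbhs_neq.
have kd : `|k| <= delta by near: k; apply: dnbhs0_le; exact: d0.
have := H _ _ k0 k0 kd kd; have := ip_rate_le t k0.
rewrite ler_norml; move=> *; apply/andP; split; lra.
Unshelve. all: by end_near. Qed.

End mean_square_derivative.

(** * Spectral representation *)

Section complex_L2.
Context {R : realType} {d : measure_display} {T : measurableType d}.
Variable P : probability T R.

Definition ReR (z : R[i]) : R := complex.Re z.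
Definition ImR (z : R[i]) : R := complex.Im z.

Lemma ReRD z z' : ReR (z + z') = ReR z + ReR z'.
Proof. by case: z z' => [a b] [a' b']. Qed.

Lemma ImRD z z' : ImR (z + z') = ImR z + ImR z'.
Proof. by case: z z' => [a b] [a' b']. Qed.

Lemma ReRM z z' : ReR (z * z') = ReR z * ReR z' - ImR z * ImR z'.
Proof. by case: z z' => [a b] [a' b']. Qed.

Lemma ImRM z z' : ImR (z * z') = ReR z * ImR z' + ImR z * ReR z'.
Proof. by case: z z' => [a b] [a' b']. Qed.

Lemma ReR_sum (I : Type) (r : seq I) (F : I -> R[i]) :
  ReR (\sum_(i <- r) F i) = \sum_(i <- r) ReR (F i).
Proof. by apply: big_morph => // z z'; exact: ReRD. Qed.

Lemma ImR_sum (I : Type) (r : seq I) (F : I -> R[i]) :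
  ImR (\sum_(i <- r) F i) = \sum_(i <- r) ImR (F i).
Proof. by apply: big_morph => // z z'; exact: ImRD. Qed.

Lemma L2_normc_cvg (Z : nat -> T -> R[i]) : (forall N, L2C P (Z N)) ->
  L2_norm P (fun w => Normc.normc (Z N w)) @[N --> \oo] --> 0%E ->
  ip P (fun w => ReR (Z N w)) (fun w => ReR (Z N w)) @[N --> \oo] --> (0 : R) /\
  ip P (fun w => ImR (Z N w)) (fun w => ImR (Z N w)) @[N --> \oo] --> (0 : R).
Proof.
move=> Z2.
have sq j w : Normc.normc (Z j w) * Normc.normc (Z j w) =
    ReR (Z j w) ^+ 2 + ImR (Z j w) ^+ 2.
  by case: (Z j w) => a b /=; rewrite -expr2 sqr_sqrtr// addr_ge0// sqr_ge0.
have Re2 j : (fun w => ReR (Z j w)) \in Lfun P 2%:E by exact: (proj1 (Z2 j)).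
have Im2 j : (fun w => ImR (Z j w)) \in Lfun P 2%:E by exact: (proj2 (Z2 j)).
have iRI j : P.-integrable [set: T] (EFin \o (fun w => ReR (Z j w) ^+ 2 + ImR (Z j w) ^+ 2)).
  have := integrableD measurableT (L2_integrableM (Re2 j) (Re2 j)) (L2_integrableM (Im2 j) (Im2 j)).
  by apply: eq_integrable => // w _; rewrite /= !expr2 EFinD.
have n2 j : (fun w => Normc.normc (Z j w)) \in Lfun P 2%:E.
  apply/L2_memP; split.
    rewrite (_ : (fun w => _) = Num.sqrt \o (fun w => ReR (Z j w) ^+ 2 + ImR (Z j w) ^+ 2)); last first.
      by apply/funext => w /=; case: (Z j w).
    have ms : measurable_fun [set: R] (@Num.sqrt R).
      by apply: continuous_measurable_fun; exact: sqrt_continuous.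
    apply: (measurableT_comp ms); apply/measurable_EFinP; exact: measurable_int (iRI j).
  under eq_integral do rewrite expr2 sq.
  have /integrableP[_] := iRI j; apply: le_lt_trans.
  apply: ge0_le_integral => //.
  - by move=> w _; rewrite lee_fin addr_ge0// sqr_ge0.
  - exact: measurable_int (iRI j).
  - by apply: measurableT_comp => //; exact: measurable_int (iRI j).
  - by move=> w _; rewrite lee_fin ler_norm.
move=> /(L2_norm_cvg0 _ n2) c.
have e j : ip P (fun w => Normc.normc (Z j w)) (fun w => Normc.normc (Z j w)) =
    ip P (fun w => ReR (Z j w)) (fun w => ReR (Z j w)) +
    ip P (fun w => ImR (Z j w)) (fun w => ImR (Z j w)).
  rewrite /ip -RintegralD//; try exact: L2_integrableM.
  by apply: eq_Rintegral => w _; rewrite sq !expr2.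
split; apply: (@cvg0_norm_le _ _ _ _ _ _ _ c); apply: nearW => k; rewrite e ger0_norm ?ip_ge0//.
  by rewrite lerDl ip_ge0.
by rewrite lerDr ip_ge0.
Qed.

(** Hermitian orthonormality controls only these two combinations of the real and imaginary parts,
    not the individual inner products. *)
Lemma orthonormal_ip (xi : int -> T -> R[i]) n m : orthonormal_L2C P xi ->
  let A n w := ReR (xi n w) in let B n w := ImR (xi n w) in
  ip P (A n) (A m) + ip P (B n) (B m) = (n == m)%:R /\
  ip P (B n) (A m) - ip P (A n) (B m) = 0.
Proof.
move=> [xi2 o] A B.
have A2 l : A l \in Lfun P 2%:E by exact: (proj1 (xi2 l)).
have B2 l : B l \in Lfun P 2%:E by exact: (proj2 (xi2 l)).
have := o n m; rewrite /expectationC unlock => e.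
have [e1 e2] : fine (\int[P]_w (ReR (xi n w * conjc (xi m w)))%:E) = (n == m)%:R /\
    fine (\int[P]_w (ImR (xi n w * conjc (xi m w)))%:E) = 0.
  split; [have := congr1 ReR e|have := congr1 ImR e] => /= ->.
    by case: (n == m).
  by case: (n == m).
split.
  rewrite -e1 /ip -RintegralD//; try exact: L2_integrableM.
  apply: eq_Rintegral => w _; rewrite ReRM /A /B.
  by case: (xi n w) (xi m w) => [a b] [a' b'] /=; ring.
rewrite -[RHS]e2 /ip -RintegralB//; try exact: L2_integrableM.
apply: eq_Rintegral => w _; rewrite ImRM /A /B.
by case: (xi n w) (xi m w) => [a b] [a' b'] /=; ring.
Qed.

(** Pythagoras in complex L^2: the terms off the diagonal group into the two combinations of
    [orthonormal_ip]. *)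
Lemma ip_orthonormal_sum (xi : int -> T -> R[i]) K (s : 'I_K -> int) (a : 'I_K -> R[i]) :
  injective s -> orthonormal_L2C P xi ->
  let U w := \sum_(k < K) a k * xi (s k) w in
  ip P (fun w => ReR (U w)) (fun w => ReR (U w)) +
  ip P (fun w => ImR (U w)) (fun w => ImR (U w)) =
  \sum_(k < K) (ReR (a k) ^+ 2 + ImR (a k) ^+ 2).
Proof.
move=> inj_s ho U; have [xi2 _] := ho.
pose A k w := ReR (xi (s k) w); pose B k w := ImR (xi (s k) w).
have A2 l : A l \in Lfun P 2%:E by exact: (proj1 (xi2 _)).
have B2 l : B l \in Lfun P 2%:E by exact: (proj2 (xi2 _)).
pose X k w := ReR (a k) * A k w - ImR (a k) * B k w.
pose Y k w := ReR (a k) * B k w + ImR (a k) * A k w.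
have X2 k : X k \in Lfun P 2%:E by apply: L2B; exact: L2Z.
have Y2 k : Y k \in Lfun P 2%:E by apply: L2D; exact: L2Z.
have -> : (fun w => ReR (U w)) = fun w => \sum_(k < K) X k w.
  by apply/funext => w; rewrite ReR_sum; apply: eq_bigr => k _; rewrite ReRM.
have -> : (fun w => ImR (U w)) = fun w => \sum_(k < K) Y k w.
  by apply/funext => w; rewrite ImR_sum; apply: eq_bigr => k _; rewrite ImRM.
have X2s : (fun w => \sum_(k < K) X k w) \in Lfun P 2%:E by exact: L2_sum.
have Y2s : (fun w => \sum_(k < K) Y k w) \in Lfun P 2%:E by exact: L2_sum.
rewrite !ip_suml// -big_split; apply: eq_bigr => k _.
rewrite !ip_sumr// -big_split /= (bigD1 k)//= big1 ?addr0.
  have [e1 e2] := orthonormal_ip (s k) (s k) ho.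
  have ZA c l : (fun w => c * A l w) \in Lfun P 2%:E by exact: L2Z.
  have ZB c l : (fun w => c * B l w) \in Lfun P 2%:E by exact: L2Z.
  rewrite /X /Y ipBl ?ipBr ?ipDl ?ipDr// ?L2B ?L2D//.
  rewrite !ipZl ?ipZr//.
  rewrite eqxx in e1.
  transitivity ((ReR (a k) ^+ 2 + ImR (a k) ^+ 2) *
    (ip P (A k) (A k) + ip P (B k) (B k))); first by ring.
  by rewrite /A /B e1 mulr1.
move=> l lk; have [e1 e2] := orthonormal_ip (s k) (s l) ho.
have ZA c j : (fun w => c * A j w) \in Lfun P 2%:E by exact: L2Z.
have ZB c j : (fun w => c * B j w) \in Lfun P 2%:E by exact: L2Z.
rewrite /X /Y ipBl ?ipBr ?ipDl ?ipDr// ?L2B ?L2D//.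
rewrite !ipZl ?ipZr//.
rewrite (inj_eq inj_s) eq_sym (negbTE lk) in e1.
transitivity ((ReR (a k) * ReR (a l) + ImR (a k) * ImR (a l)) *
   (ip P (A k) (A l) + ip P (B k) (B l)) +
   (ReR (a k) * ImR (a l) - ImR (a k) * ReR (a l)) * 
   (ip P (B k) (A l) - ip P (A k) (B l))); first by ring.
by rewrite /A /B e1 e2 !mulr0 addr0.
Qed.

End complex_L2.

Section spectral_derivative.
Context {R : realType} {d : measure_display} {T : measurableType d}.
Variables (P : probability T R) (X : R -> T -> R) (c : int -> R) (xi : int -> T -> R[i]).
Hypothesis X2 : forall t, X t \in Lfun P 2%:E.
Hypothesis hX : spectral_representation P X c xi.

(** The real parts of the partial sums tend to X and the imaginary parts to 0, X being real. The
    squared complex norm of the increment of a partial sum, given by Pythagoras, hence tends to that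
    of X, and |e^(in(t+h)) - e^(int)|^2 = 2 - 2 cos (nh). *)
Lemma ip_increment_spectral t h :
  \sum_(k < N.*2.+1) c (k%:Z - N%:Z) ^+ 2 * (2 - 2 * cos ((k%:Z - N%:Z)%:~R * h))
    @[N --> \oo] --> ip P (X (t + h) \- X t) (X (t + h) \- X t).
Proof.
have [c0 ho cS] := hX; have [xi2 _] := ho.
pose S N s w := spectral_sum c xi N s w.
have SE N s w : ReR (S N s w) = \sum_(k < N.*2.+1)
    (ReR ((c (k%:Z - N%:Z))%:C%C * expi ((k%:Z - N%:Z)%:~R * s)) * ReR (xi (k%:Z - N%:Z) w) -
     ImR ((c (k%:Z - N%:Z))%:C%C * expi ((k%:Z - N%:Z)%:~R * s)) * ImR (xi (k%:Z - N%:Z) w)).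
  by rewrite /S /spectral_sum ReR_sum; apply: eq_bigr => k _; rewrite ReRM.
have SI N s w : ImR (S N s w) = \sum_(k < N.*2.+1)
    (ReR ((c (k%:Z - N%:Z))%:C%C * expi ((k%:Z - N%:Z)%:~R * s)) * ImR (xi (k%:Z - N%:Z) w) +
     ImR ((c (k%:Z - N%:Z))%:C%C * expi ((k%:Z - N%:Z)%:~R * s)) * ReR (xi (k%:Z - N%:Z) w)).
  by rewrite /S /spectral_sum ImR_sum; apply: eq_bigr => k _; rewrite ImRM.
have ReS2 N s : (fun w => ReR (S N s w)) \in Lfun P 2%:E.
  rewrite (funext (SE N s)); apply: L2_sum => k _; apply: L2B; apply: L2Z.
    exact: (proj1 (xi2 _)).
  exact: (proj2 (xi2 _)).
have ImS2 N s : (fun w => ImR (S N s w)) \in Lfun P 2%:E.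
  rewrite (funext (SI N s)); apply: L2_sum => k _; apply: L2D; apply: L2Z.
    exact: (proj2 (xi2 _)).
  exact: (proj1 (xi2 _)).
have ReXS N s w : ReR ((X s w)%:C%C - S N s w) = X s w - ReR (S N s w).
  by case: (S N s w).
have ImXS N s w : ImR ((X s w)%:C%C - S N s w) = - ImR (S N s w).
  by case: (S N s w) => a b /=; rewrite sub0r.
have XS2 s N : L2C P (fun w => (X s w)%:C%C - S N s w).
  split; first by rewrite (funext (ReXS N s)); exact: L2B.
  by rewrite (funext (ImXS N s)); exact: L2N.
have cRI s := L2_normc_cvg (XS2 s) (cS s).
have cRe s : ip P ((fun w => ReR (S N s w)) \- X s) ((fun w => ReR (S N s w)) \- X s)
    @[N --> \oo] --> (0 : R).
  apply: cvg_trans (proj1 (cRI s)); apply: near_eq_cvg; apply: nearW => N.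
  by apply: eq_Rintegral => w _; rewrite ReXS /=; ring.
have cIm s : ip P ((fun w => ImR (S N s w)) \- cst 0) ((fun w => ImR (S N s w)) \- cst 0)
    @[N --> \oo] --> (0 : R).
  apply: cvg_trans (proj2 (cRI s)); apply: near_eq_cvg; apply: nearW => N.
  by apply: eq_Rintegral => w _; rewrite ImXS /=; ring.
have incr (U V : nat -> T -> R) (U0 V0 : T -> R) :
    (forall N, U N \in Lfun P 2%:E) -> (forall N, V N \in Lfun P 2%:E) ->
    U0 \in Lfun P 2%:E -> V0 \in Lfun P 2%:E ->
    ip P (U N \- U0) (U N \- U0) @[N --> \oo] --> (0 : R) ->
    ip P (V N \- V0) (V N \- V0) @[N --> \oo] --> (0 : R) ->
    ip P (U N \- V N) (U N \- V N) @[N --> \oo] --> ip P (U0 \- V0) (U0 \- V0).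
  move=> U2 V2 U02 V02 cU cV; rewrite ip_sqr//.
  rewrite (_ : (fun N => _) = fun N => ip P (U N) (U N) - 2 * ip P (U N) (V N) + ip P (V N) (V N)).
    apply: cvgD; last exact: cvgn_ip.
    apply: cvgB; first exact: cvgn_ip.
    apply: cvgM; [exact: cvg_cst|exact: cvgn_ip].
  by apply/funext => N; rewrite ip_sqr.
have l1 := incr _ _ _ _ (ReS2^~ (t + h)) (ReS2^~ t) (X2 (t + h)) (X2 t) (cRe _) (cRe _).
have l2 := incr _ _ _ _ (ImS2^~ (t + h)) (ImS2^~ t) (L2_cst P 0) (L2_cst P 0) (cIm _) (cIm _).
have c00 : ip P (cst 0 \- cst 0) (cst 0 \- cst 0) = 0.
  rewrite /ip (_ : (fun w => _) = cst 0); first by rewrite Rintegral_cst// mul0r.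
  by apply/funext => w /=; ring.
rewrite c00 in l2; rewrite -[X in _ --> X]addr0.
apply: cvg_trans (cvgD l1 l2); apply: near_eq_cvg; apply: nearW => N /=.
pose a (k : 'I_(N.*2.+1)) := (c (k%:Z - N%:Z))%:C%C * expi ((k%:Z - N%:Z)%:~R * (t + h)) -
  (c (k%:Z - N%:Z))%:C%C * expi ((k%:Z - N%:Z)%:~R * t).
have inj_s : injective (fun k : 'I_(N.*2.+1) => k%:Z - N%:Z).
  by move=> k l /addIr [] /val_inj.
have e w : S N (t + h) w - S N t w = \sum_(k < N.*2.+1) a k * xi (k%:Z - N%:Z) w.
  by rewrite /S /spectral_sum -sumrB; apply: eq_bigr => k _; rewrite /a mulrBl.
have := ip_orthonormal_sum a inj_s ho => /=.
have -> : (fun w => ReR (\sum_(k < N.*2.+1) a k * xi (k%:Z - N%:Z) w)) =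
    (fun w => ReR (S N (t + h) w)) \- (fun w => ReR (S N t w)).
  by apply/funext => w; rewrite -e /=; case: (S N (t + h) w) (S N t w) => [? ?] [? ?].
have -> : (fun w => ImR (\sum_(k < N.*2.+1) a k * xi (k%:Z - N%:Z) w)) =
    (fun w => ImR (S N (t + h) w)) \- (fun w => ImR (S N t w)).
  by apply/funext => w; rewrite -e /=; case: (S N (t + h) w) (S N t w) => [? ?] [? ?].
move=> hU; rewrite [LHS]hU; apply: eq_bigr => k _.
set n := (_%:~R : R); rewrite /expi /ReR /ImR /=.
have h1 := cos2Dsin2 (n * (t + h)); have h2 := cos2Dsin2 (n * t).
have -> : cos (n * h) = cos (n * (t + h)) * cos (n * t) + sin (n * (t + h)) * sin (n * t).
  by rewrite -cosB; congr cos; ring.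
rewrite !mul0r !subr0 !addr0.
set C1 := cos (n * (t + h)) in h1 *; set C2 := cos (n * t) in h2 *.
set S1 := sin (n * (t + h)) in h1 *; set S2 := sin (n * t) in h2 *.
set cc := c _.
transitivity (cc ^+ 2 * ((C1 ^+ 2 + S1 ^+ 2) + (C2 ^+ 2 + S2 ^+ 2) - 2 * (C1 * C2 + S1 * S2))).
  by ring.
by rewrite h1 h2; ring.
Qed.

End spectral_derivative.

(** With u = y / 2, 2 - 2 cos y = 4 sin^2 u, and (sin u / u)^2 >= 1 - u^2. This even gives y^2 - y^4
    / 4; the cruder bound is enough. *)
Lemma cos_le_quartic {R : realType} (y : R) : y ^+ 2 - y ^+ 4 <= 2 - 2 * cos y.
Proof.
have e : 2 - 2 * cos y = 4 * sin (y / 2) ^+ 2.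
  have {1}-> : y = y / 2 + y / 2 by lra.
  rewrite cosD; have := cos2Dsin2 (y / 2).
  rewrite -!expr2 => h; lra.
have [->|y0] := eqVneq y 0; first by rewrite cos0 !expr0n /=; lra.
have u0 : y / 2 != 0 by rewrite mulf_neq0// invr_eq0 pnatr_eq0.
rewrite e; have := sinc_ge u0; set u := y / 2 in u0 *.
have yu : y = 2 * u by rewrite /u; lra.
clearbody u.
have su : sin u ^+ 2 = u ^+ 2 * (u^-1 * sin u) ^+ 2 by field.
rewrite su yu; move: (u^-1 * sin u) => v hv.
have uu : 0 <= u ^+ 2 := sqr_ge0 u.
suff : 1 - u ^+ 2 <= v ^+ 2.
  move=> h; have := ler_wpM2l uu h.
  rewrite (_ : u ^+ 2 * (1 - u ^+ 2) = u ^+ 2 - u ^+ 4); last by ring.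
  rewrite !exprMn (_ : 2 ^+ 2 = 4); last by ring.
  have : 0 <= u ^+ 4 by rewrite (_ : u ^+ 4 = (u ^+ 2) ^+ 2) ?sqr_ge0//; ring.
  rewrite (_ : 2 ^+ 4 = 16); last by ring.
  lra.
(* The lower bound on v may be squared only when it is nonnegative; otherwise u^2 > 2 and 1 - u^2 is
   negative. *)
have [w0|w0] := leP 0 (1 - u ^+ 2 / 2).
  have : (1 - u ^+ 2 / 2) ^+ 2 <= v ^+ 2 by rewrite lerXn2r ?nnegrE//; exact: le_trans hv.
  have : 0 <= (u ^+ 2) ^+ 2 := sqr_ge0 _.
  by rewrite [(1 - _) ^+ 2](_ : _ = 1 - u ^+ 2 + (u ^+ 2) ^+ 2 / 4); [lra|field].
have := sqr_ge0 v; lra.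
Qed.

Lemma int_shift (n : int) (N : nat) : (absz n <= N)%N ->
  (absz (n + N%:Z)%R < N.*2.+1)%N /\ (absz (n + N%:Z))%:Z - N%:Z = n.
Proof. by split; lia. Qed.

Section symmetric_sums.
Context {R : realType}.
Variable a : int -> R.
Hypothesis a_ge0 : forall n, 0 <= a n.

(** The sum over |n| <= N, indexed as in [spectral_sum]. *)
Definition symmetric_sum (a : int -> R) (N : nat) : R :=
  \sum_(k < N.*2.+1) a (k%:Z - N%:Z).

Lemma symmetric_sum_homo N M : (N <= M)%N -> symmetric_sum a N <= symmetric_sum a M.
Proof.
apply: (@homo_leq _ (symmetric_sum a) (fun x y => x <= y));
  [by []|by move=> x y z; exact: le_trans|move=> n].
rewrite /symmetric_sum doubleS [leRHS]big_ord_recl [X in _ + X]big_ord_recr /=.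
rewrite addrCA ler_wpDr ?addr_ge0//.
by apply: ler_sum => i _; rewrite /bump /=; have -> : ((1 + i)%N%:Z - n.+1%:Z) = i%:Z - n%:Z by lia.
Qed.

Lemma symmetric_sum_le_esum N :
  ((symmetric_sum a N)%:E <= \esum_(n in [set: int]) (a n)%:E)%E.
Proof.
apply: esum_ge; pose s (k : nat) := k%:Z - N%:Z.
have s_inj : set_inj `I_(N.*2.+1) s by move=> k l _ _ /addIr [].
exists (s @` `I_(N.*2.+1)).
  by split; [exact/finite_image/finite_II|].
by rewrite (fsbig_image _ _ _ s_inj) -fsbig_ord sumEFin.
Qed.

(** Every finite set of integers lies in some symmetric range. *)
Lemma esum_le_symmetric L : (forall N, symmetric_sum a N <= L) ->
  (\esum_(n in [set: int]) (a n)%:E <= L%:E)%E.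
Proof.
move=> h; apply: ge_ereal_sup => _ [A [finA _] <-].
have /finite_seqP[r rA] := finA.
pose N := (\max_(n <- r) `|n|)%N; pose s (k : nat) := k%:Z - N%:Z.
have s_inj : set_inj `I_(N.*2.+1) s by move=> k l _ _ /addIr [].
apply: (@le_trans _ _ (\sum_(n \in s @` `I_(N.*2.+1)) (a n)%:E)%E).
  apply: lee_fsum_nneg_subset => //.
  - exact/finite_image/finite_II.
  - move=> n /set_mem nA; apply/mem_set.
    have nN : (`|n| <= N)%N.
      by apply: (@leq_bigmax_seq _ r xpredT absz n) => //; move: nA; rewrite rA.
    by have [? ?] := int_shift nN; exists (absz (n + N%:Z)).
  - by move=> n _; rewrite lee_fin.
rewrite (fsbig_image _ _ _ s_inj) -(fsbig_ord _ _ (fun k => (a (s k))%:E)) sumEFin lee_fin.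
exact: h.
Qed.

End symmetric_sums.

Section spectral_norm.
Context {R : realType} {d : measure_display} {T : measurableType d}.
Variables (P : probability T R) (X : R -> T -> R) (c : int -> R) (xi : int -> T -> R[i]).
Hypothesis X2 : forall t, X t \in Lfun P 2%:E.
Hypothesis hX : spectral_representation P X c xi.

(** 2 - 2 cos y lies between y^2 - y^4 and y^2. The upper bound passes term by term to the whole
    series, so the limit of the rates is at most the sum; the lower bound gives the converse on each
    symmetric range. *)
Lemma spectral_derivative_norm t Z : L2_derivative P X t Z ->
  (\esum_(n in [set: int]) (n%:~R ^+ 2 * c n ^+ 2)%:E)%E = (ip P Z Z)%:E.
Proof.
move=> hZ; have cr := cvg_ip_rate X2 hZ.
pose g h (n : int) := c n ^+ 2 * (h^-1 ^+ 2 * (2 - 2 * cos (n%:~R * h))).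
pose g0 (n : int) : R := n%:~R ^+ 2 * c n ^+ 2.
have g0_ge0 n : 0 <= g0 n by rewrite mulr_ge0 ?sqr_ge0.
have g_ge0 h n : 0 <= g h n.
  rewrite /g mulr_ge0 ?sqr_ge0//; apply: mulr_ge0; first exact: sqr_ge0.
  have := cos_le1 (n%:~R * h); lra.
have g_le h n : h != 0 -> g h n <= g0 n.
  move=> h0; rewrite /g /g0 mulrC ler_wpM2r ?sqr_ge0// exprVn mulrC ler_pdivrMr; last first.
    by rewrite lt_def sqr_ge0 andbT expf_neq0.
  rewrite -exprMn; have := cos_ge_parabola (n%:~R * h); lra.
have g_ge h n : h != 0 -> g0 n - h ^+ 2 * (n%:~R ^+ 4 * c n ^+ 2) <= g h n.
  move=> h0; have := cos_le_quartic (n%:~R * h).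
  have h2 : 0 <= c n ^+ 2 * h^-1 ^+ 2 by rewrite mulr_ge0 ?sqr_ge0.
  move=> /(ler_wpM2l h2) H; rewrite /g [leRHS]mulrA; apply: le_trans H.
  by rewrite le_eqVlt; apply/orP; left; apply/eqP; rewrite /g0; field.
have cg h : symmetric_sum (g h) N @[N --> \oo] --> ip P (rate X t h) (rate X t h).
  have D2 := L2B (X2 (t + h)) (X2 t).
  have -> : ip P (rate X t h) (rate X t h) =
      h^-1 ^+ 2 * ip P (X (t + h) \- X t) (X (t + h) \- X t).
    by rewrite /rate ipZl ?ipZr// ?L2Z// mulrA expr2.
  have -> : symmetric_sum (g h) = fun N => h^-1 ^+ 2 * \sum_(k < N.*2.+1)
      c (k%:Z - N%:Z) ^+ 2 * (2 - 2 * cos ((k%:Z - N%:Z)%:~R * h)).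
    apply/funext => N; rewrite /symmetric_sum mulr_sumr; apply: eq_bigr => k _.
    by rewrite /g mulrCA.
  by apply: cvgM; [exact: cvg_cst|exact: (ip_increment_spectral X2 hX)].
(* N is fixed while h tends to 0: the error h^2 C involves a finite sum of n^4 c_n^2, terms that may
   fail to be summable over all integers. *)
have up N : symmetric_sum g0 N <= ip P Z Z.
  pose C := symmetric_sum (fun n => n%:~R ^+ 4 * c n ^+ 2) N.
  have : ip P (rate X t h) (rate X t h) + h ^+ 2 * C @[h --> 0^'] --> ip P Z Z + 0 ^+ 2 * C.
    apply: cvgD => //; apply: cvgM; last exact: cvg_cst.
    by apply: cvg_within_filter; exact: (@exprn_continuous R 2 0).
  rewrite expr0n /= mul0r addr0 => cC.
  have /cvg_lim <- := cC; last exact: norm_hausdorff.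
  apply: limr_ge; first by apply/cvg_ex; exists (ip P Z Z).
  near=> h; have h0 : h != 0 by near: h; exact: nbhs_dnbhs_neq.
  rewrite -lerBlDr; apply: (@le_trans _ _ (symmetric_sum (g h) N)).
    rewrite /C /symmetric_sum mulr_sumr -sumrB; apply: ler_sum => k _; exact: g_ge.
  have /cvg_lim <- := @cg h; last exact: norm_hausdorff.
  apply: limr_ge; first by apply/cvg_ex; exists (ip P (rate X t h) (rate X t h)); exact: (@cg h).
  by exists N => // M /= NM; exact: symmetric_sum_homo.
apply/eqP; rewrite eq_le; apply/andP; split; first exact: (esum_le_symmetric g0_ge0 up).
have fin : \esum_(n in [set: int]) (g0 n)%:E \is a fin_num.
  rewrite ge0_fin_numE; last by apply: esum_ge0 => n _; rewrite lee_fin.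
  by apply: (le_lt_trans (esum_le_symmetric g0_ge0 up)); rewrite ltry.
rewrite -(fineK fin) lee_fin.
have /cvg_lim <- := cr; last exact: norm_hausdorff.
apply: limr_le; first by apply/cvg_ex; exists (ip P Z Z).
near=> h; have h0 : h != 0 by near: h; exact: nbhs_dnbhs_neq.
have /cvg_lim <- := @cg h; last exact: norm_hausdorff.
apply: limr_le; first by apply/cvg_ex; exists (ip P (rate X t h) (rate X t h)); exact: (@cg h).
apply: nearW => N; rewrite -lee_fin (fineK fin).
apply: (@le_trans _ _ (symmetric_sum g0 N)%:E); last exact: symmetric_sum_le_esum.
rewrite lee_fin.
by apply: ler_sum => k _; exact: g_le.
Unshelve. all: by end_near. Qed.

End spectral_norm.

(** * Carre du champ *)

Lemma cvg_EFin_nat {R : realType} (u : nat -> R) l :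
  u n @[n --> \oo] --> l -> (u n)%:E @[n --> \oo] --> l%:E.
Proof. by move=> ul; apply: cvg_EFin => //; exact: nearW. Qed.

Lemma sqnorm_ge0 {R : realType} n (f : n.-tuple R -> R) : (0 <= sqnorm f)%E.
Proof. by apply: integral_Rn_ge0 => x; rewrite lee_fin sqr_ge0. Qed.

Lemma sqnormZ {R : realType} n (f : n.-tuple R -> R) c : measurable_fun setT f ->
  sqnorm (fun x => c * f x) = ((c ^+ 2)%:E * sqnorm f)%E.
Proof.
move=> mf; rewrite /sqnorm -integral_RnZl ?sqr_ge0//.
- by apply: eq_integral_Rn => x; rewrite exprMn.
- by apply/measurable_EFinP; exact: measurable_funX.
- by move=> x; rewrite lee_fin sqr_ge0.
Qed.

Lemma EFin_chaos_weight {R : realType} (f : forall n, n.-tuple R -> R) n :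
  symmetric_L2 (f n) -> (chaos_weight f n)%:E = (n`!%:R%:E * sqnorm (f n))%E.
Proof.
by move=> [_ fin _]; rewrite EFinM fineK// ge0_fin_numE// sqnorm_ge0.
Qed.

Section energy.
Context {R : realType} {d : measure_display} {T : measurableType d}.
Variables (P : probability T R) (H : R -> set (set T)) (B : R -> T -> R).
Hypothesis hB : normal_increments P H B.

(** The covariance formula with k = 1, for [F] against itself. *)
Lemma chaos_sqnorm f F : chaos_expansion P B f F ->
  (\int[P]_w (F w ^+ 2)%:E = \sum_(0 <= n <oo) n`!%:R%:E * sqnorm (f n))%E.
Proof.
move=> e; have [sf F2 _] := e.
transitivity (ip P F F)%:E; first by rewrite EFin_ip//; apply: eq_integral => w _; rewrite expr2.
apply/esym/cvg_lim => //.
have := chaos_covariance hB (normal_joint_increments hB) e e e e e.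
move=> /cvg_EFin_nat; apply: cvg_trans; apply: near_eq_cvg; apply: nearW => N.
rewrite big_mkord -sumEFin; apply: eq_bigr => n _.
by rewrite expr1n mul1r EFin_chaos_weight.
Qed.

Lemma integral_carre_du_champ (DF : R -> T -> R) :
  measurable_fun [set: R * T] (fun z => DF z.1 z.2) ->
  (\int[P]_w carre_du_champ DF w =
   \int[lebesgue_measure]_(s in `[0%R, +oo[) \int[P]_w (DF s w ^+ 2)%:E)%E.
Proof.
move=> mDF.
pose h (z : T * measurableTypeR R) : \bar R :=
  (\1_(`[0%R, +oo[%classic : set R) z.2 * DF z.2 z.1 ^+ 2)%:E.
have mh : measurable_fun setT h.
  apply/measurable_EFinP; apply: measurable_funM.
    have mI : measurable_fun [set: R] (\1_(`[0%R, +oo[%classic : set R) : R -> R).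
      exact: measurable_indic.
    exact: (measurableT_comp mI (@measurable_snd_R _ _ T)).
  apply: measurable_funX.
  apply: (measurableT_comp mDF
    (_ : measurable_fun setT (fun z : T * measurableTypeR R => (z.2, z.1)))).
  exact: measurable_fun_pair.
have h0 z : (0 <= h z)%E by rewrite lee_fin mulr_ge0// sqr_ge0.
have := @fubini_tonelli _ _ T (measurableTypeR R) R P (@lebesgue_measure R) h mh h0.
rewrite /fubini_F /fubini_G => e.
transitivity (\int[P]_x \int[@lebesgue_measure R]_y h (x, y))%E.
  by apply: eq_integral => w _; rewrite /carre_du_champ integral_setE.
rewrite e [RHS]integral_mkcond; apply: eq_integral => s _; rewrite patchE /h /= indicE.
case: ifPn => sI; first by apply: eq_integral => w _; rewrite mul1r.
by rewrite integral0_eq// => w _; rewrite mul0r.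
Qed.

(** Integrating n! (n+1)^2 |f_(n+1)(s, .)|^2 over s gives (n+1) (n+1)! |f_(n+1)|^2, the term of
    order n + 1 of L. The kernels that come with [DF] are its own; their weights equal those of [f0]
    by uniqueness. *)
Lemma carre_du_champ_energy F DF L (f0 : forall n, n.-tuple R -> R) :
  chaos_expansion P B f0 F ->
  \sum_(n < N) n%:R * chaos_weight f0 n @[N --> \oo] --> L ->
  malliavin_derivative P B F DF -> (\int[P]_w carre_du_champ DF w = L%:E)%E.
Proof.
move=> e0 cL [mDF [f [e aeD]]]; have [sf F2 _] := e.
have mf n : measurable_fun setT (f n) by have [] := sf n.
pose a n : \bar R := (n`!%:R * n.+1%:R ^+ 2)%:E.
have a0 n : (0 <= a n)%E by rewrite lee_fin mulr_ge0// sqr_ge0.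
pose q n (s : R) : \bar R := sqnorm (fun x : n.-tuple R => f n.+1 [tuple of s :: x]).
have mq n : measurable_fun [set: measurableTypeR R] (q n).
  apply: (@measurable_integral_Rn_slice R n (fun x => (f n.+1 x ^+ 2)%:E)).
    apply/measurable_EFinP; exact: (measurable_funX 2 (mf n.+1)).
  by move=> x; rewrite lee_fin sqr_ge0.
have q0 n s : (0 <= q n s)%E by exact: sqnorm_ge0.
have maq n : measurable_fun [set: measurableTypeR R] (fun s => a n * q n s)%E.
  exact: measurable_funeM.
have aq0 n s : (0 <= a n * q n s)%E by rewrite mule_ge0.
rewrite integral_carre_du_champ//.
rewrite (@ge0_ae_eq_integral _ _ _ lebesgue_measure _ _
  (fun s => \sum_(0 <= n <oo) a n * q n s)%E) => //; last first.
- have [A [mA A0 sA]] := aeD; exists A; split => // s ns; apply: sA => hs; apply: ns.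
  rewrite /= in_itv/= andbT => s0.
  have es := hs s0; have [ss _ _] := es.
  rewrite (chaos_sqnorm es); apply: eq_eseriesr => n _.
  by rewrite sqnormZ ?/a ?EFinM ?muleA//; exact: measurable_slice.
- by move=> s _; apply: nneseries_ge0 => n _ _; exact: aq0.
- by move=> s _; apply: integral_ge0 => w _; rewrite lee_fin sqr_ge0.
- by apply: measurable_funTS; apply: ge0_emeasurable_sum.
- apply: measurable_funTS.
  apply: (@measurable_fun_fubini_tonelli_F _ _ (measurableTypeR R) T R P
    (fun z => (DF z.1 z.2 ^+ 2)%:E)) => [|z]; last by rewrite lee_fin sqr_ge0.
  by apply/measurable_EFinP; exact: (measurable_funX 2 mDF).
rewrite integral_nneseries//; last by move=> n; exact: measurable_funTS.
rewrite (@eq_eseriesr _ _ (fun n => (n.+1%:R * chaos_weight f0 n.+1)%:E)); last first.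
  move=> n _; rewrite ge0_integralZl_EFin//; last exact: measurable_funTS.
  rewrite (chaos_weight_unique hB e0 e) [RHS]EFinM EFin_chaos_weight// muleA -EFinM.
  by congr (_%:E * _)%E; rewrite factS natrM; ring.
apply/cvg_lim => //.
(* The derivative lowers the order by one, so its series is that of L without the term n = 0, which
   vanishes. *)
pose v N := \sum_(n < N) n%:R * chaos_weight f0 n.
have : v N.+1 @[N --> \oo] --> L by rewrite (cvg_shiftS v).
move=> /cvg_EFin_nat.
apply: cvg_trans; apply: near_eq_cvg; apply: nearW => N /=.
by rewrite big_mkord sumEFin /v big_ord_recl /= mul0r add0r.
Qed.

End energy.

Lemma summable_chaos_energy {R : realType} (f : forall n, n.-tuple R -> R) :
  (forall n, symmetric_L2 (f n)) ->
  (\sum_(0 <= n <oo) (n%:R * n`!%:R)%:E * sqnorm (f n) < +oo)%E ->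
  exists L : R, \sum_(n < N) n%:R * chaos_weight f n @[N --> \oo] --> L.
Proof.
move=> sf fin.
have e n : ((n%:R * n`!%:R)%:E * sqnorm (f n) = (n%:R * chaos_weight f n)%:E)%E.
  by rewrite EFinM -muleA -EFin_chaos_weight// -EFinM.
have w0 n : (0 <= (n%:R * chaos_weight f n)%:E)%E.
  by rewrite lee_fin mulr_ge0// chaos_weight_ge0.
rewrite (eq_eseriesr (fun n _ => e n)) in fin.
set S := (\sum_(0 <= n <oo) _)%E in fin.
have finS : S \is a fin_num by rewrite ge0_fin_numE// nneseries_ge0.
exists (fine S).
have c : (\sum_(0 <= n < N) (n%:R * chaos_weight f n)%:E)%E @[N --> \oo] --> S.
  exact: (is_cvg_nneseries (fun n _ _ => w0 n)).
rewrite -(fineK finS) in c; have /fine_cvgP[_] := c.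
apply: cvg_trans; apply: near_eq_cvg; apply: nearW => N /=.
by rewrite sumEFin big_mkord.
Qed.

Unset Implicit Arguments.

Theorem proposition5 (R : realType)
  (d1 : measure_display) (T1 : measurableType d1) (P1 : probability T1 R)
  (d2 : measure_display) (T2 : measurableType d2) (P2 : probability T2 R)
  (B : R -> T1 -> R) (hB : brownian_motion P1 B)
  (G : R -> set (set T2)) (M : R -> T2 -> R) (hM : normal_martingale P2 G M)
  (F : T1 -> R) (hF : OU_domain P1 B F)
  (Ft : R -> T1 * T2 -> R)
  (hFt : forall theta, chaotic_extension P1 P2 B M F theta (Ft theta)) :
  L2_differentiable (P1 \x P2)%E Ft /\
  forall (c : int -> R) (xi : int -> T1 * T2 -> R[i]) (DF : R -> T1 -> R),
    spectral_representation (P1 \x P2)%E Ft c xi ->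
    malliavin_derivative P1 B F DF ->
    forall (theta : R) (dF : T1 * T2 -> R),
      L2_derivative (P1 \x P2)%E Ft theta dF ->
      [/\ ('E_(P1 \x P2)[(fun w => dF w ^+ 2)%R] =
            \esum_(n in [set: int]) (n%:~R ^+ 2 * c n ^+ 2)%:E)%E,
          (\esum_(n in [set: int]) (n%:~R ^+ 2 * c n ^+ 2)%:E =
            \int[P1]_w carre_du_champ DF w)%E &
          (\int[P1]_w carre_du_champ DF w = 2%:E * OU_form P1 DF)%E].
Proof.
have hB1 := brownian_increments hB.
have hM1 := normal_martingale_increments hM.
(* These kernels serve as the reference: those chosen at each angle and those of the derivative are
   related to them through their weights. *)
have [f [e fin]] := hF; have [sf _ _] := e.
have [L cL] := summable_chaos_energy sf fin.
have w0 := chaos_weight_ge0 f.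
have Ft2 theta : Ft theta \in Lfun (P1 \x P2)%E 2%:E.
  by have [g [_ []]] := hFt theta.
have cov alpha beta : \sum_(n < N) cos (alpha - beta) ^+ n * chaos_weight f n
    @[N --> \oo] --> ip (P1 \x P2)%E (Ft alpha) (Ft beta).
  have [g [eg eg']] := hFt alpha; have [g' [eh eh']] := hFt beta.
  exact: (chaos_covariance hB1 (joint_increments_rotation alpha beta hB1 hM1) e eg eg' eh eh').
split; first exact: (mean_square_differentiable w0 cL Ft2 cov).
move=> c xi DF hX hD theta dF hdF; have [dF2 _] := hdF.
have eL := mean_square_derivative_norm w0 cL Ft2 cov hdF.
rewrite (spectral_derivative_norm Ft2 hX hdF) (carre_du_champ_energy hB1 e cL hD) eL.
split => //.
  by rewrite -eL EFin_ip// unlock; apply: eq_integral => w _; rewrite expr2.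
by rewrite /OU_form (carre_du_champ_energy hB1 e cL hD) -!EFinM mulrA mulfV ?mul1r// pnatr_eq0.
Qed.
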